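(* Let $\mathcal{O}$ be a geometric object. Then the result $\mathcal{T}_{ST}(\mathcal{O})$ of the procedure $\mathcal{T}_{ST}$ is a spatio-temporal triangulation of $\mathcal{O}$: each snapshot of $\mathcal{T}_{ST}(\mathcal{O})$ is a spatial triangulation (of the corresponding snapshot of $\mathcal{O}$), and $st(\mathcal{O})=st(\mathcal{T}_{ST}(\mathcal{O}))$.
   Context: Geometric objects. An atomic (geometric) object is a triple $(S,I,f)$, where $S\subset\mathbb{R}^2$ (the spatial reference object) is a filled triangle, allowed to degenerate into a line segment or a point, whose corner points have rational or algebraic coordinates; $I\subset\mathbb{R}$ (the time domain) is a point or an interval; and $f:\mathbb{R}^2\times\mathbb{R}\to\mathbb{R}^2$ (the transformation function) is a time-dependent affinity $(x,y;t)\mapsto A(t)\binom{x}{y}+b(t)$, where the entries of the $2\times 2$ matrix $A(t)$ and of the vector $b(t)$ are rational functions of $t$ (quotients of polynomials with rational coefficients) and $\det A(t)\neq 0$ for all $t\in I$. It represents the set $st(S,I,f)=\{(x,y;t)\mid t\in I,\ (x,y)\in f(S,t)\}$. A geometric object $\mathcal{O}=\{\mathcal{O}_1=(S_1,I_1,f_1),\ldots,\mathcal{O}_n=(S_n,I_n,f_n)\}$ is a finite set of atomic objects; it represents the union $st(\mathcal{O})$ of the sets represented by its atomic objects, and its time domain is the convex closure of the union of their time domains. Its snapshot at time $\tau$ is $\mathcal{O}^\tau=\bigcup_{i:\tau\in I_i}f_i(S_i,\tau)\subseteq\mathbb{R}^2$, given by the triangles $f_i(S_i,\tau)$. Triangulations.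 A collection of (possibly degenerate) filled triangles is a triangulation of a snapshot if the interiors of different triangles are disjoint and their union equals the snapshot (the interior of a line segment is the segment without end points; the interior of a point is the point itself). A geometric object $\{\mathcal{T}_1,\ldots,\mathcal{T}_p\}$ is a (spatio-temporal) triangulation of $\mathcal{O}$ if for each $\tau$ in the time domain of $\mathcal{O}$ the triangles $\mathcal{T}_1^\tau,\ldots,\mathcal{T}_p^\tau$ (some of which may be empty) form a triangulation of $\mathcal{O}^\tau$, and $st(\mathcal{O})=st(\{\mathcal{T}_1,\ldots,\mathcal{T}_p\})$. Procedure Partition. On input $\mathcal{O}$: (1) let $\chi$ be the sorted list of all begin and end points of the $I_i$; (2) let $\mathcal{C}$ consist of the objects $(S_{i,\ell},I_i,f_i)$, $1\le i\le n$, $1\le\ell\le 3$, where $S_{i,1},S_{i,2},S_{i,3}$ are the boundary segments of $S_i$; the (time-dependent) carrier of such an object is the line through $f_i(S_{i,\ell},t)$; (3) for all pairs $(S_{i,\ell_1},I_i,f_i),(S_{j,\ell_2},I_j,f_j)$ of $\mathcal{C}$ with $1\le i<j\le n$, $1\le\ell_1,\ell_2\le3$ and $I_i\cap I_j\neq\emptyset$, compute the end points of the intervals during which the intersection of the two carriers exists, and add those lying within $I_i\cap I_j$ to $\chi$; (4) for all triples $(S_{i,\ell_1},I_i,f_i),(S_{j,\ell_2},I_j,f_j),(S_{k,\ell_3},I_k,f_k)$ of $\mathcal{C}$ with $1\le i<j<k\le n$, $1\le\ell_1,\ell_2,\ell_3\le3$ and $I_i\cap I_j\cap I_k\neq\emptyset$,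 compute the end points of the intervals during which the three carriers intersect in one point, and add those lying within $I_i\cap I_j\cap I_k$ to $\chi$; (5) return the sorted list $\chi$, which partitions the time domain into the listed points $\tau_j$ and the open intervals $]\tau_j,\tau_{j+1}[$. Spatial triangulation method $\mathcal{T}_S$. The input is a set $S\subset\mathbb{R}^2$ given as a finite set of (possibly overlapping, possibly degenerate) triangles. Compute the set $\mathcal{B}(S)$ of all line segments bounding an input triangle that contribute to the boundary of $S$ (contain an edge of the boundary), the planar subdivision $\mathcal{U}(S)$ induced by the input triangles, and the convex hull of $S$. The lines through the segments in $\mathcal{B}(S)$ subdivide the convex hull into open convex polygons, open line segments and points. For each polygon, let $a$ be its center of mass, computed as the average of its vertices; if $a$ belongs to a face of $\mathcal{U}(S)$ (so that the polygon belongs to $S$), add to the output, for each edge $a_sa_e$ of the polygon, the closed triangle with corner points $a,a_s,a_e$. Lower-dimensional parts: input points that are not part of an input segment or triangle are added to the output directly, and for each open line segment of the subdivision that is part of an input line segment contributing to the boundary of $S$, its closure is added to the output. (The formal description of the method is given under the simplification that $S$ is fully two-dimensional or, equivalently, that points and line segments not adjacent to a polygon belonging to $S$ are already in the output.) Procedure Triangulate. Input: $\mathcal{O}$ and $\chi=(\tau_1,\ldots,\tau_k)$. (i) For each $\tau_j$ in $\chi$ and each triangle $T$ in $\mathcal{T}_S(\mathcal{O}^{\tau_j})$, return the atomic object $(T,\{\tau_j\},\mathrm{Id})$. (ii) For each pair of consecutive moments $\tau_j,\tau_{j+1}$ of $\chi$, let $\tau_m=\frac12(\tau_j+\tau_{j+1})$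 and compute the spatial triangulation of the snapshot $\mathcal{O}^{\tau_m}$ by $\mathcal{T}_S$, copying every action on a point or line segment at time $\tau_m$ to the moving point or moving line segment of which it is the snapshot (so that whenever an intersection point of two carriers or a center of mass is computed, the formula, in rational functions of $t$, for the corresponding moving point is computed as well). For each triangle $T$ so obtained, output the atomic object $(T,\,]\tau_j,\tau_{j+1}[,\,f)$, where the transformation function $f$ is computed from the functions describing the moving corner points of $T$. Procedure Merge. Run through the elements (points and intervals) of the time partition in order, merging consecutive ones when possible. A point $\tau$ and an adjacent interval $J$ can be merged if there is a one-to-one mapping $M$ from the atomic objects with time domain $J$ to those with time domain $\{\tau\}$ such that $(S_2,\{\tau\},\mathrm{Id})=M((S_1,J,f_1))$ if and only if $\lim_{t\to\tau}f_1(S_1,t)=S_2$ (one-sided limit from within $J$; this equals $f_1(S_1,\tau)$ provided $\tau$ is in the domain of $f_1$, i.e., its coefficients are well-defined and its determinant is nonzero at $\tau$); the objects at $\tau$ are then removed and the time domains of the objects on $J$ extended to $J\cup\{\tau\}$. Two adjacent intervals, one ending openly at $\tau$ and one containing its end point $\tau$ (or symmetrically), can be merged if the objects of each interval have transformation functions whose domain includes the other interval, if the open one can be extended to $\tau$ by the tests above, and if for matching atomic objects the combination is again an atomic object, i.e., the transformation functions coincide once the same reference object is chosen. Procedure $\mathcal{T}_{ST}$. On input $\mathcal{O}$: compute $\chi$ by Partition; apply Triangulate to $\mathcal{O}$ and $\chi$; if $\chi$ has more than one element, apply Merge to the result; return the resulting set of atomic objects.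
   Formalization: Partition also treats the corner points of each S_i as (point) carriers in steps (3) and (4); coefficients of transformation functions may be real algebraic, not only rational; in T_S the open segments added for lower-dimensional parts are those of the planar subdivision U(S). *)

(* Defs.v *)
From HB Require Import structures.
From mathcomp Require Import all_boot all_order all_algebra.
From mathcomp Require Import all_classical all_reals.
From mathcomp Require Import topology normedtype.
From Stdlib Require List.
Set Implicit Arguments.
Unset Strict Implicit.
Unset Printing Implicit Defensive.
Import Order.TTheory GRing.Theory Num.Theory.
Import numFieldNormedType.Exports.
Local Open Scope classical_set_scope.
Local Open Scope ring_scope.

(* The constants (corner coordinates, coefficients of the transformation
   functions, end points of the time domains) are taken in a subfield [K] of
   the reals that is algebraically closed in [R].  The main instance is the
   field of real algebraic numbers ([algebraic_constant_field]).  The whole of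
   [R] is also allowed ([real_constant_field]); it covers time domains with
   transcendental end points.  The rational numbers belong to every [K]. *)
Definition constant_field (R : realType) (K : {pred R}) : Prop :=
  GRing.divring_closed K /\
  forall (p : {poly R}) (x : R),
    p != 0 -> p \is a polyOver K -> root p x -> x \in K.

Definition real_algebraic (R : realType) : {pred R} :=
  fun x => `[< algebraicOver (ratr : rat -> R) x >].

Lemma algebraic_constant_field (R : realType) :
  constant_field (@real_algebraic R).
Proof.
have inP (x : R) : (x \in @real_algebraic R) =
    `[< algebraicOver (ratr : rat -> R) x >] by [].
split.
  split=> [|x y|x y]; rewrite !inP.
  - by apply/asboolP; apply: algebraic1.
  - by move=> /asboolP hx /asboolP hy; apply/asboolP; apply: algebraic_sub.
  - by move=> /asboolP hx /asboolP hy; apply/asboolP; apply: algebraic_div.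
move=> p x p0 /allP pK px; rewrite inP; apply/asboolP/integral_algebraic.
apply: (integral_root p0 px) => c /pK; rewrite [mem _ _]inP => /asboolP.
by move/integral_algebraic.
Qed.

Lemma real_constant_field (R : realType) : constant_field (@predT R).
Proof. by []. Qed.

Definition pt (R : realType) : Type := 'cV[R]_2.

Definition px (R : realType) (p : pt R) : R := p ord0 ord0.
Definition py (R : realType) (p : pt R) : R := p ord_max ord0.

Definition cross (R : realType) (u v : pt R) : R := px u * py v - py u * px v.

Definition topo_boundary (T : topologicalType) (X : set T) : set T :=
  closure X `\` interior X.

Definition conv (R : realType) (s : seq (pt R)) : set (pt R) :=
  [set x | exists w : 'I_(size s) -> R,
     [/\ forall i, 0 <= w i, \sum_i w i = 1
       & x = \sum_i w i *: s`_i]].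

Definition open_segment (R : realType) (p q : pt R) : set (pt R) :=
  conv [:: p; q] `\` [set p; q].

Definition extreme_point (R : realType) (X : set (pt R)) (p : pt R) : Prop :=
  X p /\ forall (x y : pt R) (s : R), X x -> X y -> 0 < s -> s < 1 ->
    p = s *: x + (1 - s) *: y -> x = y.

(* A filled triangle, possibly degenerate, is given by its corner points. *)
Definition tri (R : realType) : Type := 3.-tuple (pt R).

Definition tri_set (R : realType) (T : tri R) : set (pt R) := conv T.

Definition corner (R : realType) (T : tri R) (k : 'I_3) : pt R := tnth T k.

Definition tri_is_point (R : realType) (T : tri R) : Prop :=
  forall k l, corner T k = corner T l.

Definition tri_is_flat (R : realType) (T : tri R) : Prop :=
  cross (T`_1 - T`_0) (T`_2 - T`_0) = 0.

Definition tri_is_segment (R : realType) (T : tri R) : Prop :=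
  tri_is_flat T /\ ~ tri_is_point T.

(* The end points of a segment are its extreme points. *)
Definition tri_interior (R : realType) (T : tri R) : set (pt R) :=
  [set x | [\/ ~ tri_is_flat T /\ interior (tri_set T) x,
               tri_is_segment T /\ tri_set T x /\
                 ~ extreme_point (tri_set T) x
             | tri_is_point T /\ tri_set T x]].

Definition covered (R : realType) (D : seq (tri R)) : set (pt R) :=
  [set x | exists2 T, T \in D & tri_set T x].

Definition is_triangulation (R : realType) (D : seq (tri R)) (X : set (pt R)) :
    Prop :=
  (forall T T', T \in D -> T' \in D -> tri_set T <> tri_set T' ->
     tri_interior T `&` tri_interior T' = set0) /\
  covered D = X.

(* A quotient (numerator, denominator) of polynomials. *)
Definition ratfun (R : realType) : Type := ({poly R} * {poly R})%type.

Definition rf_defined (R : realType) (t : R) (r : ratfun R) : bool :=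
  r.2.[t] != 0.
Definition rf_val (R : realType) (t : R) (r : ratfun R) : R :=
  r.1.[t] / r.2.[t].
Definition rf_over (R : realType) (K : {pred R}) (r : ratfun R) : bool :=
  (r.1 \is a polyOver K) && (r.2 \is a polyOver K).

(* The time-dependent affinity (x, t) |-> A(t) x + b(t). *)
Record trans (R : realType) : Type :=
  Trans { lin_part : 'M[ratfun R]_2; shift_part : 'cV[ratfun R]_2 }.

Definition lin_at (R : realType) (f : trans R) (t : R) : 'M[R]_2 :=
  map_mx (rf_val t) (lin_part f).

Definition shift_at (R : realType) (f : trans R) (t : R) : 'cV[R]_2 :=
  map_mx (rf_val t) (shift_part f).

Definition trans_at (R : realType) (f : trans R) (t : R) (x : pt R) : pt R :=
  lin_at f t *m x + shift_at f t.

(* [t] is in the domain of [f]: the coefficients of [f] are well defined at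
   [t] and the determinant does not vanish there. *)
Definition trans_defined (R : realType) (f : trans R) (t : R) : Prop :=
  [/\ forall i j, rf_defined t (lin_part f i j),
      forall i, rf_defined t (shift_part f i ord0)
    & \det (lin_at f t) != 0].

Definition trans_over (R : realType) (K : {pred R}) (f : trans R) : Prop :=
  (forall i j, rf_over K (lin_part f i j)) /\
  (forall i, rf_over K (shift_part f i ord0)).

Definition trans_id (R : realType) : trans R :=
  Trans (\matrix_(i, j) ((i == j)%:R%:P, 1)) (\matrix_(i, j) (0, 1)).

Record atomic (R : realType) : Type :=
  Atomic { ref_obj : tri R; time_dom : interval R; tfun : trans R }.

(* A point or a bounded interval with end points [x <= y] in [K]. *)
Definition time_interval (R : realType) (K : {pred R}) (I : interval R) :
    Prop :=
  (exists t, t \in I) /\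
  exists bx x b_y y,
    [/\ I = Interval (BSide bx x) (BSide b_y y), x \in K & y \in K].

Definition atomic_object (R : realType) (K : {pred R}) (a : atomic R) : Prop :=
  [/\ forall k i, corner (ref_obj a) k i ord0 \in K,
      time_interval K (time_dom a),
      trans_over K (tfun a)
    & forall t, t \in time_dom a -> trans_defined (tfun a) t].

(* A finite set of atomic objects, presented as a list. *)
Definition geometric_object (R : realType) (K : {pred R}) (O : seq (atomic R)) :
    Prop :=
  forall a, List.In a O -> atomic_object K a.

(* The triangle f(S, t), given by the images of the corners of S. *)
Definition tri_at (R : realType) (a : atomic R) (t : R) : tri R :=
  map_tuple (trans_at (tfun a) t) (ref_obj a).

Definition st (R : realType) (O : seq (atomic R)) : set (pt R * R) :=
  [set z | exists2 a, List.In a O &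
     z.2 \in time_dom a /\
     (trans_at (tfun a) z.2 @` tri_set (ref_obj a)) z.1].

Definition snapshot (R : realType) (O : seq (atomic R)) (t : R) : set (pt R) :=
  [set x | exists2 a, List.In a O &
     t \in time_dom a /\ (trans_at (tfun a) t @` tri_set (ref_obj a)) x].

Definition active (R : realType) (O : seq (atomic R)) (t : R) :
    seq (atomic R) := [seq a <- O | t \in time_dom a].

(* The triangles occupied at time [t] by the objects active at time [m]. *)
Definition frame (R : realType) (O : seq (atomic R)) (m t : R) : seq (tri R) :=
  [seq tri_at a t | a <- active O m].

Definition object_time_domain (R : realType) (O : seq (atomic R)) : set R :=
  [set t | exists a b s u, [/\ List.In a O, List.In b O, s \in time_dom a,
     u \in time_dom b & s <= t <= u]].

Definition st_triangulation (R : realType) (K : {pred R})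
    (O G : seq (atomic R)) : Prop :=
  [/\ geometric_object K G,
      forall t, object_time_domain O t ->
        is_triangulation (frame G t t) (snapshot O t)
    & st O = st G].

(* Elements of the boundary of an object are indexed by pairs of corners: the
   pair [(k, l)] is the segment between the corners [k] and [l].  The pairs
   with [k = l] are the end points of these segments, viewed as degenerate
   segments whose carrier is a point.  They are needed: the moment at which a
   corner of one triangle crosses a side of another one is not a moment at
   which the sides of three different objects are concurrent, and the end
   points of a degenerate triangle are not intersections of its carriers. *)
Definition carrier (R : realType) (T : tri R) (kl : 'I_3 * 'I_3) :
    set (pt R) :=
  [set x | exists s : R,
     x = corner T kl.1 + s *: (corner T kl.2 - corner T kl.1)].

Definition meeting_times (R : realType) (a b : atomic R) (k l : 'I_3 * 'I_3) :
    set R :=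
  [set t | [/\ t \in time_dom a, t \in time_dom b
     & exists x, carrier (tri_at a t) k x /\ carrier (tri_at b t) l x]].

Definition concurrence_times (R : realType) (a b c : atomic R)
    (k l m : 'I_3 * 'I_3) : set R :=
  [set t | [/\ t \in time_dom a, t \in time_dom b, t \in time_dom c
     & exists x, carrier (tri_at a t) k `&` carrier (tri_at b t) l `&`
                 carrier (tri_at c t) m = [set x]]].

Definition is_endpoint (R : realType) (I : interval R) (t : R) : Prop :=
  exists b r, I = Interval (BSide b t) r \/ I = Interval r (BSide b t).

(* The end points of the maximal intervals of a set of moments are the points
   of its topological boundary. *)
Definition moment (R : realType) (O : seq (atomic R)) (t : R) : Prop :=
  [\/ exists2 a, List.In a O & is_endpoint (time_dom a) t,
      exists i j : 'I_(size O), exists k l,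
        let a := tnth (in_tuple O) in
        [/\ (i < j)%N, t \in time_dom (a i), t \in time_dom (a j)
          & topo_boundary (meeting_times (a i) (a j) k l) t]
    | exists i j h : 'I_(size O), exists k l m,
        let a := tnth (in_tuple O) in
        [/\ (i < j < h)%N,
            [/\ t \in time_dom (a i), t \in time_dom (a j)
              & t \in time_dom (a h)]
          & topo_boundary (concurrence_times (a i) (a j) (a h) k l m) t]].

Definition time_partition (R : realType) (O : seq (atomic R)) (chi : seq R) :
    Prop :=
  sorted <%R chi /\ forall t, t \in chi <-> moment O t.

(* [(i, (k, l))] is the segment between the corners [k] and [l] of the [i]-th
   input triangle. *)
Definition side : Type := (nat * ('I_3 * 'I_3))%type.

(* Symbolic descriptions of the points computed by the method.  Evaluating the
   same description in the snapshots at other moments gives the moving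
   point. *)
Inductive vertex : Type :=
| Corner of nat & 'I_3
| Meet of side & side.

Inductive point_expr : Type :=
| Vertex of vertex
| Centroid of seq vertex.

Definition tri_expr : Type := (point_expr * point_expr * point_expr)%type.

Definition input_tri (R : realType) (D : seq (tri R)) (i : nat) : tri R :=
  nth [tuple 0 | k < 3] D i.

Definition src (R : realType) (D : seq (tri R)) (c : side) : pt R :=
  corner (input_tri D c.1) c.2.1.
Definition tgt (R : realType) (D : seq (tri R)) (c : side) : pt R :=
  corner (input_tri D c.1) c.2.2.
Definition dir (R : realType) (D : seq (tri R)) (c : side) : pt R :=
  tgt D c - src D c.
Definition side_set (R : realType) (D : seq (tri R)) (c : side) :
    set (pt R) := conv [:: src D c; tgt D c].

Definition eval_vertex (R : realType) (D : seq (tri R)) (v : vertex) : pt R :=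
  match v with
  | Corner i k => corner (input_tri D i) k
  | Meet c d =>
      (* the intersection point of the lines through [c] and [d] *)
      src D c + (cross (src D d - src D c) (dir D d) /
                 cross (dir D c) (dir D d)) *: dir D c
  end.

Definition eval_point (R : realType) (D : seq (tri R)) (e : point_expr) :
    pt R :=
  match e with
  | Vertex v => eval_vertex D v
  | Centroid s => (size s)%:R^-1 *: \sum_(v <- s) eval_vertex D v
  end.

Definition eval_tri (R : realType) (D : seq (tri R)) (e : tri_expr) : tri R :=
  [tuple eval_point D e.1.1; eval_point D e.1.2; eval_point D e.2].

Definition is_side (R : realType) (D : seq (tri R)) (c : side) : Prop :=
  (c.1 < size D)%N /\ src D c <> tgt D c.

(* B(S): the sides that contain an edge of the boundary of S. *)
Definition boundary_side (R : realType) (D : seq (tri R)) (c : side) : Prop :=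
  is_side D c /\
  exists x y, x <> y /\
    conv [:: x; y] `<=` side_set D c `&` topo_boundary (covered D).

Definition hull (R : realType) (D : seq (tri R)) : set (pt R) :=
  conv (flatten [seq tval T | T <- D]).

(* The open polygons into which the lines through the segments of B(S)
   subdivide the convex hull; [line_side] tells on which side of the line
   through [c] the point [x] lies. *)
Definition line_side (R : realType) (D : seq (tri R)) (c : side) (x : pt R) :
    R := cross (dir D c) (x - src D c).

Definition is_polygon (R : realType) (D : seq (tri R)) (P : set (pt R)) :
    Prop :=
  exists x0, [/\ interior (hull D) x0,
    forall c, boundary_side D c -> line_side D c x0 != 0
  & P = [set x | interior (hull D) x /\
           forall c, boundary_side D c ->
             0 < line_side D c x0 * line_side D c x]].

Definition polygon_vertex (R : realType) (P : set (pt R)) (p : pt R) : Prop :=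
  extreme_point (closure P) p.

(* [s] computes the vertices of [P], each of them once, as intersection points
   of the lines through the segments of B(S). *)
Definition computes_vertices (R : realType) (D : seq (tri R)) (P : set (pt R))
    (s : seq vertex) : Prop :=
  [/\ forall v, List.In v s -> exists c d,
        [/\ v = Meet c d, boundary_side D c, boundary_side D d
          & cross (dir D c) (dir D d) != 0],
      uniq (map (eval_vertex D) s)
    & forall p, p \in map (eval_vertex D) s <-> polygon_vertex P p].

(* The polygon belongs to S iff [P `<=` covered D]; this cannot be read off
   the open faces of U(S) alone, since the center of mass may lie on an edge of
   U(S) that is interior to S.
   Two vertices of the open convex polygon [P] span an edge iff the segment
   between them does not meet [P]. *)
Definition TS_polygon_part (R : realType) (D : seq (tri R)) (e : tri_expr) :
    Prop :=
  exists P s u v,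
    [/\ is_polygon D P /\ P `<=` covered D,
        computes_vertices D P s,
        List.In u s /\ List.In v s,
        eval_vertex D u <> eval_vertex D v /\
        conv [:: eval_vertex D u; eval_vertex D v] `&` P = set0
      & e = (Centroid s, Vertex u, Vertex v)].

(* The vertices of the planar subdivision U(S) induced by the input. *)
Definition subdivision_vertex (R : realType) (D : seq (tri R)) (v : vertex) :
    Prop :=
  match v with
  | Corner i _ => (i < size D)%N
  | Meet c d =>
      [/\ is_side D c, is_side D d, cross (dir D c) (dir D d) != 0
        & (side_set D c `&` side_set D d) (eval_vertex D v)]
  end.

(* The open segments of U(S) that are part of an input line segment and of the
   boundary of S. *)
Definition TS_segment_part (R : realType) (D : seq (tri R)) (e : tri_expr) :
    Prop :=
  exists u v,
    let p := eval_vertex D u in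
    let q := eval_vertex D v in
    [/\ subdivision_vertex D u /\ subdivision_vertex D v,
        p <> q /\
        (forall w, subdivision_vertex D w ->
           ~ open_segment p q (eval_vertex D w)),
        exists T, [/\ T \in D, tri_is_segment T
                    & open_segment p q `<=` tri_set T],
        open_segment p q `<=` topo_boundary (covered D)
      & e = (Vertex u, Vertex v, Vertex v)].

Definition TS_point_part (R : realType) (D : seq (tri R)) (e : tri_expr) :
    Prop :=
  exists i,
    let p := Vertex (Corner i ord0) in
    [/\ (i < size D)%N, tri_is_point (input_tri D i),
        forall T, T \in D -> ~ tri_is_point T -> ~ tri_set T (eval_point D p)
      & e = (p, p, p)].

Definition TS_triangle (R : realType) (D : seq (tri R)) (e : tri_expr) : Prop :=
  [\/ TS_polygon_part D e, TS_segment_part D e | TS_point_part D e].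

(* [L] is an output of the method: every triangle to be returned is described
   by exactly one element of [L]. *)
Definition TS (R : realType) (D : seq (tri R)) (L : seq tri_expr) : Prop :=
  [/\ forall e, List.In e L -> TS_triangle D e,
      forall e, TS_triangle D e -> exists2 e', List.In e' L &
        tri_set (eval_tri D e') = tri_set (eval_tri D e)
    & forall (e0 : tri_expr) i j, (i < j < size L)%N ->
        tri_set (eval_tri D (nth e0 L i)) <>
        tri_set (eval_tri D (nth e0 L j))].

Definition triangulate_moment (R : realType) (O : seq (atomic R)) (t : R)
    (G : seq (atomic R)) : Prop :=
  exists2 L, TS (frame O t t) L &
    G = [seq Atomic (eval_tri (frame O t t) e) `[t, t] (trans_id R) | e <- L].

(* The transformation function is the one that takes the corners of the
   triangle at the middle moment [m] to the moving corners. *)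
Definition triangulate_interval (R : realType) (K : {pred R})
    (O : seq (atomic R)) (x y : R) (G : seq (atomic R)) : Prop :=
  let m := (x + y) / 2 in
  exists2 L, TS (frame O m m) L &
    List.Forall2 (fun e a =>
      [/\ ref_obj a = eval_tri (frame O m m) e,
          time_dom a = `]x, y[,
          trans_over K (tfun a),
          forall t, t \in `]x, y[ -> trans_defined (tfun a) t
        & forall t, t \in `]x, y[ -> tri_at a t = eval_tri (frame O m t) e])
      L G.

(* An element of the time partition with the atomic objects living on it. *)
Definition slice (R : realType) : Type := (interval R * seq (atomic R))%type.

Inductive triangulate (R : realType) (K : {pred R}) (O : seq (atomic R)) :
    seq R -> seq (slice R) -> Prop :=
| triangulate_nil : triangulate K O [::] [::]
| triangulate_last t G :
    triangulate_moment O t G -> triangulate K O [:: t] [:: (`[t, t], G)]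
| triangulate_cons t u s G H E :
    triangulate_moment O t G ->
    triangulate_interval K O t u H ->
    triangulate K O (u :: s) E ->
    triangulate K O (t :: u :: s) [:: (`[t, t], G), (`]t, u[, H) & E].

Definition set_time_dom (R : realType) (I : interval R) (a : atomic R) :
    atomic R := Atomic (ref_obj a) I (tfun a).

Definition matching (R : realType) (G H : seq (atomic R))
    (same : atomic R -> atomic R -> Prop)
    (M : 'I_(size G) -> 'I_(size H)) : Prop :=
  bijective M /\
  forall i j, M i = j <->
    same (tnth (in_tuple G) i) (tnth (in_tuple H) j).

(* The objects [G] of an adjacent interval can be extended to the moment [t],
   at which the objects are [H].  As [t] is in the domain of the transformation
   functions, the one-sided limits are values. *)
Definition extends_to_moment (R : realType) (t : R) (G H : seq (atomic R)) :
    Prop :=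
  (forall a, List.In a G -> trans_defined (tfun a) t) /\
  exists M, @matching R G H
    (fun a b => tri_set (tri_at a t) = tri_set (ref_obj b)) M.

(* The transformation functions coincide once the reference object of [a] is
   moved to that of [b] by an affinity. *)
Definition same_motion (R : realType) (I : interval R) (a b : atomic R) :
    Prop :=
  exists (P : 'M[R]_2) (v : 'cV[R]_2),
    [/\ P \in unitmx,
        (fun x => P *m x + v) @` tri_set (ref_obj a) = tri_set (ref_obj b)
      & forall t x, t \in I ->
          trans_at (tfun a) t x = trans_at (tfun b) t (P *m x + v)].

(* Two adjacent intervals have a common bound [BSide b t], so that exactly one
   of them contains [t]; their union has the two remaining bounds. *)
Definition mergeable_intervals (R : realType) (l r : itv_bound R) (b : bool)
    (t : R) (G H : seq (atomic R)) : Prop :=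
  [/\ forall a s, List.In a G -> s \in Interval (BSide b t) r ->
        trans_defined (tfun a) s,
      forall a s, List.In a H -> s \in Interval l (BSide b t) ->
        trans_defined (tfun a) s,
      (forall a, List.In a (G ++ H) -> trans_defined (tfun a) t)
    & exists M, @matching R G H
        (fun a c => tri_set (tri_at a t) = tri_set (tri_at c t)) M /\
        forall i, same_motion (Interval l r)
          (tnth (in_tuple G) i) (tnth (in_tuple H) (M i))].

Inductive merge2 (R : realType) : slice R -> slice R -> slice R -> Prop :=
| merge_moment_interval t u b G H :
    t < u -> extends_to_moment t H G ->
    let I := Interval (BLeft t) (BSide b u) in
    merge2 (`[t, t], G) (Interval (BRight t) (BSide b u), H)
           (I, map (set_time_dom I) H)
| merge_interval_moment t u b G H :
    u < t -> extends_to_moment t G H ->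
    let I := Interval (BSide b u) (BRight t) in
    merge2 (Interval (BSide b u) (BLeft t), G) (`[t, t], H)
           (I, map (set_time_dom I) G)
| merge_interval_interval bx x b t b_y y G H :
    x < t -> t < y ->
    mergeable_intervals (BSide bx x) (BSide b_y y) b t G H ->
    let I := Interval (BSide bx x) (BSide b_y y) in
    merge2 (Interval (BSide bx x) (BSide b t), G)
           (Interval (BSide b t) (BSide b_y y), H)
           (I, map (set_time_dom I) G).

(* Consecutive slices are merged whenever that is possible. *)
Inductive merging (R : realType) : seq (slice R) -> seq (slice R) -> Prop :=
| merge_nil : merging [::] [::]
| merge_last e : merging [:: e] [:: e]
| merge_yes e1 e2 e s E :
    merge2 e1 e2 e -> merging (e :: s) E -> merging [:: e1, e2 & s] E
| merge_no e1 e2 s E :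
    (forall e, ~ merge2 e1 e2 e) -> merging (e2 :: s) E ->
    merging [:: e1, e2 & s] (e1 :: E).

(* [G] is a result of the procedure on input [O]. *)
Definition TST (R : realType) (K : {pred R}) (O G : seq (atomic R)) : Prop :=
  exists chi E E',
    [/\ time_partition O chi,
        triangulate K O chi E,
        if (1 < size chi)%N then merging E E' else E' = E
      & G = flatten (map snd E')].

(* Main.v *)
(** Between two consecutive moments of the time partition the arrangement of the
    carriers keeps its combinatorial type: coincidences of corners, the side of
    a carrier on which a corner or an intersection point lies, and the order of
    such points along a carrier can only change when two or three carriers of
    distinct objects start or stop meeting, and the quantities involved are
    rational functions of time, so their signs are constant by the intermediate
    value theorem.  The output of the spatial method depends on this
    combinatorial type only, because an edge of the boundary, and a polygon
    contained in the snapshot, can be recognised from signs at vertices.  At a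
    fixed time, a generic path that leaves the snapshot S does so through a side
    in B(S); hence every polygon that meets the interior of S lies in S, and the
    fans over these polygons together with the lower-dimensional parts
    triangulate S.  Finally, merging does not change the sets occupied at any
    given time. *)

From HB Require Import structures.
Require Import Defs.
From mathcomp Require Import all_boot all_order all_algebra all_classical all_reals.
From mathcomp Require Import topology normedtype ring lra.
From Stdlib Require List.
Set Implicit Arguments.
Unset Strict Implicit.
Unset Printing Implicit Defensive.
Import Order.TTheory GRing.Theory Num.Theory.
Import numFieldNormedType.Exports.
Local Open Scope classical_set_scope.
Local Open Scope ring_scope.

(** * Sequences *)

(** The spatial method outputs symbolic descriptions, so it suffices that one list is an output for
    all snapshots of an open interval; the transformation functions are then interpolated from the
    moving corners. The relation [equi] records what has to be constant. The obstacle is that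
    polygons, coverage and boundary are sets of points, while the partition controls only the zeros
    of finitely many expressions. Hence everything is reduced to signs at [valid] vertices, and
    centroids, whose signs are not recorded, inherit them from vertices. The partition says nothing
    about two sides of a single object; there an affinity multiplies all cross products by its
    determinant, so their zeros never move. Incidences of corners with lines or with corners are
    meetings of degenerate carriers. For existence, the times at which carriers meet are described
    by equations over [K] and their negations; their boundaries consist of roots of polynomials over
    [K], so there are finitely many moments, and the constants of the output stay in [K]. *)

Lemma In_mem (T : eqType) (x : T) (s : seq T) : List.In x s <-> x \in s.
Proof.
elim: s => [|y s IH] //=; rewrite inE; split.
  by move=> [->|/IH ->]; rewrite ?eqxx ?orbT.
by move=> /orP [/eqP ->|/IH]; [left|right].
Qed.

Lemma nth_In (A : Type) (x0 : A) (s : seq A) i : (i < size s)%N -> List.In (nth x0 s i) s.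
Proof. by elim: s i => // a s IH [|i] hi; [left|right; apply: IH]. Qed.

Lemma tnth_In (A : Type) (s : seq A) i : List.In (tnth (in_tuple s) i) s.
Proof. by rewrite (tnth_nth (tnth (in_tuple s) i)); apply: nth_In; apply: ltn_ord. Qed.

Lemma In_tnth (A : Type) (s : seq A) z : List.In z s -> exists i, tnth (in_tuple s) i = z.
Proof.
move=> hz; suff [i hi ei] : exists2 i, (i < size s)%N & nth z s i = z.
  by exists (Ordinal hi); rewrite (tnth_nth z).
elim: s hz => //= w s IH [->|/IH [i hi ei]]; first by exists 0%N.
by exists i.+1.
Qed.

Lemma mem_map_In (A : Type) (B : eqType) (f : A -> B) (s : seq A) z :
  z \in map f s <-> exists2 w, List.In w s & z = f w.
Proof.
split.
  elim: s => //= a s IH; rewrite inE => /orP [/eqP ->|/IH [w hw ->]].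
    by exists a => //; left.
  by exists w => //; right.
case=> w + ->; elim: s => //= a s IH [->|/IH h]; rewrite inE ?eqxx //.
by rewrite h orbT.
Qed.

Lemma In_filter (A : Type) (p : pred A) (s : seq A) z :
  List.In z (seq.filter p s) <-> List.In z s /\ p z.
Proof.
elim: s => [|a s IH] /=; first by split=> // -[].
case: ifP => pa /=; rewrite IH; split.
- by move=> [<-|[h1 h2]]; split; auto.
- by move=> [[->|h1] h2]; auto.
- by move=> [h1 h2]; auto.
- by move=> [[e|h1] h2]; [rewrite -e pa in h2|].
Qed.

Lemma filter_In (T : Type) (p q : pred T) (s : seq T) :
  (forall z, List.In z s -> p z = q z) -> seq.filter p s = seq.filter q s.
Proof.
elim: s => //= z s IH h; rewrite (h z); last by left.
by rewrite IH // => w hw; apply: h; right.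
Qed.

Lemma choose_list (A B : Type) (cs : seq A) (Q : B -> Prop) (S : A -> B -> Prop) :
  (forall a, List.In a cs -> exists2 b, Q b & S a b) ->
  exists vs, (forall b, List.In b vs -> Q b) /\
    forall a, List.In a cs -> exists2 b, List.In b vs & S a b.
Proof.
elim: cs => [|a cs IH] h; first by exists [::]; split.
have [|vs [h1 h2]] := IH; first by move=> a' ha'; apply: h; right.
have [b Qb Sb] := h a (or_introl erefl).
exists (b :: vs); split; first by move=> b' [<-|/h1].
move=> a' [<-|/h2 [b' hb' Sb']]; first by exists b => //; left.
by exists b' => //; right.
Qed.

(** Induction on the finite list of possible values: [P] is restricted to the points whose value is
    not [y], and one witness for [y] is put in front if there is one. It produces both the outputs
    of the spatial method and the vertex lists of polygons. *)
Lemma representatives (A B : Type) (P : A -> Prop) (f : A -> B) (ys : seq B) :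
  (forall x, P x -> List.In (f x) ys) ->
  exists L, [/\ forall x, List.In x L -> P x,
    forall x, P x -> exists2 x', List.In x' L & f x' = f x
    & forall x0 i j, (i < j < size L)%N -> f (nth x0 L i) <> f (nth x0 L j)].
Proof.
elim: ys P => [|y ys IH] P h.
  by exists [::]; split => // [x /h //|x0 i j]; rewrite andbC.
have [|L [h1 h2 h3]] := IH (fun x => P x /\ f x <> y).
  by move=> x [/h /= [e|//] ne]; exfalso; apply: ne.
case: (pselect (exists2 x, P x & f x = y)) => [[x Px fx]|hn].
  exists (x :: L); split.
  - by move=> z [<-//|/h1 []].
  - move=> z Pz; case: (pselect (f z = y)) => e; first by exists x; [left|rewrite fx].
    by have [x' hx' e'] := h2 z (conj Pz e); exists x' => //; right.
  - move=> x0 [|i] [|j] //=; last exact: h3.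
    rewrite ltnS => jL.
    have /h1 [_ ne] : List.In (nth x0 L j) L by apply: nth_In.
    by rewrite fx => e; apply: ne.
exists L; split => // [x /h1 [] //|x Px]; apply: h2; split => // e; apply: hn.
by exists x.
Qed.

(** * The plane *)

Section Plane.
Variable R : realType.
Implicit Types (p q x y z u v d : pt R) (a b c e r s t : R) (X Y : set (pt R)).

Lemma ptP p q : px p = px q -> py p = py q -> p = q.
Proof.
rewrite /px /py => h0 h1; apply/matrixP => i j; rewrite (ord1 j).
by case: i => [[|[|//]] hi];
  [have -> : Ordinal hi = ord0 by apply: val_inj
  |have -> : Ordinal hi = ord_max by apply: val_inj].
Qed.

Lemma pxD p q : px (p + q) = px p + px q. Proof. by rewrite /px mxE. Qed.
Lemma pyD p q : py (p + q) = py p + py q. Proof. by rewrite /py mxE. Qed.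
Lemma pxN p : px (- p) = - px p. Proof. by rewrite /px mxE. Qed.
Lemma pyN p : py (- p) = - py p. Proof. by rewrite /py mxE. Qed.
Lemma pxZ a p : px (a *: p) = a * px p. Proof. by rewrite /px mxE. Qed.
Lemma pyZ a p : py (a *: p) = a * py p. Proof. by rewrite /py mxE. Qed.
Lemma px0 : px (0 : pt R) = 0. Proof. by rewrite /px mxE. Qed.
Lemma py0 : py (0 : pt R) = 0. Proof. by rewrite /py mxE. Qed.

Definition mkpt a b : pt R := \col_i (if i == ord0 then a else b).
Lemma px_mkpt a b : px (mkpt a b) = a. Proof. by rewrite /px mxE. Qed.
Lemma py_mkpt a b : py (mkpt a b) = b. Proof. by rewrite /py mxE. Qed.

Definition ptE := (px_mkpt, py_mkpt, px0, py0, pxD, pyD, pxN, pyN, pxZ, pyZ).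

Lemma pt_neq0 p : p != 0 -> (px p != 0) \/ (py p != 0).
Proof.
move=> h; case: (eqVneq (px p) 0) => [h1|]; last by left.
right; apply: contraNneq h => h2; apply/eqP; apply: ptP; by rewrite ?h1 ?h2 ptE.
Qed.

Lemma norm2_gt0 p : p != 0 -> 0 < px p * px p + py p * py p.
Proof. by move=> /pt_neq0 [] h; [have : 0 < px p ^+ 2|have : 0 < py p ^+ 2];
  rewrite ?exprn_even_gt0 //= => {}h; nra. Qed.

Lemma sub_neq0 p q : p <> q -> q - p != 0.
Proof. by move=> h; rewrite subr_eq0; apply/eqP => e; apply: h. Qed.

Definition dot u v := px u * px v + py u * py v.

Definition pseg x y s : pt R := x + s *: (y - x).

(** The ball of the sup norm, which is the norm of column vectors; topological arguments in the
    plane are carried out with it. *)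
Definition box e x y := `|px y - px x| < e /\ `|py y - py x| < e.

Lemma nbhs_box x X : nbhs x X <-> exists2 e : R, 0 < e & forall y, box e x y -> X y.
Proof.
split.
  move=> /nbhs_ballP [e /= e0 h]; exists e => // y [h1 h2]; apply: h.
  split=> // i j; rewrite (ord1 j) /ball /= distrC.
  case: i => [[|[|//]] hi];
  [have -> : Ordinal hi = ord0 by apply: val_inj
  |have -> : Ordinal hi = ord_max by apply: val_inj]; by rewrite distrC distrC.
case=> e e0 h; apply/nbhs_ballP; exists e => //= y hy; apply: h.
have [_ hy'] := hy; split; rewrite distrC.
  exact: (hy' ord0 ord0).
exact: (hy' ord_max ord0).
Qed.

Lemma interior_box X x :
  interior X x <-> exists2 e : R, 0 < e & forall y, box e x y -> X y.
Proof. exact: nbhs_box. Qed.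

Lemma closure_box X x :
  closure X x <-> forall e, 0 < e -> exists2 y, box e x y & X y.
Proof.
split.
  move=> h e e0; have /h [y [h1 h2]] : nbhs x [set y | box e x y].
    by apply/nbhs_box; exists e.
  by exists y.
move=> h B /nbhs_box [e e0 hB]; have [y h1 h2] := h e e0.
by exists y; split => //; apply: hB.
Qed.

Lemma box_le e e' x y : e <= e' -> box e x y -> box e' x y.
Proof. by move=> h [h1 h2]; split; apply: lt_le_trans h. Qed.

Lemma box_step x d e : 0 < e -> exists2 r : R, 0 < r &
  forall s, `|s| <= r -> box e x (x + s *: d).
Proof.
(* The summand 1 keeps the divisor positive when [d] is zero. *)
move=> e0; set M := `|px d| + `|py d| + 1.
have M0 : 0 < M by rewrite /M; have := normr_ge0 (px d); have := normr_ge0 (py d); lra.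
exists (e / M / 2); first by rewrite !divr_gt0.
move=> s hs; split; rewrite !ptE.
  have -> : px x + s * px d - px x = s * px d by ring.
  rewrite normrM; apply: (@le_lt_trans _ _ (e / M / 2 * M)).
    apply: ler_pM => //; rewrite /M; have := normr_ge0 (py d); lra.
  have -> : e / M / 2 * M = e / 2 by field; lra.
  lra.
have -> : py x + s * py d - py x = s * py d by ring.
rewrite normrM; apply: (@le_lt_trans _ _ (e / M / 2 * M)).
  apply: ler_pM => //; rewrite /M; have := normr_ge0 (px d); lra.
have -> : e / M / 2 * M = e / 2 by field; lra.
lra.
Qed.

Definition aff a b c x := a * px x + b * py x + c.

Lemma aff_pos_box a b c x : 0 < aff a b c x ->
  exists2 e : R, 0 < e & forall y, box e x y -> 0 < aff a b c y.
Proof.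
move=> h; set M := `|a| + `|b| + 1.
have ha := normr_ge0 a; have hb := normr_ge0 b.
have M0 : 0 < M by rewrite /M; lra.
exists (aff a b c x / M); first by rewrite divr_gt0.
move=> y [h1 h2]; set r := aff a b c x / M in h1 h2.
have hr : r * M = aff a b c x by rewrite /r; field; lra.
have r0 : 0 < r by rewrite divr_gt0.
have k1 : `|a * (px y - px x)| <= `|a| * r by rewrite normrM ler_wpM2l // ltW.
have k2 : `|b * (py y - py x)| <= `|b| * r by rewrite normrM ler_wpM2l // ltW.
move: k1 k2; rewrite !ler_norml => /andP [k1 _] /andP [k2 _].
move: hr; rewrite /aff /M => hr; nra.
Qed.

Lemma crossE_aff d p x : cross d (x - p) =
  aff (- py d) (px d) (py d * px p - px d * py p) x.
Proof. by rewrite /cross /aff !ptE; ring. Qed.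

Lemma cross_pos_box k d p x : 0 < k * cross d (x - p) ->
  exists2 e : R, 0 < e & forall y, box e x y -> 0 < k * cross d (y - p).
Proof.
have E y : k * cross d (y - p) =
    aff (- k * py d) (k * px d) (k * (py d * px p - px d * py p)) y.
  by rewrite crossE_aff /aff; ring.
rewrite E => /aff_pos_box [e e0 h]; exists e => // y; rewrite E; exact: h.
Qed.

Lemma closed_aff a b c : closed [set x | 0 <= aff a b c x].
Proof.
move=> x /closure_box h /=; rewrite leNgt; apply/negP => h0.
have : 0 < aff (- a) (- b) (- c) x by move: h0; rewrite /aff; lra.
move=> /aff_pos_box [e /h [y hy h1] h2]; move: (h2 _ hy) h1; rewrite /aff /=; lra.
Qed.

Lemma closed_cross k d p : closed [set x | 0 <= k * cross d (x - p)].
Proof.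
rewrite (_ : mkset _ =
  [set x | 0 <= aff (- k * py d) (k * px d) (k * (py d * px p - px d * py p)) x]);
  first exact: closed_aff.
by apply/seteqP; split=> y /=; rewrite crossE_aff /aff => h; apply: le_trans h _;
 rewrite le_eqVlt; apply/orP; left; apply/eqP; ring.
Qed.

Lemma cross_pseg d p x y s :
  cross d (pseg x y s - p) = (1 - s) * cross d (x - p) + s * cross d (y - p).
Proof. by rewrite /pseg /cross !ptE; ring. Qed.

Lemma pseg0 x y : pseg x y 0 = x.
Proof. by rewrite /pseg scale0r addr0. Qed.
Lemma pseg1 x y : pseg x y 1 = y.
Proof. by rewrite /pseg scale1r addrC subrK. Qed.
Definition convex X := forall x y s, X x -> X y -> 0 <= s <= 1 -> X (pseg x y s).

(** The supremum of the parameters at which the segment is in [X]; closedness of [X] makes it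
    attained. Every argument about a path leaving a set starts from this point. *)
Lemma last_point X x y : closed X -> X x -> ~ X y ->
  exists s, [/\ 0 <= s, s < 1, X (pseg x y s) &
     forall s', s < s' -> s' <= 1 -> ~ X (pseg x y s')].
Proof.
move=> cX Xx Xy; pose S := [set s | 0 <= s <= 1 /\ X (pseg x y s)].
have S0 : S 0 by split; [lra|rewrite pseg0].
have hS : has_sup S by split; [exists 0|exists 1 => s [/andP []]].
have h0 : 0 <= sup S by apply: (ub_le_sup (proj2 hS)).
have h1 : sup S <= 1 by apply: ge_sup; [exists 0|move=> s [/andP []]].
have hX : X (pseg x y (sup S)).
  apply: cX; apply/closure_box => e e0.
  have [r r0 hr] := box_step (pseg x y (sup S)) (y - x) e0.
  have [s Ss hs] := sup_adherent r0 hS.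
  exists (pseg x y s); last by case: Ss.
  have -> : pseg x y s = pseg x y (sup S) + (s - sup S) *: (y - x).
    by apply: ptP; rewrite /pseg !ptE; ring.
  apply: hr; have := ub_le_sup (proj2 hS) Ss; rewrite ler_norml => h; lra.
exists (sup S); split => //.
  rewrite lt_neqAle h1 andbT; apply/eqP => e; apply: Xy.
  by move: hX; rewrite e pseg1.
move=> s' h2 h3 h4; have : S s' by split => //; lra.
by move=> /(ub_le_sup (proj2 hS)); lra.
Qed.

(** From an interior point one can step a little along the normal that decreases the functional, by
    [r * k ^+ 2] times the squared norm of [d], and still be in [X]; so the value was positive
    before the step. *)
Lemma interior_halfplane X k d p x : k != 0 -> d != 0 ->
  (forall y, X y -> 0 <= k * cross d (y - p)) ->
  interior X x -> 0 < k * cross d (x - p).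
Proof.
move=> k0 d0 hX /interior_box [e e0 he].
have [r r0 hr] := box_step x (mkpt (k * py d) (- k * px d)) e0.
have /hX : X (x + r *: mkpt (k * py d) (- k * px d)).
  by apply: he; apply: hr; rewrite gtr0_norm.
have -> : k * cross d (x + r *: mkpt (k * py d) (- k * px d) - p) =
  k * cross d (x - p) - r * k ^+ 2 * (px d * px d + py d * py d).
  by rewrite /cross !ptE; ring.
move=> h; have := norm2_gt0 d0; have : 0 < k ^+ 2 by rewrite exprn_even_gt0.
move=> h1 h2; have := mulr_gt0 (mulr_gt0 r0 h1) h2; lra.
Qed.

(** The lines are removed one at a time. The complement of a line is open, and a point on the line
    can leave it along the normal without leaving the open set. *)
Lemma generic_point X (L : seq (pt R * pt R)) : open X -> X !=set0 ->
  (forall l, List.In l L -> l.1 != 0) ->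
  exists2 x, X x & forall l, List.In l L -> cross l.1 (x - l.2) != 0.
Proof.
elim: L X => [|l L IH] X oX [x Xx] hL; first by exists x.
have l0 : l.1 != 0 by apply: hL; left.
pose Y := X `&` [set y | cross l.1 (y - l.2) != 0].
have oY : open Y.
  apply: openI => //; rewrite openE => y /= hy; apply/interior_box.
  have /cross_pos_box [e e0 he] : 0 < cross l.1 (y - l.2) * cross l.1 (y - l.2).
    by rewrite -expr2 exprn_even_gt0.
  exists e => // z /he h /=; apply/eqP => h1; move: h; rewrite h1 mulr0 ltxx //.
have Y0 : Y !=set0.
  case: (eqVneq (cross l.1 (x - l.2)) 0) => [h|h]; last by exists x.
  move: oX; rewrite openE => /(_ _ Xx) /interior_box [e e0 he].
  have [r r0 hr] := box_step x (mkpt (py l.1) (- px l.1)) e0.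
  exists (x + r *: mkpt (py l.1) (- px l.1)); split.
    by apply: he; apply: hr; rewrite gtr0_norm.
  rewrite /= (_ : cross _ _ = cross l.1 (x - l.2)
     - r * (px l.1 * px l.1 + py l.1 * py l.1)); last by rewrite /cross !ptE; ring.
  rewrite h sub0r oppr_eq0 mulf_neq0 //; first by lra.
  by have := norm2_gt0 l0; lra.
have [y [Xy hy] hy2] := IH Y oY Y0 (fun l' h => hL l' (or_intror h)).
by exists y => // l' [<-|/hy2].
Qed.

End Plane.

(** * Triangles *)

Definition k0 : 'I_3 := @Ordinal 3 0 isT.
Definition k1 : 'I_3 := @Ordinal 3 1 isT.
Definition k2 : 'I_3 := @Ordinal 3 2 isT.

Lemma I3_cases (k : 'I_3) : [\/ k = k0, k = k1 | k = k2].
Proof.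
case: k => [[|[|[|//]]] hk]; [constructor 1|constructor 2|constructor 3];
exact: val_inj.
Qed.

Section Triangle.
Variable R : realType.
Implicit Types (p q x y z u v d : pt R) (a b c e r s t : R) (X Y : set (pt R)).
Implicit Types (T : tri R).

Lemma conv2P p q x : conv [:: p; q] x <-> exists2 s : R, 0 <= s <= 1 & x = pseg p q s.
Proof.
split.
  case=> w [w0 w1 ->]; exists (w ord_max).
    move: w1; rewrite !big_ord_recl big_ord0 /= addr0.
    have -> : lift ord0 ord0 = ord_max :> 'I_2 by apply: val_inj.
    have := w0 ord0; have := w0 ord_max; move=> h1 h2 h3; lra.
  move: w1; rewrite !big_ord_recl !big_ord0 /= !addr0.
  have -> : lift ord0 ord0 = ord_max :> 'I_2 by apply: val_inj.
  move=> h3; have -> : w ord0 = 1 - w ord_max by lra.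
  by apply: ptP; rewrite /pseg !ptE; ring.
case=> s s01 ->; exists (fun i => if i == ord0 then 1 - s else s); split.
- by move=> i; case: ifP => _; lra.
- by rewrite !big_ord_recl big_ord0 /=; ring.
- by rewrite !big_ord_recl big_ord0 /=; apply: ptP; rewrite /pseg !ptE; ring.
Qed.

Definition comb3 a b c p q u : pt R := a *: p + b *: q + c *: u.

Lemma conv3P p q u x : conv [:: p; q; u] x <->
  exists a b c, [/\ 0 <= a, 0 <= b, 0 <= c, a + b + c = 1 & x = comb3 a b c p q u].
Proof.
split.
  case=> w [w0 w1 ->]; exists (w k0), (w k1), (w k2).
  move: w1; rewrite !big_ord_recl !big_ord0 /= !addr0.
  have -> : lift ord0 (lift ord0 ord0) = k2 :> 'I_3 by apply: val_inj.
  have -> : lift ord0 ord0 = k1 :> 'I_3 by apply: val_inj.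
  have -> : ord0 = k0 :> 'I_3 by apply: val_inj.
  by move=> h; split => //; rewrite -?addrA //; apply: ptP; rewrite !ptE; ring.
case=> a [b [c [a0 b0 c0 h ->]]].
exists (fun i => if i == k0 then a else if i == k1 then b else c); split.
- by move=> i; case: ifP => // _; case: ifP.
- by rewrite !big_ord_recl big_ord0 /= addr0 addrA.
- rewrite !big_ord_recl big_ord0 /=; apply: ptP; rewrite !ptE; ring.
Qed.

Lemma tri_setE T : tri_set T = conv [:: corner T k0; corner T k1; corner T k2].
Proof.
case: T => -[|p [|q [|u [|//]]]] //= hT; rewrite /tri_set /corner /=.
Qed.

Lemma tri_nth T : (T`_0 = corner T k0) * (T`_1 = corner T k1) * (T`_2 = corner T k2).
Proof. by rewrite /corner !(tnth_nth 0). Qed.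

(** Twice the signed area. *)
Definition area T := cross (corner T k1 - corner T k0) (corner T k2 - corner T k0).

Lemma tri_flatE T : tri_is_flat T <-> area T = 0.
Proof. by rewrite /tri_is_flat !tri_nth. Qed.

Lemma tri_setP T x : tri_set T x <->
  exists a b c, [/\ 0 <= a, 0 <= b, 0 <= c, a + b + c = 1 &
    x = comb3 a b c (corner T k0) (corner T k1) (corner T k2)].
Proof. by rewrite tri_setE; apply: conv3P. Qed.

Lemma corner_in T k : tri_set T (corner T k).
Proof.
apply/tri_setP; case: (I3_cases k) => ->.
- by exists 1, 0, 0; split; rewrite ?addr0 ?lexx ?ler01 //; apply: ptP; rewrite !ptE; ring.
- by exists 0, 1, 0; split; rewrite ?addr0 ?add0r ?lexx ?ler01 //; apply: ptP; rewrite !ptE; ring.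
- by exists 0, 0, 1; split; rewrite ?addr0 ?add0r ?lexx ?ler01 //; apply: ptP; rewrite !ptE; ring.
Qed.

Lemma convex_tri T : convex (tri_set T).
Proof.
move=> x y s /tri_setP [a [b [c [a0 b0 c0 h ->]]]] /tri_setP
  [a' [b' [c' [a0' b0' c0' h' ->]]]] s01; apply/tri_setP.
exists ((1-s)*a+s*a'), ((1-s)*b+s*b'), ((1-s)*c+s*c'); split.
- nra.
- nra.
- nra.
- have -> : c = 1 - a - b by lra.
  have -> : c' = 1 - a' - b' by lra.
  ring.
- by apply: ptP; rewrite /pseg /comb3 !ptE; ring.
Qed.

Lemma conv2_sub X p q : convex X -> X p -> X q -> conv [:: p; q] `<=` X.
Proof. by move=> cX Xp Xq x /conv2P [s s01 ->]; apply: cX. Qed.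

Lemma conv3_sub X p q u : convex X -> X p -> X q -> X u ->
  conv [:: p; q; u] `<=` X.
Proof.
move=> cX Xp Xq Xu x /conv3P [a [b [c [a0 b0 c0 h ->]]]].
have [e|ne] := eqVneq c 1.
  have -> : comb3 a b c p q u = u.
    have -> : a = 0 by lra.
    have -> : b = 0 by lra.
    by rewrite e; apply: ptP; rewrite !ptE; ring.
  done.
have c1 : 0 < a + b by move/eqP: ne => ne; rewrite lt_neqAle addr_ge0 // andbT;
  apply/eqP => e; apply: ne; lra.
have -> : comb3 a b c p q u = pseg (pseg p q (b / (a + b))) u c.
  have -> : c = 1 - a - b by lra.
  by apply: ptP; rewrite /pseg /comb3 !ptE; field; lra.
apply: (cX) => //; last by lra.
apply: cX => //; apply/andP; split; last by rewrite ler_pdivrMr //; lra.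
by apply: divr_ge0 => //; apply: ltW.
Qed.

Lemma tri_sub X T : convex X -> (forall k, X (corner T k)) -> tri_set T `<=` X.
Proof. by move=> cX h; rewrite tri_setE; apply: conv3_sub. Qed.

Lemma convex_conv2 p q : convex (conv [:: p; q]).
Proof.
move=> x y s /conv2P [a a01 ->] /conv2P [b b01 ->] s01; apply/conv2P.
exists ((1-s)*a+s*b); first by apply/andP; split; nra.
by apply: ptP; rewrite /pseg !ptE; ring.
Qed.

Lemma conv2_l p q : conv [:: p; q] p.
Proof. by apply/conv2P; exists 0; rewrite ?pseg0 // lexx ler01. Qed.
Lemma conv2_r p q : conv [:: p; q] q.
Proof. by apply/conv2P; exists 1; rewrite ?pseg1 // lexx ler01. Qed.
Lemma conv2C p q : conv [:: p; q] = conv [:: q; p].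
Proof.
by apply/seteqP; split; apply: conv2_sub;
  rewrite ?conv2_l ?conv2_r //; auto using convex_conv2, conv2_l, conv2_r.
Qed.

Lemma conv2_tri T k l : conv [:: corner T k; corner T l] `<=` tri_set T.
Proof. by apply: conv2_sub; [exact: convex_tri|exact: corner_in|exact: corner_in]. Qed.

(** Membership in a segment as three sign conditions. Closedness of segments follows at once, and so
    does, later, the transport of membership between snapshots of the same combinatorial type. *)
Lemma conv2_line p q x : p != q ->
  conv [:: p; q] x <-> [/\ cross (q - p) (x - p) = 0, 0 <= dot (q - p) (x - p)
    & 0 <= dot (q - p) (q - x)].
Proof.
move=> pq; have d0 : q - p != 0 by rewrite subr_eq0 eq_sym.
have n0 := norm2_gt0 d0; split.
  case/conv2P => s s01 ->; split; rewrite /pseg.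
  - by rewrite /cross !ptE; ring.
  - have -> : dot (q - p) (p + s *: (q - p) - p) =
      s * (px (q - p) * px (q - p) + py (q - p) * py (q - p)).
      by rewrite /dot !ptE; ring.
    by rewrite mulr_ge0 //; [lra|exact: ltW].
  - have -> : dot (q - p) (q - (p + s *: (q - p))) =
      (1 - s) * (px (q - p) * px (q - p) + py (q - p) * py (q - p)).
      by rewrite /dot !ptE; ring.
    by rewrite mulr_ge0 //; [lra|exact: ltW].
case=> h1 h2 h3; apply/conv2P; set N := (X in 0 < X) in n0.
exists (dot (q - p) (x - p) / N).
  apply/andP; split; first by apply: divr_ge0 => //; apply: ltW.
  rewrite ler_pdivrMr // mul1r -subr_ge0.
  by apply: le_trans h3 _; rewrite le_eqVlt; apply/orP; left; apply/eqP;
     rewrite /N /dot !ptE; ring.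
have hN : N != 0 by rewrite gt_eqF.
move: h1; rewrite /cross !ptE => h1.
apply: ptP; rewrite /pseg !ptE; apply: (mulfI hN).
  have -> : N * (px p + dot (q - p) (x - p) / N * (px q - px p)) =
    N * px p + dot (q - p) (x - p) * (px q - px p) by field.
  have -> : N * px x = N * px p + dot (q - p) (x - p) * (px q - px p) -
     (py q - py p) * ((px q - px p) * (py x - py p) - (py q - py p) * (px x - px p)).
    by rewrite /N /dot !ptE; ring.
  by rewrite h1; ring.
have -> : N * (py p + dot (q - p) (x - p) / N * (py q - py p)) =
  N * py p + dot (q - p) (x - p) * (py q - py p) by field.
have -> : N * py x = N * py p + dot (q - p) (x - p) * (py q - py p) +
   (px q - px p) * ((px q - px p) * (py x - py p) - (py q - py p) * (px x - px p)).
  by rewrite /N /dot !ptE; ring.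
by rewrite h1; ring.
Qed.

Lemma closed_conv2 p q : closed (conv [:: p; q]).
Proof.
case: (eqVneq p q) => [<-|pq].
  rewrite (_ : conv _ = [set p]).
    apply: accessible_closed_set1; apply: hausdorff_accessible.
    exact: norm_hausdorff.
  apply/seteqP; split=> [x /conv2P [s _ ->]|x -> /=].
    by rewrite /pseg subrr scaler0 addr0.
  exact: conv2_l.
rewrite (_ : conv _ = [set x | 0 <= 1 * cross (q - p) (x - p)] `&`
  [set x | 0 <= (- 1) * cross (q - p) (x - p)] `&`
  [set x | 0 <= aff (px (q - p)) (py (q - p)) (- dot (q - p) p) x] `&`
  [set x | 0 <= aff (- px (q - p)) (- py (q - p)) (dot (q - p) q) x]).
  by apply: closedI; [apply: closedI; [apply: closedI|]|];
    (exact: closed_cross || exact: closed_aff).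
have E1 x : aff (px (q - p)) (py (q - p)) (- dot (q - p) p) x = dot (q - p) (x - p).
  by rewrite /aff /dot !ptE; ring.
have E2 x : aff (- px (q - p)) (- py (q - p)) (dot (q - p) q) x = dot (q - p) (q - x).
  by rewrite /aff /dot !ptE; ring.
apply/seteqP; split=> x.
  by move=> /(conv2_line _ pq) [h1 h2 h3]; rewrite /= E1 E2 h1 !mulr0.
rewrite /= E1 E2 => -[[[h1 h2] h3] h4]; apply/(conv2_line _ pq); split => //; lra.
Qed.

Lemma line_empty_interior X p d : d != 0 -> (forall x, X x -> cross d (x - p) = 0) ->
  forall x, ~ interior X x.
Proof.
move=> d0 h x hx; have := @interior_halfplane R X 1 d p x (oner_neq0 _) d0.
have hX y : X y -> 0 <= 1 * cross d (y - p) by move=> /h ->; rewrite mulr0.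
by move=> /(_ hX hx); rewrite (h _ (interior_subset hx)) mulr0 ltxx.
Qed.

Lemma conv2_empty_interior p q x : ~ interior (conv [:: p; q]) x.
Proof.
case: (eqVneq p q) => [<-|pq]; last first.
  have d0 : q - p != 0 by rewrite subr_eq0 eq_sym.
  by apply: (line_empty_interior d0 (p := p)) => y /conv2_line [].
apply: (@line_empty_interior _ p (mkpt 1 0)).
  apply/eqP => /(congr1 (@px R)); rewrite !ptE => /eqP; exact/negP/oner_neq0.
move=> y /conv2P [s _ ->]; rewrite /pseg /cross !ptE; ring.
Qed.

(* Barycentric coordinates up to the factor [area T]. *)
Definition bary T (k : 'I_3) x : R :=
  if k == k0 then cross (corner T k2 - corner T k1) (x - corner T k1)
  else if k == k1 then cross (corner T k0 - corner T k2) (x - corner T k2)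
  else cross (corner T k1 - corner T k0) (x - corner T k0).

Lemma bary_sum T x : bary T k0 x + bary T k1 x + bary T k2 x = area T.
Proof. by rewrite /bary /= /area /cross !ptE; ring. Qed.

Lemma bary_comb T a b c : a + b + c = 1 ->
  let x := comb3 a b c (corner T k0) (corner T k1) (corner T k2) in
  [/\ bary T k0 x = a * area T, bary T k1 x = b * area T & bary T k2 x = c * area T].
Proof.
move=> h /=; have -> : c = 1 - a - b by lra.
by split; rewrite /bary /= /area /comb3 /cross !ptE; ring.
Qed.

(** The barycentric coordinates are [bary T k x / area T]; multiplying by [area T] instead has the
    same sign and makes the criterion independent of the orientation of the corners. *)
Lemma tri_bary T x : ~ tri_is_flat T ->
  tri_set T x <-> forall k, 0 <= area T * bary T k x.
Proof.
rewrite tri_flatE => /eqP F0; have F2 : 0 < area T ^+ 2 by rewrite exprn_even_gt0.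
split.
  move=> /tri_setP [a [b [c [a0 b0 c0 h ->]]]] k.
  have [h0 h1 h2] := bary_comb T h.
  by case: (I3_cases k) => ->; rewrite ?h0 ?h1 ?h2 mulrCA -expr2 mulr_ge0 // ltW.
move=> h; apply/tri_setP.
have hd k : 0 <= bary T k x / area T.
  rewrite (_ : _ / _ = area T * bary T k x / area T ^+ 2); last by field.
  by rewrite divr_ge0 // ltW.
exists (bary T k0 x / area T), (bary T k1 x / area T), (bary T k2 x / area T).
split => //; first by rewrite -!mulrDl bary_sum divff.
have E k (r : R) : area T * (bary T k x / area T * r) = bary T k x * r by field.
by apply: ptP; apply: (mulfI F0); rewrite /comb3 !ptE !mulrDr !E;
  rewrite /bary /area /= /cross !ptE; ring.
Qed.

Lemma closed_tri_nonflat T : ~ tri_is_flat T -> closed (tri_set T).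
Proof.
move=> hT; rewrite (_ : tri_set T = 
  [set x | 0 <= area T * bary T k0 x] `&`
  [set x | 0 <= area T * bary T k1 x] `&`
  [set x | 0 <= area T * bary T k2 x]).
  by apply: closedI; [apply: closedI|]; exact: closed_cross.
apply/seteqP; split=> x.
  by move=> /(tri_bary _ hT) h; do !split => /=.
move=> [[h0 h1] h2]; apply/(tri_bary _ hT) => k.
by case: (I3_cases k) => ->.
Qed.

(** When the corners [A] and [B] differ, the third one is [A + s (B - A)], and the position of [s]
    relative to 0 and 1 tells which corner lies between the other two. *)
Lemma flat_conv2 T : tri_is_flat T ->
  exists k l, tri_set T = conv [:: corner T k; corner T l].
Proof.
rewrite tri_flatE => F0.
have K k l m : conv [:: corner T k; corner T l] (corner T m) ->
  (forall j, [\/ j = k, j = l | j = m]) ->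
  exists k l, tri_set T = conv [:: corner T k; corner T l].
  move=> h hj; exists k, l; apply/seteqP; split; last exact: conv2_tri.
  apply: tri_sub; first exact: convex_conv2.
  by move=> j; case: (hj j) => -> //; auto using conv2_l, conv2_r.
have J0 : forall j, [\/ j = k1, j = k2 | j = k0].
  by move=> j; case: (I3_cases j) => ->; [constructor 3|constructor 1|constructor 2].
have J1 : forall j, [\/ j = k0, j = k2 | j = k1].
  by move=> j; case: (I3_cases j) => ->; [constructor 1|constructor 3|constructor 2].
have J2 := I3_cases.
set A := corner T k0 in K *; set B := corner T k1; set C := corner T k2.
case: (eqVneq A B) => [e|AB].
  apply: (K k1 k2 k0) => //; rewrite -/A e; exact: conv2_l.
have d0 : B - A != 0 by rewrite subr_eq0 eq_sym.
pose N := px (B - A) * px (B - A) + py (B - A) * py (B - A).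
have n0 : 0 < N := norm2_gt0 d0.
have hN : N != 0 by rewrite gt_eqF.
pose s := dot (B - A) (C - A) / N.
have hC : C = pseg A B s.
  move: F0; rewrite /area -/A -/B -/C /cross => F0.
  apply: ptP; apply: (mulfI hN); rewrite /pseg !ptE /s.
    transitivity (N * px A + dot (B - A) (C - A) * (px B - px A) -
      py (B - A) * (px (B - A) * py (C - A) - py (B - A) * px (C - A))).
      by rewrite /N /dot !ptE; ring.
    by rewrite F0; field.
  transitivity (N * py A + dot (B - A) (C - A) * (py B - py A) +
      px (B - A) * (px (B - A) * py (C - A) - py (B - A) * px (C - A))).
    by rewrite /N /dot !ptE; ring.
  by rewrite F0; field.
case: (ltrP s 0) => s0.
  apply: (K k1 k2 k0) => //; rewrite -/A -/B -/C; apply/conv2P.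
  exists (1 / (1 - s)); first by apply/andP; split; [apply: divr_ge0; lra|rewrite ler_pdivrMr; lra].
  by rewrite hC; apply: ptP; rewrite /pseg !ptE; field; lra.
case: (lerP s 1) => s1.
  apply: (K k0 k1 k2) => //; rewrite -/A -/B -/C; apply/conv2P; exists s => //; lra.
apply: (K k0 k2 k1) => //; rewrite -/A -/B -/C; apply/conv2P.
exists (1 / s); first by apply/andP; split; [apply: divr_ge0; lra|rewrite ler_pdivrMr; lra].
by rewrite hC; apply: ptP; rewrite /pseg !ptE; field; lra.
Qed.

Lemma closed_tri T : closed (tri_set T).
Proof.
case: (pselect (tri_is_flat T)) => h; last exact: closed_tri_nonflat.
by have [k [l ->]] := flat_conv2 h; apply: closed_conv2.
Qed.

Lemma tri_interior_bary T x : ~ tri_is_flat T ->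
  interior (tri_set T) x <-> forall k, 0 < area T * bary T k x.
Proof.
move=> hT; have F0 : area T != 0 by apply/eqP => /tri_flatE.
have dk k l m : (forall j, [\/ j = k, j = l | j = m]) ->
    corner T k - corner T l != 0.
  move=> hj; apply/eqP => h; apply: hT; apply/tri_flatE.
  have {}h : corner T k = corner T l by apply/eqP; rewrite -subr_eq0 h.
  move: hj h; case: (I3_cases k) => ->; case: (I3_cases l) => ->;
  try (by move=> _ h; rewrite /area /cross h ?subrr !ptE; ring);
  by move=> hj; exfalso; case: (I3_cases m) hj => -> hj;
     case: (hj k0) => // ?; case: (hj k1) => // ?; case: (hj k2).
split.
  move=> hx k.
  have hp y : tri_set T y -> 0 <= area T * bary T k y by move/(tri_bary _ hT).
  have J0 : forall j, [\/ j = k2, j = k1 | j = k0].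
    by move=> j; case: (I3_cases j) => ->; [constructor 3|constructor 2|constructor 1].
  have J1 : forall j, [\/ j = k0, j = k2 | j = k1].
    by move=> j; case: (I3_cases j) => ->; [constructor 1|constructor 3|constructor 2].
  have J2 : forall j, [\/ j = k1, j = k0 | j = k2].
    by move=> j; case: (I3_cases j) => ->; [constructor 2|constructor 1|constructor 3].
  move: hp; case: (I3_cases k) => -> hp;
    exact: (interior_halfplane F0 (dk _ _ _ _) hp hx).
move=> h.
have K k : exists2 e : R, 0 < e & forall y, box e x y -> 0 < area T * bary T k y.
  by move: (h k); case: (I3_cases k) => ->; apply: cross_pos_box.
have [e0 p0 h0] := K k0; have [e1 p1 h1] := K k1; have [e2 p2 h2] := K k2.
apply/interior_box; exists (Num.min e0 (Num.min e1 e2)).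
  by rewrite !lt_min p0 p1.
move=> y hy; apply/(tri_bary _ hT) => k; apply: ltW.
by case: (I3_cases k) => ->; [apply: h0|apply: h1|apply: h2];
  apply: box_le hy; rewrite !ge_min lexx ?orbT.
Qed.

Lemma flat_interior T x : tri_is_flat T -> ~ interior (tri_set T) x.
Proof. by move=> /flat_conv2 [k [l ->]]; apply: conv2_empty_interior. Qed.

Lemma nonflat_interior T : ~ tri_is_flat T ->
  interior (tri_set T) (comb3 (1/3) (1/3) (1/3) (corner T k0) (corner T k1) (corner T k2)).
Proof.
move=> hT; have F0 : area T != 0 by apply/eqP => /tri_flatE.
have F2 : 0 < area T ^+ 2 by rewrite exprn_even_gt0.
apply/(tri_interior_bary _ hT) => k.
have h : 1/3 + 1/3 + 1/3 = 1 :> R by field.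
have [h0 h1 h2] := bary_comb T h.
by case: (I3_cases k) => ->; rewrite ?h0 ?h1 ?h2 mulrCA -expr2 mulr_gt0 //; lra.
Qed.

Lemma tri_flat_set T : tri_is_flat T <-> interior (tri_set T) = set0.
Proof.
split=> [h|h]; first by rewrite -subset0 => x; apply: flat_interior.
apply: contrapT => /nonflat_interior; rewrite h; exact.
Qed.

Lemma tri_point_set T :
  tri_is_point T <-> forall x y, tri_set T x -> tri_set T y -> x = y.
Proof.
split=> [h x y|h k l]; last by apply: h; apply: corner_in.
have K z : tri_set T z -> z = corner T k0.
  case/tri_setP=> a [b [c [_ _ _ e ->]]].
  rewrite /comb3 (h k1 k0) (h k2 k0) -!scalerDl e scale1r //.
by move=> /K -> /K ->.
Qed.

(** Flatness and being a point are properties of the set alone, by the two lemmas above. Merging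
    compares triangles only as sets, so this invariance is what it relies on. *)
Lemma tri_interior_eq T T' : tri_set T = tri_set T' -> tri_interior T = tri_interior T'.
Proof.
move=> h; have hf : tri_is_flat T = tri_is_flat T'.
  by apply/propext; rewrite !tri_flat_set h.
have hp : tri_is_point T = tri_is_point T'.
  by apply/propext; rewrite !tri_point_set h.
by rewrite /tri_interior /tri_is_segment h hf hp.
Qed.

(** A point of a non-flat triangle that is not interior has a zero barycentric coordinate and lies
    on the opposite side; a flat triangle is one of its own sides. *)
Lemma tri_boundary T x : tri_set T x -> ~ interior (tri_set T) x ->
  exists k l, conv [:: corner T k; corner T l] x.
Proof.
case: (pselect (tri_is_flat T)) => hT.
  by have [k [l ->]] := flat_conv2 hT; exists k, l.
move=> hx hi; case/tri_setP: (hx) => a [b [c [a0 b0 c0 h e]]].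
have [h0 h1 h2] := bary_comb T h; rewrite -e in h0 h1 h2.
have F2 : 0 < area T ^+ 2.
  by rewrite exprn_even_gt0 //; apply/eqP => /tri_flatE.
have [|ha] := eqVneq a 0.
  move=> ea; exists k1, k2; apply/conv2P; exists c; first by lra.
  have eb : b = 1 - c by lra.
  by rewrite e ea eb; apply: ptP; rewrite /pseg /comb3 !ptE; ring.
have [|hb] := eqVneq b 0.
  move=> ea; exists k0, k2; apply/conv2P; exists c; first by lra.
  have eb : a = 1 - c by lra.
  by rewrite e ea eb; apply: ptP; rewrite /pseg /comb3 !ptE; ring.
have [|hc] := eqVneq c 0.
  move=> ea; exists k0, k1; apply/conv2P; exists b; first by lra.
  have eb : a = 1 - b by lra.
  by rewrite e ea eb; apply: ptP; rewrite /pseg /comb3 !ptE; ring.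
case: hi; apply/(tri_interior_bary _ hT) => k.
by case: (I3_cases k) => ->; rewrite ?h0 ?h1 ?h2 mulrCA -expr2 mulr_gt0 // lt_def ?ha ?hb ?hc.
Qed.

End Triangle.

(** * Intersections of half planes *)

Section Region.
Variable R : realType.
Implicit Types (p q x y z u v w d n : pt R) (a b c e r s t : R) (X Y : set (pt R)).
Implicit Types (L : seq (pt R * pt R)) (l m : pt R * pt R).

(* A line is encoded by a direction and one of its points. *)
Definition lval l x := cross l.1 (x - l.2).

Lemma lval_pseg l x y s : lval l (pseg x y s) = (1 - s) * lval l x + s * lval l y.
Proof. exact: cross_pseg. Qed.

Lemma lval_step l x n s : lval l (x + s *: n) = lval l x + s * cross l.1 n.
Proof. by rewrite /lval /cross !ptE; ring. Qed.

(** The open cell of [x0] in the arrangement of the lines [L]; [cregion] is its closure when [x0] is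
    on none of the lines. *)
Definition region L x0 := [set x | forall l, List.In l L -> 0 < lval l x0 * lval l x].
Definition cregion L x0 := [set x | forall l, List.In l L -> 0 <= lval l x0 * lval l x].

Definition bounded_pts X := exists M : R, forall x, X x -> `|px x| <= M /\ `|py x| <= M.

Definition centroid (vs : seq (pt R)) : pt R := (size vs)%:R^-1 *: \sum_(v <- vs) v.

Lemma lval_sum l vs : \sum_(v <- vs) lval l v =
  cross l.1 (\sum_(v <- vs) v) - (size vs)%:R * cross l.1 l.2.
Proof.
elim: vs => [|v vs IH]; first by rewrite !big_nil /cross !ptE /=; ring.
by rewrite !big_cons IH /= /lval /cross !ptE -[(size vs).+1]addn1 natrD; ring.
Qed.

Lemma lval_centroid l vs : vs <> [::] ->
  lval l (centroid vs) = (size vs)%:R^-1 * \sum_(v <- vs) lval l v.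
Proof.
move=> h; rewrite lval_sum /centroid /lval /cross !ptE; field.
by rewrite pnatr_eq0; case: vs h.
Qed.

Lemma centroid_pos l k vs : (forall v, v \in vs -> 0 <= k * lval l v) ->
  (exists2 v, v \in vs & k * lval l v != 0) -> 0 < k * lval l (centroid vs).
Proof.
move=> h [v hv v0]; have vs0 : vs <> [::] by case: vs hv {h}.
rewrite (lval_centroid _ vs0) mulrCA; apply: mulr_gt0.
  by rewrite invr_gt0 ltr0n lt0n size_eq0; apply/eqP.
rewrite mulr_sumr (big_rem v) //=.
have := h v hv; rewrite le_eqVlt eq_sym (negPf v0) /= => v1.
rewrite ltr_pwDl // big_seq; apply: sumr_ge0 => i hi; apply: h.
exact: mem_rem hi.
Qed.

Variables (L : seq (pt R * pt R)) (x0 : pt R).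
Hypothesis hd : forall l, List.In l L -> l.1 != 0.
Hypothesis h0 : forall l, List.In l L -> lval l x0 != 0.
Let Reg := region L x0.
Let cReg := cregion L x0.

Lemma region_base : Reg x0.
Proof. by move=> l /h0 h; rewrite -expr2 exprn_even_gt0. Qed.

Lemma region_sub : Reg `<=` cReg.
Proof. by move=> x h l /h /ltW. Qed.

Lemma region_near K x : (forall l, List.In l K -> 0 < lval l x0 * lval l x) ->
  exists2 e : R, 0 < e & forall y, box e x y -> forall l, List.In l K -> 0 < lval l x0 * lval l y.
Proof.
elim: K => [|l K IH] h; first by exists 1.
have [|e e0 he] := IH; first by move=> m hm; apply: h; right.
have [e' e0' he'] := cross_pos_box (h l (or_introl erefl)).
exists (Num.min e e'); first by rewrite lt_min e0.
move=> y hy m [<-|hm]; first by apply: he'; apply: box_le hy; rewrite ge_min lexx orbT.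
by apply: he => //; apply: box_le hy; rewrite ge_min lexx.
Qed.

Lemma open_region : open Reg.
Proof.
rewrite openE => x /region_near [e e0 he]; apply/interior_box; exists e => //.
Qed.

Lemma convex_cregion : convex cReg.
Proof.
move=> x y s hx hy s01 l hl; rewrite lval_pseg.
have := hx l hl; have := hy l hl; nra.
Qed.

Lemma cregion_region x y s : cReg x -> Reg y -> 0 < s <= 1 -> Reg (pseg x y s).
Proof.
move=> hx hy s01 l hl; rewrite lval_pseg.
have := hx l hl; have := hy l hl; move=> h1 h2.
have : 0 < s * (lval l x0 * lval l y) by rewrite mulr_gt0 //; lra.
have : 0 <= (1 - s) * (lval l x0 * lval l x) by rewrite mulr_ge0 //; lra.
nra.
Qed.

Lemma closed_cregion : closed cReg.
Proof.
move=> x hx l hl; have := @closed_cross _ (lval l x0) l.1 l.2.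
apply => /=; move: hx; apply: closure_subset => y; exact.
Qed.

(** A point of the closed cell is approached along the segment towards [x0], which is in the open
    cell except possibly at its start. *)
Lemma closure_region : closure Reg = cReg.
Proof.
apply/seteqP; split=> x.
  by move=> h; apply: closed_cregion; apply: closure_subset h; apply: region_sub.
move=> hx; apply/closure_box => e e0; have [r r0 hr] := box_step x (x0 - x) e0.
exists (pseg x x0 (Num.min r 1)).
  by apply: hr; rewrite gtr0_norm ?lt_min ?r0 //= ge_min lexx.
by apply: cregion_region => //; [exact: region_base|rewrite lt_min r0 ltr01 ge_min lexx orbT].
Qed.

(** Lines that miss [x] leave some room around it, and lines through [x] are parallel to [n], so
    they keep the value 0 along the step. *)
Lemma cregion_step x n : cReg x ->
  (forall l, List.In l L -> lval l x = 0 -> cross l.1 n = 0) ->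
  exists2 r : R, 0 < r & forall s, `|s| <= r -> cReg (x + s *: n).
Proof.
rewrite /cReg /cregion /=; elim: L => [|l K IH] hx hn.
  by exists 1.
have [||r r0 hr] := IH; [by move=> m hm; apply: hx; right|by move=> m hm; apply: hn; right|].
have [e|ne] := eqVneq (lval l x) 0.
  exists r => // s hs m [<-|hm]; last exact: hr.
  by rewrite lval_step (hn l) ?e //; [rewrite mulr0 addr0 mulr0|left].
have := hx l (or_introl erefl); rewrite le_eqVlt => /orP [/eqP e|].
  exists r => // s hs m [<-|hm]; last exact: hr.
  by move/esym/eqP: e; rewrite mulf_eq0 (negPf ne) orbF => /eqP ->; rewrite mul0r.
move=> /cross_pos_box [e e0 he]; have [r' r0' hr'] := box_step x n e0.
exists (Num.min r r'); first by rewrite lt_min r0.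
move=> s; rewrite le_min => /andP [h1 h2] m [<-|hm]; last exact: hr.
by apply: ltW; apply: he; apply: hr'.
Qed.

(** In the plane, parallelism is transitive through a nonzero vector. *)
Lemma cross_parallel d n u : d != 0 -> cross u d = 0 -> cross d n = 0 -> cross u n = 0.
Proof.
move=> /pt_neq0 d0; rewrite /cross => h1 h2; case: d0 => d0; apply: (mulfI d0); rewrite mulr0.
  transitivity (px u * (px d * py n - py d * px n) + px n * (px u * py d - py u * px d)).
    ring.
  by rewrite h1 h2; ring.
transitivity (py u * (px d * py n - py d * px n) + py n * (px u * py d - py u * px d)).
  ring.
by rewrite h1 h2; ring.
Qed.

Lemma crossC u v : cross u v = - cross v u.
Proof. by rewrite /cross; ring. Qed.

Lemma cross_self u : cross u u = 0.
Proof. by rewrite /cross; ring. Qed.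

(** If the lines through [x] were all parallel, [cregion_step] would allow equal steps in both
    senses of their common direction, and [x] would be the midpoint of two other points of the
    cell. *)
Lemma extreme_meet x : extreme_point cReg x ->
  exists l m, [/\ List.In l L, List.In m L, lval l x = 0, lval m x = 0
    & cross l.1 m.1 != 0].
Proof.
move=> [hx ext]; apply: contrapT => H.
have [n n0 hn] : exists2 n : pt R, n != 0 &
    forall l, List.In l L -> lval l x = 0 -> cross l.1 n = 0.
  case: (pselect (exists2 l, List.In l L & lval l x = 0)) => [[l hl h]|h].
    exists l.1; first exact: hd.
    move=> m hm hmx; apply: contrapT => /eqP hc; apply: H; exists m, l; split => //.
  exists (mkpt 1 0).
    apply/eqP => /(congr1 (@px R)); rewrite !ptE; apply/eqP; exact: oner_neq0.
  by move=> l hl hl0; exfalso; apply: h; exists l.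
have [r r0 hr] := cregion_step hx hn.
have E : x + r *: n = x + (- r) *: n.
  apply: (ext _ _ (1/2)); [| |lra|lra|].
  - by apply: hr; rewrite gtr0_norm.
  - by apply: hr; rewrite normrN gtr0_norm.
  - by apply: ptP; rewrite !ptE; field.
move/eqP: n0; apply; move: (congr1 (@px R) E) (congr1 (@py R) E).
rewrite !ptE => e1 e2; have hr0 : r + r != 0 by lra.
by apply: ptP; rewrite !ptE; apply: (mulfI hr0); rewrite mulr0; lra.
Qed.

Lemma line_line d p d' p' x y : cross d d' != 0 -> cross d (x - p) = 0 ->
  cross d' (x - p') = 0 -> cross d (y - p) = 0 -> cross d' (y - p') = 0 -> x = y.
Proof.
rewrite /cross !ptE => h e1 e2 e3 e4.
have f1 : px d * (py x - py y) = py d * (px x - px y) by lra.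
have f2 : px d' * (py x - py y) = py d' * (px x - px y) by lra.
apply: ptP; apply/eqP; rewrite -subr_eq0; apply/eqP; apply: (mulfI h); rewrite mulr0.
  transitivity (px d * (py d' * (px x - px y)) - px d' * (py d * (px x - px y))).
    ring.
  by rewrite -f1 -f2; ring.
transitivity (py d' * (px d * (py x - py y)) - py d * (px d' * (py x - py y))).
  ring.
by rewrite f1 f2; ring.
Qed.

(** On a line through [x], the value 0 is an average with positive weights of two values that are
    not on opposite sides, so both vanish. The end points thus lie on two transverse lines and
    coincide. *)
Lemma meet_extreme x l m : cReg x -> List.In l L -> List.In m L ->
  lval l x = 0 -> lval m x = 0 -> cross l.1 m.1 != 0 -> extreme_point cReg x.
Proof.
move=> hx hl hm elx emx hc; split => // y z s hy hz s0 s1 e.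
have e' : x = pseg y z (1 - s).
  by rewrite e; apply: ptP; rewrite /pseg !ptE; ring.
have K k : List.In k L -> lval k x = 0 -> lval k y = 0 /\ lval k z = 0.
  move=> hk; rewrite e' lval_pseg => h.
  have k0 := h0 hk; have := hy k hk; have := hz k hk => h1 h2.
  have h3 : s * (lval k x0 * lval k y) + (1 - s) * (lval k x0 * lval k z) = 0.
    rewrite -[RHS](mulr0 (lval k x0)) -h; ring.
  have h4 : lval k x0 * lval k y = 0 by nra.
  have h5 : lval k x0 * lval k z = 0 by nra.
  by move/eqP: h4; move/eqP: h5; rewrite !mulf_eq0 (negPf k0) => /eqP ? /eqP ?.
have [a1 a2] := K l hl elx; have [b1 b2] := K m hm emx.
exact: (line_line hc a1 b1 a2 b2).
Qed.

Hypothesis hb : bounded_pts cReg.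

(** The ray leaves the bounded cell, hence has a last point in it. Were all lines through that point
    parallel to [n], [cregion_step] would prolong the ray. *)
Lemma region_ray x n : cReg x -> n != 0 -> exists s, [/\ 0 <= s, cReg (x + s *: n)
  & exists l, [/\ List.In l L, lval l (x + s *: n) = 0 & cross l.1 n != 0]].
Proof.
move=> hx n0; have [M hM] := hb.
(* Coordinates in the cell are at most [M] in absolute value, so a displacement of one of them by
   [2 * M + 1] leads outside. *)
have [S S0 far] : exists2 S : R, 0 < S & ~ cReg (x + S *: n).
  have [mx my] := hM _ hx.
  have M0 : 0 <= M by apply: le_trans mx.
  case/pt_neq0: n0 => n0; [pose r := px n|pose r := py n];
  have r0 : 0 < `|r| by rewrite normr_gt0.
    exists ((2 * M + 1) / `|r|); first by rewrite divr_gt0 //; lra.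
    move=> /hM [+ _]; rewrite !ptE -/r; apply/negP; rewrite -ltNge.
    have : `|(2 * M + 1) / `|r| * r| = 2 * M + 1.
      by rewrite normrM ger0_norm ?divfK ?gt_eqF // divr_ge0 //; lra.
    move=> h; rewrite addrC; apply: lt_le_trans (lerB_normD _ _); rewrite h; lra.
  exists ((2 * M + 1) / `|r|); first by rewrite divr_gt0 //; lra.
  move=> /hM [_]; rewrite !ptE -/r; apply/negP; rewrite -ltNge.
  have : `|(2 * M + 1) / `|r| * r| = 2 * M + 1.
    by rewrite normrM ger0_norm ?divfK ?gt_eqF // divr_ge0 //; lra.
  move=> h; rewrite addrC; apply: lt_le_trans (lerB_normD _ _); rewrite h; lra.
have [s [s0 s1 hs out]] := last_point closed_cregion hx far.
have E r : pseg x (x + S *: n) r = x + (r * S) *: n.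
  by apply: ptP; rewrite /pseg !ptE; ring.
exists (s * S); rewrite E in hs; split => //; first by rewrite mulr_ge0 // ltW.
apply: contrapT => H; have [|r r0 hr] := cregion_step (n := n) hs.
  move=> l hl hl0; apply: contrapT => /eqP hc; apply: H; by exists l.
pose s' := Num.min 1 (s + r / S).
have h1 : s < s' by rewrite lt_min s1 ltrDl divr_gt0.
have h2 : s' <= 1 by rewrite ge_min lexx.
apply: (out _ h1 h2); rewrite E.
have -> : x + (s' * S) *: n = x + (s * S) *: n + ((s' - s) * S) *: n.
  by apply: ptP; rewrite !ptE; ring.
apply: hr; rewrite ger0_norm; last by rewrite mulr_ge0 // ?subr_ge0 ltW.
have h3 : s' - s <= r / S by rewrite lerBlDl ge_min lexx orbT.
have := ler_wpM2r (ltW S0) h3; rewrite divfK ?gt_eqF //.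
Qed.

(** The two rays from [x] along the line [l] end on lines transverse to [l], hence at vertices;
    neither has length 0 because [x] is not a vertex itself. *)
Lemma region_edge l x : List.In l L -> cReg x -> lval l x = 0 ->
  ~ extreme_point cReg x ->
  exists u v s, [/\ extreme_point cReg u /\ extreme_point cReg v, u <> v,
    lval l u = 0 /\ lval l v = 0, 0 < s < 1 & x = pseg u v s].
Proof.
move=> hl hx ex next.
have d0 := hd hl.
have [a [a0 ha [m [hm em cm]]]] := region_ray hx d0.
have d0' : (- 1) *: l.1 != 0.
  by rewrite scaleN1r oppr_eq0.
have [b [b0 hb' [k [hk ek ck]]]] := region_ray hx d0'.
have E r : lval l (x + r *: l.1) = 0 by rewrite lval_step ex cross_self; ring.
have E' : x + b *: ((-1) *: l.1) = x + (- b) *: l.1.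
  by apply: ptP; rewrite !ptE; ring.
rewrite E' in hb' ek.
have cm' : cross l.1 m.1 != 0 by rewrite crossC oppr_eq0.
have ck' : cross l.1 k.1 != 0.
  rewrite crossC oppr_eq0; move: ck; apply: contraNneq => h.
  have -> : cross k.1 ((-1) *: l.1) = - cross k.1 l.1 by rewrite /cross !ptE; ring.
  by rewrite h oppr0.
have eu := meet_extreme ha hl hm (E a) em cm'.
have ev := meet_extreme hb' hl hk (E (- b)) ek ck'.
have a1 : 0 < a.
  rewrite lt_neqAle a0 andbT; apply/eqP => h; apply: next.
  by move: eu; rewrite -h scale0r addr0.
have b1 : 0 < b.
  rewrite lt_neqAle b0 andbT; apply/eqP => h; apply: next.
  by move: ev; rewrite -h oppr0 scale0r addr0.
exists (x + a *: l.1), (x + (- b) *: l.1), (a / (a + b)); split => //.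
- move=> h; move/eqP: d0; apply.
  move: (congr1 (@px R) h) (congr1 (@py R) h); rewrite !ptE => e1 e2.
  have hr0 : a + b != 0 by lra.
  by apply: ptP; rewrite !ptE; apply: (mulfI hr0); rewrite mulr0; lra.
- apply/andP; split; first by rewrite divr_gt0 // addr_gt0.
  by rewrite ltr_pdivrMr; lra.
- by apply: ptP; rewrite /pseg !ptE; field; lra.
Qed.

(** The ray from [x0] parallel to [l] keeps a nonzero value. Its end is a vertex or lies between two
    vertices, which cannot both be on [l]. This is why the average of all vertices is strictly
    inside the cell. *)
Lemma region_vertex l : List.In l L ->
  exists2 v, extreme_point cReg v & lval l v != 0.
Proof.
move=> hl; have [s [s0 hs [m [hm em cm]]]] := region_ray (region_sub region_base) (hd hl).
have E : lval l (x0 + s *: l.1) != 0 by rewrite lval_step cross_self mulr0 addr0 h0.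
case: (pselect (extreme_point cReg (x0 + s *: l.1))) => [h|h]; first by exists (x0 + s *: l.1).
have [u [v [r [[eu ev] uv [lu lv] r01 e]]]] := region_edge hm hs em h.
case: (eqVneq (lval l u) 0) => [e1|]; last by exists u.
case: (eqVneq (lval l v) 0) => [e2|]; last by exists v.
by move: E; rewrite e lval_pseg e1 e2 !mulr0 addr0 eqxx.
Qed.

Lemma region_has_line : exists l, List.In l L.
Proof.
have n0 : mkpt 1 0 != 0 :> pt R.
  apply/eqP => /(congr1 (@px R)); rewrite !ptE; apply/eqP; exact: oner_neq0.
by have [s [_ _ [l [hl _ _]]]] := region_ray (region_sub region_base) n0; exists l.
Qed.

(** The ray from [a] through [z] leaves the cell beyond [z], and by the hypothesis on [z] not at a
    vertex, hence between the ends of an edge. *)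
Lemma region_fan (a : pt R) z : Reg a -> Reg z ->
  (forall v, extreme_point cReg v -> cross (v - a) (z - a) != 0) ->
  exists u v l, [/\ extreme_point cReg u /\ extreme_point cReg v, u <> v,
    List.In l L, lval l u = 0 /\ lval l v = 0 & conv [:: a; u; v] z].
Proof.
move=> ha hz hg.
have n0 : z - a != 0.
  have [l hl] := region_has_line; have [v /hg + _] := region_vertex hl.
  apply: contraNneq => ->; rewrite /cross !ptE; apply/eqP; ring.
have [s [s0 hs [l [hl el cl]]]] := region_ray (region_sub ha) n0.
have s1 : 1 < s.
  rewrite ltNge; apply/negP => s1.
  have : Reg (pseg a z s).
    have [s2|] := eqVneq s 0; first by rewrite s2 pseg0.
    by move=> s2; apply: cregion_region => //; [exact: region_sub|rewrite s1 andbT lt_neqAle eq_sym s2].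
  by move=> /(_ l hl); rewrite /pseg el mulr0 ltxx.
case: (pselect (extreme_point cReg (a + s *: (z - a)))) => [h|h].
  exfalso; have := hg _ h; rewrite (_ : cross _ _ = 0) ?eqxx //.
  by rewrite /cross !ptE; ring.
have [u [v [r [[eu ev] uv [lu lv] r01 e]]]] := region_edge hl hs el h.
exists u, v, l; split => //; apply/conv3P.
(* The exit point is [a + s (z - a)], so [z] divides the segment from [a] to it at the parameter
   [s^-1]; [r] locates the exit point on the edge. *)
exists (1 - s^-1), (s^-1 * (1 - r)), (s^-1 * r).
have i0 : 0 < s^-1 by rewrite invr_gt0; lra.
have i1 : s^-1 < 1 by rewrite invf_lt1 //; lra.
split; [lra|rewrite mulr_ge0 //; lra|rewrite mulr_ge0 //; lra|ring|].
have -> : z = a + s^-1 *: (pseg u v r - a).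
  by rewrite -e; apply: ptP; rewrite !ptE; field; lra.
by apply: ptP; rewrite /pseg /comb3 !ptE; ring.
Qed.

(** The midpoint is in the closed cell but not in the open one, so some line passes through it;
    values of equal sign that average to 0 both vanish. *)
Lemma edge_line u v : cReg u -> cReg v -> conv [:: u; v] `&` Reg = set0 ->
  exists l, [/\ List.In l L, lval l u = 0 & lval l v = 0].
Proof.
move=> hu hv h; pose w := pseg u v (1/2).
have hw : cReg w by apply: convex_cregion => //; lra.
have : ~ Reg w.
  move=> hw'; suff : (set0 : set (pt R)) w by [].
  by rewrite -h; split => //; apply/conv2P; exists (1/2) => //; lra.
move=> nw; apply: contrapT => H; apply: nw => l hl.
have := hu l hl; have := hv l hl; have := h0 hl => l0 h1 h2.
rewrite lval_pseg lt_neqAle; apply/andP; split; last by nra.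
apply/eqP => e; apply: H; exists l; split => //.
  have : lval l x0 * lval l u = 0 by nra.
  by move/eqP; rewrite mulf_eq0 (negPf l0) => /eqP.
have : lval l x0 * lval l v = 0 by nra.
by move/eqP; rewrite mulf_eq0 (negPf l0) => /eqP.
Qed.

End Region.

(** * The boundary of a union of triangles *)

Section Segments.
Variable R : realType.
Implicit Types (p q x y z u v w d n : pt R) (a b c e r s t : R) (X Y : set (pt R)).

Lemma argmax_seq (T : Type) (s : seq T) (P : T -> Prop) (f : T -> R) :
  (exists2 x : T, List.In x s & P x) ->
  exists x : T, [/\ List.In x s, P x & forall y : T, List.In y s -> P y -> f y <= f x].
Proof.
elim: s => [|z s IH] [x] //= hx Px.
case: (pselect (exists2 x : T, List.In x s & P x)) => [/IH [x' [h1 h2 h3]]|h].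
  case: (pselect (P z /\ f x' < f z)) => [[h4 h5]|h4].
    exists z; split => //; first by left.
    move=> y [<-|hy] Py //; apply: le_trans (h3 _ hy Py) _; exact: ltW.
  exists x'; split => //; first by right.
  move=> y [<-|hy] Py; last exact: h3.
  by rewrite leNgt; apply/negP => ?; apply: h4.
have {hx} e : z = x by case: hx => // hx; exfalso; apply: h; exists x.
exists z; split; [by left|by rewrite e|].
by move=> y [<-|hy] Py //; exfalso; apply: h; exists y.
Qed.

Lemma avoid_seq (T : eqType) (vs : seq T) (f : R -> T) a b : injective f -> a < b ->
  exists2 s : R, a < s < b & f s \notin vs.
Proof.
move=> injf; elim: vs b => [|v vs IH] b ab.
  by exists ((a + b) / 2) => //; lra.
have [s hs hf] := IH _ ab; have [e|ne] := eqVneq (f s) v.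
  have [|s' hs' hf'] := IH s; first by lra.
  exists s'; first by lra.
  rewrite inE negb_or hf' andbT -e; apply/eqP => /injf; lra.
by exists s => //; rewrite inE negb_or ne.
Qed.

Lemma pseg_inj x y : x <> y -> injective (pseg x y).
Proof.
move=> xy s t h; move/sub_neq0/pt_neq0: xy.
move: (congr1 (@px R) h) (congr1 (@py R) h); rewrite /pseg !ptE => e1 e2.
by case=> h0; apply: (mulIf h0); [move: e1|move: e2] => /addrI.
Qed.

Lemma open_segmentP p q x : p <> q ->
  open_segment p q x <-> exists2 s : R, 0 < s < 1 & x = pseg p q s.
Proof.
move=> pq; split.
  case=> /conv2P [s s01 e] h; exists s => //.
  rewrite !lt_neqAle; case/andP: s01 => -> ->; rewrite !andbT.
  apply/andP; split; apply/eqP => es; apply: h; rewrite e.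
    by left; rewrite -es pseg0.
  by right; rewrite es pseg1.
case=> s s01 ->; split; first by apply/conv2P; exists s => //; lra.
move=> [] /= h.
  by move: h; rewrite -[RHS](pseg0 _ q) => /(pseg_inj pq); lra.
by move: h; rewrite -[RHS](pseg1 p) => /(pseg_inj pq); lra.
Qed.

Lemma open_segment_conv p q : open_segment p q `<=` conv [:: p; q].
Proof. by move=> x []. Qed.

Lemma open_segmentC p q : open_segment p q = open_segment q p.
Proof. by rewrite /open_segment conv2C setUC. Qed.

Lemma open_segment_near p q x e : p <> q -> conv [:: p; q] x -> 0 < e ->
  exists2 z, open_segment p q z & box e x z.
Proof.
move=> pq /conv2P [s s01 ex] e0.
have [r r0 hr] := box_step x (pseg p q (1/2) - x) e0.
pose m := Num.min r (1/2).
have m0 : 0 < m by rewrite lt_min r0; lra.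
have m1 : m <= 1/2 by rewrite ge_min lexx orbT.
exists (x + m *: (pseg p q (1/2) - x)); last by apply: hr; rewrite gtr0_norm // ge_min lexx.
apply/(open_segmentP _ pq); exists (s + m * (1/2 - s)).
  by apply/andP; split; nra.
by rewrite ex; apply: ptP; rewrite /pseg !ptE; ring.
Qed.

Lemma parallel_scale d n : d != 0 -> cross d n = 0 -> exists r, n = r *: d.
Proof.
move=> d0; have := norm2_gt0 d0; set N := (X in 0 < X) => N0 h.
have hN : N != 0 by rewrite gt_eqF.
exists (dot d n / N); apply: ptP; apply: (mulfI hN); rewrite !ptE.
  transitivity (dot d n * px d - py d * (px d * py n - py d * px n)).
    by rewrite /N /dot; ring.
  by move: h; rewrite /cross => ->; field.
transitivity (dot d n * py d + px d * (px d * py n - py d * px n)).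
  by rewrite /N /dot; ring.
by move: h; rewrite /cross => ->; field.
Qed.

(** Barycentric interpolation of an affine function, multiplied by [area T] so that it also holds
    for flat triangles. *)
Lemma bary_affine (T : tri R) l x : area T * lval l x =
  bary T k0 x * lval l (corner T k0) + bary T k1 x * lval l (corner T k1)
  + bary T k2 x * lval l (corner T k2).
Proof. by rewrite /area /bary /= /lval /cross !ptE; ring. Qed.

Lemma lval_tri (T : tri R) l k x : (forall j, 0 <= k * lval l (corner T j)) ->
  tri_set T x -> 0 <= k * lval l x.
Proof.
move=> h; have cX : convex [set x | 0 <= k * lval l x].
  move=> y z s /= hy hz s01; rewrite lval_pseg; nra.
exact: (tri_sub cX h).
Qed.

Lemma bary0_side (T : tri R) i y : tri_set T y -> ~ tri_is_flat T -> bary T i y = 0 ->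
  exists k l, (forall j, [\/ j = i, j = k | j = l]) /\
    conv [:: corner T k; corner T l] y.
Proof.
move=> /tri_setP [a [b [c [a0 b0 c0 h ->]]]] hT.
have F0 : area T != 0 by apply/eqP => /tri_flatE.
have [h0 h1 h2] := bary_comb T h.
case: (I3_cases i) => ->; rewrite ?h0 ?h1 ?h2 => /eqP; rewrite mulf_eq0 (negPf F0) orbF => /eqP e.
- exists k1, k2; split; first exact: I3_cases.
  apply/conv2P; exists c; first by lra.
  have -> : b = 1 - c by lra.
  by rewrite e; apply: ptP; rewrite /pseg /comb3 !ptE; ring.
- exists k0, k2; split; first by move=> j; case: (I3_cases j) => ->;
    [constructor 2|constructor 1|constructor 3].
  apply/conv2P; exists c; first by lra.
  have -> : a = 1 - c by lra.
  by rewrite e; apply: ptP; rewrite /pseg /comb3 !ptE; ring.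
- exists k0, k1; split; first by move=> j; case: (I3_cases j) => ->;
    [constructor 2|constructor 3|constructor 1].
  apply/conv2P; exists b; first by lra.
  have -> : a = 1 - b by lra.
  by rewrite e; apply: ptP; rewrite /pseg /comb3 !ptE; ring.
Qed.

End Segments.

(** * The subdivision induced by the input triangles, and its boundary sides *)

Section Local.
Variable R : realType.
Implicit Types (p q x y z u v w : pt R) (a b e r s t : R) (X Y : set (pt R)).
Implicit Types (T : tri R) (c d : side).
Variable D : seq (tri R).

Definition sline c : pt R * pt R := (dir D c, src D c).

Lemma line_sideE c x : line_side D c x = lval (sline c) x.
Proof. by []. Qed.

Definition all_sides (n : nat) : seq side :=
  [seq (i, kl) | i <- iota 0 n, kl <- enum (('I_3 * 'I_3)%type : finType)].

Lemma mem_all_sides c n : (c \in all_sides n) = (c.1 < n)%N.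
Proof.
apply/idP/idP.
  by move=> /allpairsP [[i kl] [/= + _ ->]]; rewrite mem_iota.
case: c => i kl /= h; apply/allpairsP; exists (i, kl).
by rewrite mem_iota mem_enum.
Qed.

(** The vertices of the subdivision as points; [sv_pts] is a finite list containing all of them. For
    parallel sides the quotient in [Meet] has denominator 0, and the list then contains some corner
    again, which is harmless. *)
Definition sv y := exists2 v, subdivision_vertex D v & y = eval_vertex D v.

Definition sv_pts : seq (pt R) :=
  [seq corner (input_tri D i) j | i <- iota 0 (size D), j <- enum 'I_3] ++
  [seq eval_vertex D (Meet c d) | c <- all_sides (size D), d <- all_sides (size D)].

Lemma sv_mem y : sv y -> y \in sv_pts.
Proof.
case=> -[i j|c d] /= h ->; rewrite mem_cat; apply/orP.
  left; apply/allpairsP; exists (i, j); split => //=; first by rewrite mem_iota.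
  by rewrite mem_enum.
case: h => -[hc _] [hd _] _ _; right; apply/allpairsP; exists (c, d).
by rewrite !mem_all_sides.
Qed.

Lemma input_triP T : T \in D <-> exists2 i, (i < size D)%N & T = input_tri D i.
Proof.
split; first by move=> /(nthP [tuple 0 | k < 3]) [i hi <-]; exists i.
by case=> i hi ->; apply: mem_nth.
Qed.

Lemma dir_neq0 c : is_side D c -> dir D c != 0.
Proof. by case=> _ /sub_neq0. Qed.

Lemma line_side_src c : line_side D c (src D c) = 0.
Proof. by rewrite /line_side /cross !ptE; ring. Qed.

Lemma line_side_tgt c : line_side D c (tgt D c) = 0.
Proof. by rewrite /line_side /dir /cross !ptE; ring. Qed.

Lemma side_set_line c x : side_set D c x -> line_side D c x = 0.
Proof.
by move=> /conv2P [s _ ->]; rewrite line_sideE lval_pseg -!line_sideE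
  line_side_src line_side_tgt; ring.
Qed.

Lemma meet_on c d : cross (dir D c) (dir D d) != 0 ->
  line_side D c (eval_vertex D (Meet c d)) = 0 /\
  line_side D d (eval_vertex D (Meet c d)) = 0.
Proof.
rewrite /line_side /=; move: (dir D c) (dir D d) (src D c) (src D d) => d1 d2 s1 s2.
rewrite /cross => h; split; first by rewrite !ptE; ring.
by rewrite !ptE; field.
Qed.

Lemma meet_unique c d x : cross (dir D c) (dir D d) != 0 ->
  line_side D c x = 0 -> line_side D d x = 0 -> x = eval_vertex D (Meet c d).
Proof.
move=> h h1 h2; have [h3 h4] := meet_on h; exact: (line_line h h1 h2 h3 h4).
Qed.

Lemma side_sub c : (c.1 < size D)%N -> side_set D c `<=` covered D.
Proof.
move=> hc x hx; exists (input_tri D c.1); first by apply/input_triP; exists c.1.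
exact: conv2_tri hx.
Qed.

Lemma closed_covered : closed (covered D).
Proof.
elim: D => [|T E IH].
  rewrite (_ : covered [::] = set0); first exact: closed0.
  by rewrite -subset0 => x [].
rewrite (_ : covered (T :: E) = tri_set T `|` covered E).
  by apply: closedU => //; apply: closed_tri.
apply/seteqP; split=> x.
  by case=> T' ; rewrite inE => /orP [/eqP ->|h] hx; [left|right; exists T'].
by case=> [h|[T' h hx]]; [exists T; rewrite ?inE ?eqxx|exists T'; rewrite ?inE ?h ?orbT].
Qed.

Lemma sv_corner (i : nat) j : (i < size D)%N -> sv (corner (input_tri D i) j).
Proof. by move=> hi; exists (Corner i j). Qed.

Lemma cov_boundary w : covered D w -> ~ interior (covered D) w ->
  exists2 c, (c.1 < size D)%N & side_set D c w.
Proof.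
case=> T hT hw hi; have [k [l h]] : exists k l, conv [:: corner T k; corner T l] w.
  apply: tri_boundary => // h; apply: hi; apply: interiorS h => x hx; by exists T.
by have /input_triP [i ii e] := hT; exists (i, (k, l)) => //; rewrite /side_set /src /tgt /= -e.
Qed.

(** A degenerate side consists of a corner only, and corners are vertices of the subdivision. *)
Lemma nonsv_side c w : (c.1 < size D)%N -> side_set D c w -> ~ sv w -> is_side D c.
Proof.
move=> hc hw nw; split => // e; apply: nw.
move: hw; rewrite /side_set -e => /conv2P [s _ ->].
by rewrite /pseg subrr scaler0 addr0; apply: sv_corner.
Qed.

Lemma nonsv_parallel c d w : is_side D c -> is_side D d -> side_set D c w ->
  side_set D d w -> ~ sv w -> cross (dir D c) (dir D d) = 0.
Proof.
move=> hc hd wc wd nw; apply: contrapT => /eqP h; apply: nw.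
have e := meet_unique h (side_set_line wc) (side_set_line wd).
exists (Meet c d) => //; split => //; by rewrite -e.
Qed.

Lemma parallel_line c d w x : is_side D c -> is_side D d ->
  cross (dir D c) (dir D d) = 0 -> line_side D c w = 0 -> line_side D d w = 0 ->
  line_side D d x = 0 -> line_side D c x = 0.
Proof.
move=> hc hd h h1 h2 h3.
have h4 : cross (dir D d) (x - w) = 0.
  have -> : cross (dir D d) (x - w) = line_side D d x - line_side D d w.
    by rewrite /line_side /cross !ptE; ring.
  by rewrite h2 h3 subrr.
have := cross_parallel (dir_neq0 hd) h h4.
have -> : cross (dir D c) (x - w) = line_side D c x - line_side D c w.
  by rewrite /line_side /cross !ptE; ring.
by rewrite h1 subr0.
Qed.

Lemma near_tris y (E : seq (tri R)) : exists2 e : R, 0 < e & forall z, box e y z ->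
  forall T, T \in E -> tri_set T z -> tri_set T y.
Proof.
elim: E => [|T E [e e0 he]]; first by exists 1.
case: (pselect (tri_set T y)) => [h|h].
  by exists e => // z hz T'; rewrite inE => /orP [/eqP -> //|]; apply: he.
have : nbhs y (~` tri_set T).
  apply: open_nbhs_nbhs; split => //; apply: closed_openC; exact: closed_tri.
move=> /nbhs_box [e' e0' he']; exists (Num.min e e'); first by rewrite lt_min e0.
move=> z hz T'; rewrite inE => /orP [/eqP ->|hT'].
  by move=> /(he' z); case; apply: box_le hz; rewrite ge_min lexx orbT.
by apply: he => //; apply: box_le hz; rewrite ge_min lexx.
Qed.

(* At a point of a side [c] that is not a vertex of the subdivision, every
   triangle contains a full neighbourhood in each closed half plane of [c] in
   which it has a corner; so [half] for both signs detects interior points. *)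
Definition half c (k : R) y := exists T, [/\ T \in D, tri_set T y
  & exists j, 0 < k * line_side D c (corner T j)].

(** A small step from [y] to the side [k] of [c] stays in a triangle that also contains [y]. If no
    corner of it were strictly on that side, the stepped point could not belong to it. *)
Lemma interior_half c (k : R) y : dir D c != 0 -> line_side D c y = 0 -> k != 0 ->
  interior (covered D) y -> half c k y.
Proof.
move=> d0 ey kn /interior_box [e e0 he].
have [e' e0' he'] := near_tris y D.
pose n := mkpt (- k * py (dir D c)) (k * px (dir D c)).
have ee0 : 0 < Num.min e e' by rewrite lt_min e0.
have [r r0 hr] := box_step y n ee0.
have hz := hr r; rewrite gtr0_norm // lexx in hz.
have [|T hT Tz] := he (y + r *: n); first by apply: box_le (hz isT); rewrite ge_min lexx.
have Ty : tri_set T y by apply: (he' _ _ T hT Tz); apply: box_le (hz isT); rewrite ge_min lexx orbT.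
exists T; split => //; apply: contrapT => H.
have H' j : 0 <= - k * lval (sline c) (corner T j).
  rewrite mulNr oppr_ge0 leNgt; apply/negP => h; apply: H; by exists j.
have := lval_tri H' Tz; rewrite lval_step -line_sideE ey add0r.
have -> : cross (sline c).1 n =
  k * (px (dir D c) * px (dir D c) + py (dir D c) * py (dir D c)).
  by rewrite /cross /n /= !ptE; ring.
have := norm2_gt0 d0; set N := (X in 0 < X) => N0.
have : 0 < k ^+ 2 by rewrite exprn_even_gt0.
move=> k20; have := mulr_gt0 (mulr_gt0 k20 r0) N0.
have -> : - k * (r * (k * N)) = - (k ^+ 2 * r * N) by ring.
lra.
Qed.

(** Positive barycentric coordinates stay positive near [y]. If a coordinate vanishes at [y], the
    corresponding side of [T] passes through [y], which is not a vertex, so that side lies on the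
    line of [c]; the coordinate is then proportional to [line_side D c] and has the right sign on
    the half plane of the opposite corner. *)
Lemma half_near c (k : R) y T j : is_side D c -> side_set D c y -> ~ sv y ->
  T \in D -> tri_set T y -> 0 < k * line_side D c (corner T j) ->
  exists2 e : R, 0 < e & forall z, box e y z -> 0 <= k * line_side D c z -> tri_set T z.
Proof.
move=> hc yc nsv hT Ty hj; have /input_triP [i ii eT] := hT.
have sideT l m : conv [:: corner T l; corner T m] y ->
    line_side D c (corner T l) = 0 /\ line_side D c (corner T m) = 0.
  move=> h; pose d : side := (i, (l, m)).
  have yd : side_set D d y by rewrite /side_set /src /tgt /= -eT.
  have hd : is_side D d by apply: nonsv_side yd nsv.
  have hp := nonsv_parallel hc hd yc yd nsv.
  have hx := parallel_line hc hd hp (side_set_line yc) (side_set_line yd).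
  by split; rewrite eT; apply: hx; [exact: line_side_src|exact: line_side_tgt].
have nf : ~ tri_is_flat T.
  move=> hf; have [l [m e]] := flat_conv2 hf.
  have [|el em] := sideT l m; first by rewrite -e.
  have /conv2P [s _ es] : conv [:: corner T l; corner T m] (corner T j).
    by rewrite -e; apply: corner_in.
  by move: hj; rewrite es line_sideE lval_pseg -!line_sideE el em !mulr0 addr0 mulr0 ltxx.
have F0 : area T != 0 by apply/eqP => /tri_flatE.
have K m : exists2 e : R, 0 < e & forall z, box e y z -> 0 <= k * line_side D c z ->
    0 <= area T * bary T m z.
  have := proj1 (tri_bary y nf) Ty m; rewrite le_eqVlt => /orP [/eqP/esym/eqP|h]; last first.
    move: h; case: (I3_cases m) => -> /cross_pos_box [e e0 he];
    by exists e => // z /he /ltW.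
  rewrite mulf_eq0 (negPf F0) /= => /eqP b0.
  have [l [l' [hl yl]]] := bary0_side Ty nf b0.
  have [z1 z2] := sideT _ _ yl.
  have ej : j = m.
    by case: (hl j) => // e; move: hj; rewrite e ?z1 ?z2 mulr0 ltxx.
  exists 1 => // z _ hz.
  have E : area T * line_side D c z = bary T m z * line_side D c (corner T m).
    rewrite line_sideE bary_affine -!line_sideE.
    have Z (m' : 'I_3) : m' <> m -> line_side D c (corner T m') = 0.
      by case: (hl m') => [->|->|->].
    by case: (I3_cases m) Z => -> Z;
      [rewrite (Z k1) // (Z k2) //|rewrite (Z k0) // (Z k2) //|rewrite (Z k0) // (Z k1) //];
      rewrite ?mulr0 ?addr0 ?add0r.
  rewrite ej in hj; rewrite -(pmulr_lge0 _ hj).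
  have -> : area T * bary T m z * (k * line_side D c (corner T m)) =
    area T * k * (bary T m z * line_side D c (corner T m)) by ring.
  rewrite -E (_ : _ * _ = area T ^+ 2 * (k * line_side D c z)); last by ring.
  by rewrite mulr_ge0 // exprn_even_ge0.
have [e0 p0 h0] := K k0; have [e1 p1 h1] := K k1; have [e2 p2 h2] := K k2.
exists (Num.min e0 (Num.min e1 e2)); first by rewrite !lt_min p0 p1.
move=> z hz hk; apply/(tri_bary _ nf) => m.
by case: (I3_cases m) => ->; [apply: h0|apply: h1|apply: h2] => //;
  apply: box_le hz; rewrite !ge_min lexx ?orbT.
Qed.

Lemma interior_halves c y : is_side D c -> side_set D c y -> ~ sv y ->
  interior (covered D) y <-> half c 1 y /\ half c (-1) y.
Proof.
move=> hc yc nsv; split.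
  move=> h; split; apply: interior_half => //; rewrite ?dir_neq0 ?side_set_line //;
  by rewrite ?oppr_eq0 oner_neq0.
case=> -[T [hT Ty [j hj]]] [T' [hT' Ty' [j' hj']]].
have [e e0 he] := half_near hc yc nsv hT Ty hj.
have [e' e0' he'] := half_near hc yc nsv hT' Ty' hj'.
apply/interior_box; exists (Num.min e e'); first by rewrite lt_min e0.
move=> z hz; case: (lerP 0 (line_side D c z)) => h.
  exists T => //; apply: he; last by rewrite mul1r.
  by apply: box_le hz; rewrite ge_min lexx.
exists T' => //; apply: he'; last by rewrite mulN1r oppr_ge0 ltW.
by apply: box_le hz; rewrite ge_min lexx orbT.
Qed.

(** An edge of the subdivision: two consecutive vertices on the side [c]. *)
Definition elementary c p q :=
  [/\ is_side D c, sv p /\ sv q, side_set D c p /\ side_set D c q, p <> q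
    & forall w, sv w -> ~ open_segment p q w].

Lemma elementaryC c p q : elementary c p q -> elementary c q p.
Proof.
case=> h1 [h2 h3] [h4 h5] h6 h7; split => //; first by move=> e; apply: h6.
by rewrite open_segmentC.
Qed.

Lemma open_segment_side c p q : side_set D c p -> side_set D c q ->
  open_segment p q `<=` side_set D c.
Proof.
move=> h1 h2 x /open_segment_conv; apply: conv2_sub => //; exact: convex_conv2.
Qed.

(** Otherwise there is a last point [w] of [T] on the way from [y] to [q]. It lies on a side of [T],
    which must be parallel to [c] since [w] is not a vertex; for the same reason [w] is not an end
    of that side, so the side continues beyond [w]. Hence a triangle contains all or nothing of an
    open edge. *)
Lemma elementary_tri_r c p q T y : elementary c p q -> T \in D ->
  open_segment p q y -> tri_set T y -> tri_set T q.
Proof.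
case=> hc [_ _] [pc qc] pq hsv hT hy Ty; apply: contrapT => Tq.
have [t t01 ey] := proj1 (open_segmentP _ pq) hy.
have [s [s0 s1 Tw out]] := last_point (@closed_tri _ T) Ty Tq.
set w := pseg y q s in Tw.
have hw : open_segment p q w.
  apply/(open_segmentP _ pq); exists (t + s * (1 - t)).
    by apply/andP; split; nra.
  by rewrite /w ey; apply: ptP; rewrite /pseg !ptE; ring.
have nsv : ~ sv w by move=> /hsv; apply.
have step r : w + r *: (q - y) = pseg y q (s + r).
  by apply: ptP; rewrite /w /pseg !ptE; ring.
have nout (r : R) : 0 < r -> ~ (forall t, `|t| <= r -> tri_set T (w + t *: (q - y))).
  move=> r0 h; pose m := Num.min r (1 - s).
  have m0 : 0 < m by rewrite lt_min r0 subr_gt0.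
  apply: (out (s + m)); first by rewrite ltrDl.
    by rewrite -lerBrDl ge_min lexx orbT.
  by rewrite -step; apply: h; rewrite gtr0_norm // ge_min lexx.
have nint : ~ interior (tri_set T) w.
  move=> /interior_box [e e0 he]; have [r r0 hr] := box_step w (q - y) e0.
  by apply: (nout _ r0) => t' ht; apply: he; apply: hr.
have [k [l wd]] := tri_boundary Tw nint.
have /input_triP [i ii eT] := hT; pose d : side := (i, (k, l)).
have wd' : side_set D d w by rewrite /side_set /src /tgt /= -eT.
have hd : is_side D d := nonsv_side (c := d) ii wd' nsv.
have wc : side_set D c w by apply: open_segment_side hw.
have hp := nonsv_parallel hd hc wd' wc nsv.
have hq : cross (dir D c) (q - y) = 0.
  have -> : cross (dir D c) (q - y) = line_side D c q - line_side D c y.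
    by rewrite /line_side /cross !ptE; ring.
  by rewrite !side_set_line ?subrr //; apply: open_segment_side hy.
have := cross_parallel (dir_neq0 hc) hp hq.
move=> /(parallel_scale (dir_neq0 hd)) [lam elam].
have kl : corner T k <> corner T l.
  by case: hd => _; rewrite /src /tgt /= -eT.
have /(open_segmentP _ kl) [r r01 er] : open_segment (corner T k) (corner T l) w.
  by split => // -[] /= e; apply: nsv; rewrite e eT; apply: sv_corner.
(* A step [t' *: (q - y)] moves the parameter on the side of [T] by [t' * lam], which must not
   exceed the distance of [r] to 0 and 1. *)
pose m := Num.min r (1 - r) / (`|lam| + 1).
have l1 : 0 < `|lam| + 1 by rewrite ltr_wpDl.
have m0 : 0 < m by rewrite divr_gt0 // lt_min; lra.
apply: (nout _ m0) => t' ht'; rewrite elam; apply: (@conv2_tri _ T k l).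
have bnd : `|t' * lam| <= Num.min r (1 - r).
  rewrite normrM; apply: le_trans (_ : m * (`|lam| + 1) <= _); last first.
    by rewrite /m divfK ?gt_eqF.
  by apply: ler_pM => //; rewrite lerDl.
apply/conv2P; exists (r + t' * lam).
  move: bnd; rewrite le_min !ler_norml => /andP [/andP [h1 _] /andP [_ h2]]; lra.
rewrite er /dir /src /tgt /= -eT; apply: ptP; rewrite /pseg !ptE; ring.
Qed.

Lemma elementary_tri c p q T y : elementary c p q -> T \in D ->
  open_segment p q y -> (tri_set T y <-> tri_set T p /\ tri_set T q).
Proof.
move=> h hT hy; split=> [Ty|[Tp Tq]].
  split; last exact: elementary_tri_r h hT hy Ty.
  apply: elementary_tri_r (elementaryC h) hT _ Ty; by rewrite open_segmentC.
by apply: conv2_sub (open_segment_conv hy) => //; apply: convex_tri.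
Qed.

(** The ends are the nearest vertices before and after [y] on [c], found by maximising the scalar
    product with the direction of [c], or its opposite, over the finite list of vertices. *)
Lemma elementary_exists c y : is_side D c -> side_set D c y -> ~ sv y ->
  exists p q, elementary c p q /\ open_segment p q y.
Proof.
move=> hc yc nsv; have hc' := hc; case: hc' => hc1 st.
pose f (x : pt R) := dot (dir D c) (x - src D c).
have d0 := dir_neq0 hc.
have n0 := norm2_gt0 d0; set N := (X in 0 < X) in n0.
have fE s : f (pseg (src D c) (tgt D c) s) = s * N.
  by rewrite /f /dot /pseg /N /dir !ptE; ring.
have par x : side_set D c x -> exists2 s : R, 0 <= s <= 1 & x = pseg (src D c) (tgt D c) s.
  by move/conv2P.
have sv1 : sv (src D c) by apply: sv_corner.
have sv2 : sv (tgt D c) by apply: sv_corner.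
have [t t01 ey] := par _ yc.
have fs : f (src D c) = 0 by rewrite -[src D c](pseg0 _ (tgt D c)) fE mul0r.
have ft : f (tgt D c) = N by rewrite -[tgt D c](pseg1 (src D c)) fE mul1r.
have fy : f y = t * N by rewrite ey fE.
have [|p [_ [[svp pc] fp] maxp]] := @argmax_seq R _ (sv_pts)
   (fun x => (sv x /\ side_set D c x) /\ f x <= f y) f.
  exists (src D c); first by apply/In_mem; apply: sv_mem.
  split; first by split => //; exact: conv2_l.
  by rewrite fs fy; nra.
have [|q [_ [[svq qc] fq] maxq]] := @argmax_seq R _ (sv_pts)
   (fun x => (sv x /\ side_set D c x) /\ f y <= f x) (fun x => - f x).
  exists (tgt D c); first by apply/In_mem; apply: sv_mem.
  split; first by split => //; exact: conv2_r.
  by rewrite ft fy; nra.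
have [a a01 ep] := par _ pc; have [b b01 eq'] := par _ qc.
have ap : a < t.
  move: fp; rewrite ep ey !fE ler_pM2r // le_eqVlt => /orP [/eqP e|//].
  by exfalso; apply: nsv; rewrite ey -e -ep.
have bp : t < b.
  move: fq; rewrite eq' ey !fE ler_pM2r // le_eqVlt => /orP [/eqP e|//].
  by exfalso; apply: nsv; rewrite ey e -eq'.
have E s : pseg p q s = pseg (src D c) (tgt D c) (a + s * (b - a)).
  by rewrite ep eq'; apply: ptP; rewrite /pseg !ptE; ring.
have pq : p <> q.
  by rewrite ep eq' => /(pseg_inj st); lra.
exists p, q; split.
  split => // w svw hw.
  have wc : side_set D c w by apply: open_segment_side hw.
  have [s s01 ew] := proj1 (open_segmentP _ pq) hw.
  rewrite E in ew.
  case: (lerP (f w) (f y)) => h.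
    have := maxp w ltac:(by apply/In_mem; apply: sv_mem) (conj (conj svw wc) h).
    rewrite ew ep !fE ler_pM2r //; nra.
  have := maxq w ltac:(by apply/In_mem; apply: sv_mem) (conj (conj svw wc) (ltW h)).
  rewrite lerN2 ew eq' !fE ler_pM2r //; nra.
apply/(open_segmentP _ pq); exists ((t - a) / (b - a)).
  by apply/andP; split; [apply: divr_gt0; lra|rewrite ltr_pdivrMr; lra].
have hba : 0 < b - a by lra.
have e : a + (t - a) / (b - a) * (b - a) = t by rewrite divfK ?gt_eqF //; ring.
by rewrite E e.
Qed.

(** The condition [half] at the points of an open edge, read off at the two ends; as a condition on
    vertices it can be carried to another snapshot. *)
Definition half2 c (k : R) p q := exists T, [/\ T \in D, tri_set T p, tri_set T q
  & exists j, 0 < k * line_side D c (corner T j)].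

Lemma elementary_half c k p q y : elementary c p q -> open_segment p q y ->
  half c k y <-> half2 c k p q.
Proof.
move=> h hy; split.
  by case=> T [hT Ty hj]; have [Tp Tq] := proj1 (elementary_tri h hT hy) Ty; exists T.
by case=> T [hT Tp Tq hj]; exists T; split => //; apply/(elementary_tri h hT hy).
Qed.

Lemma elementary_interior c p q y : elementary c p q -> open_segment p q y ->
  interior (covered D) y <-> half2 c 1 p q /\ half2 c (-1) p q.
Proof.
move=> h hy; case: (h) => hc _ [pc qc] pq hsv.
have nsv : ~ sv y by move=> /hsv; apply.
have yc : side_set D c y by apply: open_segment_side hy.
rewrite (interior_halves hc yc nsv).
by rewrite (elementary_half 1 h hy) (elementary_half (-1) h hy).
Qed.

Lemma mid_open p q : p <> q -> open_segment p q (pseg p q (1/2)).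
Proof. by move=> pq; apply/(open_segmentP _ pq); exists (1/2) => //; lra. Qed.

Lemma elementary_boundary c p q : elementary c p q ->
  open_segment p q `<=` topo_boundary (covered D) <->
  ~ (half2 c 1 p q /\ half2 c (-1) p q).
Proof.
move=> h; case: (h) => hc _ [pc qc] pq hsv; split.
  move=> hs; rewrite -(elementary_interior h (mid_open pq)).
  by case: (hs _ (mid_open pq)).
move=> nh y hy; split.
  apply: subset_closure; apply: side_sub (proj1 hc) _ _; exact: open_segment_side hy.
by rewrite (elementary_interior h hy).
Qed.

(** A nondegenerate piece of boundary contains a point that is not a vertex, and the edge through
    that point has the same [half] data at all its points. Membership in B(S) becomes a condition on
    finitely many signs. *)
Lemma boundary_sideP c : boundary_side D c <->
  exists p q, elementary c p q /\ ~ (half2 c 1 p q /\ half2 c (-1) p q).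
Proof.
split.
  move=> [hc [x [y [xy hxy]]]].
  have [s s01 hs] := avoid_seq sv_pts (pseg_inj xy) (@ltr01 R).
  set z := pseg x y s in hs.
  have nsv : ~ sv z by move=> /sv_mem; rewrite (negPf hs).
  have [zc [_ nz]] : (side_set D c `&` topo_boundary (covered D)) z.
    by apply: hxy; apply/conv2P; exists s => //; lra.
  have [p [q [h hz]]] := elementary_exists hc zc nsv.
  by exists p, q; split => //; rewrite -(elementary_interior h hz).
case=> p [q [h nh]]; case: (h) => hc _ [pc qc] pq hsv.
split=> //; exists p, q; split => // x hx.
have xc : side_set D c x by apply: conv2_sub hx => //; apply: convex_conv2.
split => //; split; first by apply: subset_closure; apply: side_sub (proj1 hc) _ _.
move=> hi; have op := proj2 (elementary_boundary h) nh.
have /interior_box [e e0 he] : interior (interior (covered D)) x.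
  by have := @open_interior _ (covered D); rewrite openE; apply.
by have [z /op [_ nz] /he] := open_segment_near pq hx e0.
Qed.

(* A path that leaves the covered set and avoids the vertices of the subdivision
   crosses a boundary side. *)
Lemma fill X : convex X -> open X ->
  (forall c x, boundary_side D c -> X x -> ~ side_set D c x) ->
  X `&` interior (covered D) !=set0 -> X `<=` covered D.
Proof.
move=> cX oX hB hne b0 Xb0; apply: contrapT => nb0.
have e1 : mkpt 1 0 != 0 :> pt R.
  apply/eqP => /(congr1 (@px R)); rewrite !ptE; apply/eqP; exact: oner_neq0.
have oY : open (X `&` interior (covered D)) by apply: openI => //; exact: open_interior.
(* Off the horizontal lines through the vertices, [a] is in particular different from every
   vertex. *)
have [|a [Xa /interior_subset ca] ha] := generic_point (L := [seq (mkpt 1 0, v) | v <- sv_pts]) oY hne.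
  by move=> l /In_mem /mapP [v _ ->].
have oZ : open (X `&` ~` covered D).
  by apply: openI => //; apply: closed_openC; exact: closed_covered.
have asv v : v \in sv_pts -> v - a != 0.
  move=> hv; apply/eqP => h.
  have : cross (mkpt 1 0) (a - v) != 0 by apply: (ha (mkpt 1 0, v)); apply/In_mem; apply: map_f.
  rewrite -opprB h oppr0 /cross !ptE !mulr0 subrr eqxx //.
(* Off the lines that join [a] to the vertices, so that the segment from [a] to [b] passes through
   no vertex. *)
have [||b [Xb ncb] hb] := generic_point (L := [seq (v - a, a) | v <- sv_pts]) oZ.
- by exists b0.
- by move=> l /In_mem /mapP [v hv ->]; apply: asv.
have nsv s : ~ sv (pseg a b s).
  move=> /sv_mem hv; have := hb (pseg a b s - a, a) ltac:(by apply/In_mem; apply/mapP; exists (pseg a b s)).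
  by apply/negP; rewrite negbK; apply/eqP; rewrite /pseg /cross /= !ptE; ring.
have [s [s0 s1 hw out]] := last_point closed_covered ca ncb.
set w := pseg a b s in hw.
have nint : ~ interior (covered D) w.
  move=> /interior_box [e e0 he]; have [r r0 hr] := box_step w (b - a) e0.
  pose m := Num.min r (1 - s).
  have m0 : 0 < m by rewrite lt_min r0 subr_gt0.
  apply: (out (s + m)); first by rewrite ltrDl.
    by rewrite -lerBrDl ge_min lexx orbT.
  have -> : pseg a b (s + m) = w + m *: (b - a).
    by apply: ptP; rewrite /w /pseg !ptE; ring.
  by apply: he; apply: hr; rewrite gtr0_norm // ge_min lexx.
have [c hc wc] := cov_boundary hw nint.
have hc' := nonsv_side hc wc (nsv s).
have [p [q [h hwo]]] := elementary_exists hc' wc (nsv s).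
have bc : boundary_side D c.
  by apply/boundary_sideP; exists p, q; rewrite -(elementary_interior h hwo).
by apply: (hB c w bc) => //; apply: cX => //; rewrite s0 ltW.
Qed.

End Local.

(** * The spatial triangulation method *)

Section SpecialTriangles.
Variable R : realType.
Implicit Types (p q x y z u v w n : pt R) (a b c r s t : R) (X Y : set (pt R)).

Lemma conv_mem (s : seq (pt R)) p : p \in s -> conv s p.
Proof.
move=> hp; have hi : (index p s < size s)%N by rewrite index_mem.
exists (fun i => (i == Ordinal hi)%:R); split.
- by move=> i; rewrite ler0n.
- by rewrite (bigD1 (Ordinal hi)) //= eqxx big1 ?addr0 // => i /negPf ->.
- rewrite (bigD1 (Ordinal hi)) //= eqxx scale1r nth_index // big1 ?addr0 //.
  by move=> i /negPf ->; rewrite scale0r.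
Qed.

Lemma convex_conv (s : seq (pt R)) : convex (conv s).
Proof.
move=> x y t [w [w0 w1 ->]] [w' [w0' w1' ->]] t01.
exists (fun i => (1 - t) * w i + t * w' i); split.
- by move=> i; have := w0 i; have := w0' i; nra.
- by rewrite big_split /= -!mulr_sumr w1 w1'; ring.
- rewrite /pseg; set S := \sum_i w i *: _; set S' := \sum_i w' i *: _.
  have -> : S + t *: (S' - S) = (1 - t) *: S + t *: S'.
    by apply: ptP; rewrite !ptE; ring.
  rewrite /S /S' !scaler_sumr -big_split /=; apply: eq_bigr => i _.
  by rewrite !scalerA -scalerDl.
Qed.

Lemma centroid_perm (s s' : seq (pt R)) : perm_eq s s' -> centroid s = centroid s'.
Proof. by move=> h; rewrite /centroid (perm_size h) (perm_big _ h). Qed.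

Lemma extreme_pseg X y u v r : extreme_point X y -> X u -> X v -> 0 < r < 1 ->
  y = pseg u v r -> u = v.
Proof.
move=> [_ h] Xu Xv /andP [r0 r1] e; symmetry.
apply: (h _ _ r) => //; rewrite e; apply: ptP; rewrite /pseg !ptE; ring.
Qed.

Lemma closed_open_segment X p q : closed X -> p <> q -> open_segment p q `<=` X ->
  conv [:: p; q] `<=` X.
Proof.
move=> cX pq h x hx; apply: cX; apply/closure_box => e e0.
by have [z /h Xz bz] := open_segment_near pq hx e0; exists z.
Qed.

Definition mktri p q u : tri R := [tuple p; q; u].
Lemma mktri0 p q u : corner (mktri p q u) k0 = p. Proof. by []. Qed.
Lemma mktri1 p q u : corner (mktri p q u) k1 = q. Proof. by []. Qed.
Lemma mktri2 p q u : corner (mktri p q u) k2 = u. Proof. by []. Qed.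
Definition mktriE := (mktri0, mktri1, mktri2).

Lemma mktriP X p q u : convex X -> X p -> X q -> X u -> tri_set (mktri p q u) `<=` X.
Proof. move=> cX hp hq hu; rewrite tri_setE !mktriE; exact: conv3_sub. Qed.

Lemma mktri_swap p q u : tri_set (mktri p q u) = tri_set (mktri p u q).
Proof.
by apply/seteqP; split; (apply: mktriP; first exact: convex_tri);
  first [exact: (corner_in _ k0)|exact: (corner_in _ k1)|exact: (corner_in _ k2)].
Qed.

Lemma mktri_seg p q : tri_set (mktri p q q) = conv [:: p; q].
Proof.
apply/seteqP; split.
  by apply: mktriP; [exact: convex_conv2|exact: conv2_l|exact: conv2_r|exact: conv2_r].
by apply: conv2_sub; [exact: convex_tri|exact: (corner_in _ k0)|exact: (corner_in _ k1)].
Qed.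

Lemma mktri_pt p : tri_set (mktri p p p) = [set p].
Proof.
rewrite mktri_seg; apply/seteqP; split=> x; last by move=> ->; apply: conv2_l.
by move=> /conv2P [s _ ->]; rewrite /pseg subrr scaler0 addr0.
Qed.

Lemma mktri_seg_flat p q : tri_is_flat (mktri p q q).
Proof. by apply/tri_flatE; rewrite /area !mktriE /cross; ring. Qed.

Lemma extreme_conv2_l p q : p <> q -> extreme_point (conv [:: p; q]) p.
Proof.
move=> pq; split; first exact: conv2_l.
move=> x y s /conv2P [a a01 ->] /conv2P [b b01 ->] s0 s1 e.
have E : s *: pseg p q a + (1 - s) *: pseg p q b = pseg p q (s * a + (1 - s) * b).
  by apply: ptP; rewrite /pseg !ptE; ring.
move: e; rewrite E -[LHS](pseg0 p q) => /(pseg_inj pq) e.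
have ea : a = 0 by nra.
have eb : b = 0 by nra.
by rewrite ea eb.
Qed.

Lemma seg_interior p q : p <> q -> tri_interior (mktri p q q) = open_segment p q.
Proof.
move=> pq; apply/seteqP; split=> x.
  case=> [[nf _]|[_ [+ nx]]|[hp _]].
  - by exfalso; apply: nf; apply: mktri_seg_flat.
  - rewrite mktri_seg in nx * => hx; split => // -[] /= e; apply: nx; rewrite e.
      exact: extreme_conv2_l.
    by rewrite conv2C; apply: extreme_conv2_l => e'; apply: pq.
  - by exfalso; apply: pq; apply: (hp k0 k1).
move=> hx; constructor 2; split.
  split; first exact: mktri_seg_flat.
  by move=> h; apply: pq; apply: (h k0 k1).
rewrite mktri_seg; split; first exact: open_segment_conv.
move=> [_ ext]; have [s s01 e] := proj1 (open_segmentP _ pq) hx.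
case/andP: s01 => s0 s1; apply: pq; apply: (ext _ _ (1 - s)); try exact: conv2_l;
  try exact: conv2_r; rewrite ?subr_gt0 ?ltrBlDl ?ltrDr //.
by rewrite e; apply: ptP; rewrite /pseg !ptE; ring.
Qed.

Lemma pt_interior p : tri_interior (mktri p p p) = [set p].
Proof.
have fl := mktri_seg_flat p p.
have hp : tri_is_point (mktri p p p).
  by move=> k l; case: (I3_cases k) => ->; case: (I3_cases l) => ->.
apply/seteqP; split=> x.
  by case=> [[]//|[[_ []]]//|[_]]; rewrite mktri_pt.
by move=> ->; constructor 3; rewrite mktri_pt.
Qed.

Lemma nonflat_tri_interior (T : tri R) : ~ tri_is_flat T ->
  tri_interior T = interior (tri_set T).
Proof.
move=> nf; apply/seteqP; split=> x.
  case=> [[]//|[[]//]|[hp _]]; exfalso; apply: nf; apply/tri_flatE.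
  by rewrite /area (hp k1 k0) subrr /cross !ptE; ring.
by move=> hx; constructor 1.
Qed.

Lemma nonflat_edge l (a : pt R) p q : p <> q -> lval l p = 0 -> lval l q = 0 ->
  lval l a != 0 -> ~ tri_is_flat (mktri a p q).
Proof.
move=> pq hp hq ha /tri_flatE h.
have N0 := norm2_gt0 (sub_neq0 pq).
(* A point beside the line through [p] and [q]: with area 0, interpolating [l] at this point would
   give a nonzero multiple of the value at [a]. *)
pose x := p + mkpt (- py (q - p)) (px (q - p)).
have := bary_affine (mktri a p q) l x; rewrite !mktriE h hp hq !mulr0 !addr0 mul0r.
move/esym/eqP; rewrite mulf_eq0 (negPf ha) orbF /bary /= !mktriE => /eqP.
have -> : cross (q - p) (x - p) = px (q - p) * px (q - p) + py (q - p) * py (q - p).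
  by rewrite /cross /x !ptE; ring.
by move=> e; move: N0; rewrite e ltxx.
Qed.

Lemma lval_comb3 l a b c p q u : a + b + c = 1 ->
  lval l (comb3 a b c p q u) = a * lval l p + b * lval l q + c * lval l u.
Proof.
by move=> h; have -> : c = 1 - a - b by [lra]; rewrite /lval /comb3 /cross !ptE; ring.
Qed.

Lemma interior_comb3 (T : tri R) x : ~ tri_is_flat T -> interior (tri_set T) x ->
  exists a b c, [/\ 0 < a, 0 < b, 0 < c, a + b + c = 1 &
    x = comb3 a b c (corner T k0) (corner T k1) (corner T k2)].
Proof.
move=> nf hx; have := proj1 (tri_interior_bary x nf) hx.
have /tri_setP [a [b [c [a0 b0 c0 h ->]]]] : tri_set T x by apply: interior_subset.
have [h0 h1 h2] := bary_comb T h => hb.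
have K (r : R) : 0 < area T * (r * area T) -> 0 < r.
  rewrite mulrCA pmulr_lgt0 // -expr2 exprn_even_gt0 //.
  by apply/eqP => /tri_flatE.
exists a, b, c; split => //; apply: K; rewrite -?h0 -?h1 -?h2; exact: hb.
Qed.

Lemma tri_pseg_interior (T : tri R) x s : ~ tri_is_flat T -> tri_set T x -> 0 < s <= 1 ->
  interior (tri_set T)
    (pseg x (comb3 (1/3) (1/3) (1/3) (corner T k0) (corner T k1) (corner T k2)) s).
Proof.
move=> nf hx s01; set g := comb3 _ _ _ _ _ _.
have hg := proj1 (tri_interior_bary _ nf) (nonflat_interior nf).
apply/(tri_interior_bary _ nf) => k; have := hg k; have := proj1 (tri_bary _ nf) hx k.
rewrite -/g.
have -> : bary T k (pseg x g s) = (1 - s) * bary T k x + s * bary T k g.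
  by case: (I3_cases k) => ->; rewrite /bary /=; apply: cross_pseg.
move=> h1 h2.
have : 0 < s * (area T * bary T k g) by rewrite mulr_gt0 //; lra.
have : 0 <= (1 - s) * (area T * bary T k x) by rewrite mulr_ge0 //; lra.
nra.
Qed.

End SpecialTriangles.

(** * Polygons of the arrangement and their fans *)

Section Poly.
Variable R : realType.
Implicit Types (p q x y z : pt R) (r t : R) (X Y P : set (pt R)).
Implicit Types (T : tri R) (c d : side).
Variable D : seq (tri R).

Definition blines : seq (pt R * pt R) :=
  [seq sline D c | c <- all_sides (size D) & `[< boundary_side D c >]].

Lemma in_blines l : List.In l blines <-> exists2 c, boundary_side D c & l = sline D c.
Proof.
rewrite In_mem; split.
  by move=> /mapP [c]; rewrite mem_filter => /andP [/asboolP hc _] ->; exists c.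
case=> c hc ->; apply/mapP; exists c => //.
rewrite mem_filter mem_all_sides; apply/andP; split; first by apply/asboolP.
by case: hc => -[].
Qed.

Lemma blines_dir l : List.In l blines -> l.1 != 0.
Proof. by case/in_blines=> c [hc _] ->; apply: dir_neq0. Qed.

Definition off_blines x := forall l, List.In l blines -> lval l x != 0.

Lemma off_blinesP x : off_blines x <-> forall c, boundary_side D c -> line_side D c x != 0.
Proof.
split=> h; first by move=> c hc; apply: (h (sline D c)); apply/in_blines; exists c.
by move=> l /in_blines [c hc ->]; apply: h.
Qed.

Lemma covered_hull : covered D `<=` hull D.
Proof.
move=> x [T hT]; apply: tri_sub; first exact: convex_conv.
move=> k; apply: conv_mem; apply/flattenP; exists (tval T); first exact: map_f.
exact: mem_tnth.
Qed.

Lemma covered_bounded : bounded_pts (covered D).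
Proof.
elim: D => [|T E [M hM]]; first by exists 0 => x [].
pose N := (`|px (corner T k0)| + `|px (corner T k1)| + `|px (corner T k2)|) +
  (`|py (corner T k0)| + `|py (corner T k1)| + `|py (corner T k2)|).
exists (Num.max M N) => x [T']; rewrite inE => /orP [/eqP ->|h] hx; last first.
  have [h1 h2] : `|px x| <= M /\ `|py x| <= M by apply: hM; exists T'.
  by split; rewrite le_max ?h1 ?h2.
have {hx} [a [b [c [a0 b0 c0 h ->]]]] := proj1 (tri_setP T x) hx.
have := normr_ge0 (px (corner T k0)); have := normr_ge0 (px (corner T k1)).
have := normr_ge0 (px (corner T k2)); have := normr_ge0 (py (corner T k0)).
have := normr_ge0 (py (corner T k1)); have := normr_ge0 (py (corner T k2)).
move=> n1 n2 n3 n4 n5 n6.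
have K (g0 g1 g2 : R) : `|a * g0 + b * g1 + c * g2| <= `|g0| + `|g1| + `|g2|.
  have B1 (k g : R) : 0 <= k -> k <= 1 -> `|k * g| <= `|g|.
    by move=> k0 k1; rewrite normrM ger0_norm // ler_piMl.
  apply: le_trans (ler_normD _ _) _; apply: lerD; last by apply: B1 => //; lra.
  by apply: le_trans (ler_normD _ _) _; apply: lerD; apply: B1 => //; lra.
split; rewrite le_max; apply/orP; right; rewrite /comb3 !ptE;
  apply: le_trans (K _ _ _) _; rewrite /N; lra.
Qed.

Lemma convex_region x0 : convex (region blines x0).
Proof.
move=> x y s hx hy s01 l hl; rewrite lval_pseg.
have := hx l hl; have := hy l hl => h1 h2.
have h3 : 0 <= (1 - s) * (lval l x0 * lval l x).
  by apply: mulr_ge0; [lra|exact: ltW].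
case: (eqVneq s 0) => [->|s0]; first by move: h2; rewrite subr0 mul1r mul0r addr0.
have h4 : 0 < s * (lval l x0 * lval l y).
  by apply: mulr_gt0 => //; rewrite lt_def s0 /=; lra.
by nra.
Qed.

(** A boundary side lies on one of the lines of the arrangement, and the cell meets none of them; so
    [fill] applies. *)
Lemma region_covered x0 : region blines x0 `&` interior (covered D) !=set0 ->
  region blines x0 `<=` covered D.
Proof.
apply: fill; [exact: convex_region|exact: open_region|].
move=> c x hc hx xc; have : 0 < line_side D c x0 * line_side D c x.
  by apply: (hx (sline D c)); apply/in_blines; exists c.
by rewrite (side_set_line xc) mulr0 ltxx.
Qed.

Lemma interior_hull X : open X -> X `<=` covered D -> X `<=` interior (hull D).
Proof.
move=> oX h x Xx; move: oX; rewrite openE => /(_ _ Xx).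
apply: interiorS; apply: subset_trans h _; exact: covered_hull.
Qed.

Lemma region_polygon x0 : off_blines x0 -> region blines x0 `<=` covered D ->
  is_polygon D (region blines x0).
Proof.
move=> h0 hc; have hi := interior_hull (@open_region R blines x0) hc.
exists x0; split.
- by apply: hi; apply: region_base.
- exact/off_blinesP.
- apply/seteqP; split=> x.
    move=> hx; split; first exact: hi.
    by move=> c hb; apply: (hx (sline D c)); apply/in_blines; exists c.
  by move=> [_ hx] l /in_blines [c hb ->]; apply: hx.
Qed.

(** The cell of [x0] meets the interior of the covered set, so it is covered by [region_covered] and
    therefore inside the hull; hence [P] is the whole cell. Cells are then handled without reference
    to the hull. *)
Lemma polygon_region P : is_polygon D P -> P `<=` covered D ->
  exists x0, [/\ off_blines x0, region blines x0 `<=` covered D & P = region blines x0].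
Proof.
case=> x0 [i0 h0 eP] hP; exists x0.
have off : off_blines x0 by apply/off_blinesP.
have Px0 : P x0.
  rewrite eP; split => // c hc; rewrite -expr2 exprn_even_gt0 //=; exact: h0.
have oP : open P.
  rewrite (_ : P = interior (hull D) `&` region blines x0).
    by apply: openI; [exact: open_interior|exact: open_region].
  rewrite eP; apply/seteqP; split=> x [h1 h2]; split => //.
    by move=> l /in_blines [c hb ->]; apply: h2.
  by move=> c hb; apply: (h2 (sline D c)); apply/in_blines; exists c.
have hr : region blines x0 `<=` covered D.
  apply: region_covered; exists x0; split; first exact: region_base.
  by move: oP; rewrite openE => /(_ _ Px0); apply: interiorS.
split => //.
have hi := interior_hull (@open_region R blines x0) hr.
rewrite eP; apply/seteqP; split=> x.
  by move=> [_ hx] l /in_blines [c hb ->]; apply: hx.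
move=> hx; split; first exact: hi.
by move=> c hb; apply: (hx (sline D c)); apply/in_blines; exists c.
Qed.

Lemma cregion_covered x0 : off_blines x0 -> region blines x0 `<=` covered D ->
  cregion blines x0 `<=` covered D.
Proof.
move=> h0 hr; rewrite -(closure_region h0) => x hx.
by apply: closed_covered; apply: closure_subset hx.
Qed.

Lemma cregion_bounded x0 : off_blines x0 -> region blines x0 `<=` covered D ->
  bounded_pts (cregion blines x0).
Proof.
move=> h0 hr; have [M hM] := covered_bounded; exists M => x hx; apply: hM.
exact: cregion_covered hx.
Qed.

Lemma vertex_meet x0 p : off_blines x0 -> polygon_vertex (region blines x0) p <->
  cregion blines x0 p /\ exists c d, [/\ boundary_side D c, boundary_side D d,
    cross (dir D c) (dir D d) != 0 & p = eval_vertex D (Meet c d)].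
Proof.
move=> h0; rewrite /polygon_vertex closure_region //; split.
  move=> ep; split; first by case: ep.
  have [l [m [/in_blines [c hc ->] /in_blines [d hd ->] e1 e2 h]]] := extreme_meet blines_dir ep.
  by exists c, d; split => //; apply: meet_unique.
case=> hp [c [d [hc hd h e]]]; have [e1 e2] := meet_on h.
apply: (@meet_extreme R blines x0 h0 p (sline D c) (sline D d)) => //.
- by apply/in_blines; exists c.
- by apply/in_blines; exists d.
- by rewrite e.
- by rewrite e.
Qed.

Lemma meet_sv_pts c d : (c.1 < size D)%N -> (d.1 < size D)%N ->
  eval_vertex D (Meet c d) \in sv_pts D.
Proof.
move=> hc hd; rewrite mem_cat; apply/orP; right; apply/allpairsP; exists (c, d).
by rewrite !mem_all_sides.
Qed.

Lemma vertex_sv_pts x0 p : off_blines x0 -> polygon_vertex (region blines x0) p ->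
  p \in sv_pts D.
Proof.
move=> h0 /(vertex_meet p h0) [_ [c [d [[[hc _] _] [[hd _] _] _ ->]]]].
exact: meet_sv_pts.
Qed.

Lemma vertices_exist x0 : off_blines x0 ->
  exists s, computes_vertices D (region blines x0) s.
Proof.
move=> h0.
pose Q v := exists c d, [/\ v = Meet c d, boundary_side D c, boundary_side D d
          & cross (dir D c) (dir D d) != 0] /\ cregion blines x0 (eval_vertex D v).
have [v|s [h1 h2 h3]] := @representatives _ _ Q (eval_vertex D) (sv_pts D).
  case=> c [d [[-> [[hc _] _] [[hd _] _] _] _]]; apply/In_mem; exact: meet_sv_pts.
exists s; split.
- by move=> v /h1 [c [d [hv _]]]; exists c, d.
- apply/(uniqP 0) => i j; rewrite !inE size_map => hi hj.
  rewrite !(nth_map (Corner 0 k0)) // => e.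
  case: (ltngtP i j) => // ij.
    by case: (h3 (Corner 0 k0) i j); rewrite ?ij.
  by case: (h3 (Corner 0 k0) j i); rewrite ?ij.
- move=> p; rewrite (vertex_meet p h0); split.
    move=> /mem_map_In [v hv ->].
    have [c [d [[-> hc hd h] hx]]] := h1 v hv.
    by split => //; exists c, d.
  case=> hp [c [d [hc hd h e]]].
  have [|v hv ev] := h2 (Meet c d); first by exists c, d; split => //; rewrite -e.
  by apply/mem_map_In; exists v; rewrite // ev -e.
Qed.

Lemma eval_centroid s : eval_point D (Centroid s) = centroid (map (eval_vertex D) s).
Proof. by rewrite /= /centroid size_map big_map. Qed.

Lemma eval_triE e : eval_tri D e = mktri (eval_point D e.1.1) (eval_point D e.1.2) (eval_point D e.2).
Proof. by []. Qed.

(** No vertex is on the wrong side of a line, and by [region_vertex] at least one is off it, so the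
    average is strictly on the right side. *)
Lemma centroid_region x0 s : off_blines x0 -> region blines x0 `<=` covered D ->
  computes_vertices D (region blines x0) s ->
  region blines x0 (centroid (map (eval_vertex D) s)).
Proof.
move=> h0 hr [_ _ hs] l hl.
have hb := cregion_bounded h0 hr.
apply: centroid_pos.
  by move=> v /hs; rewrite vertex_meet // => -[hv _]; apply: hv.
have [v ev lv] := region_vertex blines_dir h0 hb hl.
exists v; first by apply/hs; rewrite /polygon_vertex closure_region.
by rewrite mulf_neq0 // h0.
Qed.

(** That an edge does not meet the polygon is expressed by a line [l] of the arrangement through
    both ends, which is a condition on signs at vertices. *)
Definition fan_data x0 s u v (l : pt R * pt R) :=
  [/\ off_blines x0 /\ region blines x0 `<=` covered D,
      computes_vertices D (region blines x0) s,
      extreme_point (cregion blines x0) (eval_vertex D u) /\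
        extreme_point (cregion blines x0) (eval_vertex D v),
      eval_vertex D u <> eval_vertex D v /\ (List.In u s /\ List.In v s)
    & [/\ List.In l blines, lval l (eval_vertex D u) = 0 & lval l (eval_vertex D v) = 0]].

Lemma polygon_partP e : TS_polygon_part D e <->
  exists x0 s u v l, fan_data x0 s u v l /\ e = (Centroid s, Vertex u, Vertex v).
Proof.
split.
  case=> P [s [u [v [[hP cP] hs [us vs] [uv dj] ->]]]].
  have [x0 [h0 hr eP]] := polygon_region hP cP; rewrite eP in hs dj.
  have ex w : List.In w s -> extreme_point (cregion blines x0) (eval_vertex D w).
    move=> hw; rewrite -(closure_region h0); case: hs => _ _ hs.
    by apply/hs; apply/mem_map_In; exists w.
  have [l [hl lu lv]] := edge_line h0 (proj1 (ex u us)) (proj1 (ex v vs)) dj.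
  by exists x0, s, u, v, l; split => //; split => //; split; apply: ex.
case=> x0 [s [u [v [l [[[h0 hr] hs [eu ev] [uv [us vs]] [hl lu lv]] ->]]]]].
exists (region blines x0), s, u, v; split => //.
  by split => //; apply: region_polygon.
split => //; rewrite -subset0 => x [/conv2P [t t01 ->] /(_ l hl)].
by rewrite lval_pseg lu lv !mulr0 addr0 mulr0 ltxx.
Qed.

Definition fan_tri s u v := eval_tri D (Centroid s, Vertex u, Vertex v).

Lemma fan_triE s u v : fan_tri s u v =
  mktri (centroid (map (eval_vertex D) s)) (eval_vertex D u) (eval_vertex D v).
Proof. by rewrite /fan_tri eval_triE eval_centroid. Qed.

Lemma fan_nonflat x0 s u v l : fan_data x0 s u v l -> ~ tri_is_flat (fan_tri s u v).
Proof.
case=> -[h0 hr] hs _ [uv _] [hl lu lv]; rewrite fan_triE.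
apply: (nonflat_edge uv lu lv); have := centroid_region h0 hr hs hl.
by apply: contraTneq => ->; rewrite mulr0 ltxx.
Qed.

Lemma fan_interior x0 s u v l : fan_data x0 s u v l ->
  interior (tri_set (fan_tri s u v)) `<=` region blines x0.
Proof.
move=> h x hx; have nf := fan_nonflat h.
have [a [b [c [a0 b0 c0 abc ->]]]] := interior_comb3 nf hx.
case: h => -[h0 hr] hs [eu ev] _ _ m hm; rewrite lval_comb3 // fan_triE !mktriE.
have := centroid_region h0 hr hs hm; have := proj1 eu m hm; have := proj1 ev m hm.
set A := lval m (centroid _) => h1 h2 h3.
have := mulr_gt0 a0 h3; have := mulr_ge0 (ltW b0) h2; have := mulr_ge0 (ltW c0) h1.
nra.
Qed.

Lemma sign_trans (a b c e : R) : 0 < a * b -> 0 < c * b -> 0 < a * e -> 0 < c * e.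
Proof.
move=> h1 h2 h3; have : 0 < c * e * ((a * b) * (a * b)).
  rewrite (_ : _ * _ = a * b * (c * b) * (a * e)); last by ring.
  by apply: mulr_gt0 => //; apply: mulr_gt0.
by rewrite pmulr_lgt0 // mulr_gt0.
Qed.

Lemma region_eq x0 x1 z : region blines x0 z -> region blines x1 z ->
  region blines x0 = region blines x1.
Proof.
move=> h h'; apply/seteqP; split=> x hx l hl; have h1 := h l hl;
have h2 := h' l hl; have h3 := hx l hl.
  exact: sign_trans h1 h2 h3.
exact: sign_trans h2 h1 h3.
Qed.

Lemma vertices_perm P s s' : computes_vertices D P s -> computes_vertices D P s' ->
  perm_eq (map (eval_vertex D) s) (map (eval_vertex D) s').
Proof.
move=> [_ u1 h1] [_ u2 h2]; apply: uniq_perm => // p.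
by apply/idP/idP => [/h1/h2|/h2/h1].
Qed.

(** The open intervals between 0 and 1 and between [a] and [b] share the point [r], and neither
    contains an end of the other; so they have the same ends. *)
Lemma interval_ends (a b r t : R) : 0 < t < 1 -> 0 < r < 1 -> r = a + t * (b - a) ->
  ~ 0 < a < 1 -> ~ 0 < b < 1 -> ~ (a < 0 < b \/ b < 0 < a) ->
  ~ (a < 1 < b \/ b < 1 < a) -> (a = 0 /\ b = 1) \/ (a = 1 /\ b = 0).
Proof.
move=> /andP [t0 t1] /andP [r0 r1] ert a01 b01 p0 p1.
case: (ltrgtP a 0) => ha.
- exfalso; case: (ltrP 0 b) => hb; first by apply: p0; left; rewrite ha hb.
  by nra.
- case: (ltrgtP a 1) => ha1; first by exfalso; apply: a01; rewrite ha ha1.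
    exfalso; case: (ltrP b 1) => hb; first by apply: p1; right; rewrite ha1 hb.
    by nra.
  right; split => //; case: (ltrgtP b 0) => hb //.
    by exfalso; apply: p0; right; rewrite hb ha.
  exfalso; case: (ltrP b 1) => hb1; first by apply: b01; rewrite hb hb1.
  by nra.
- left; split => //; case: (ltrgtP b 1) => hb //.
    exfalso; case: (ltrP 0 b) => hb1; first by apply: b01; rewrite hb hb1.
    by nra.
  by exfalso; apply: p1; left; rewrite hb ha ltr01.
Qed.

(** With [p'] and [q'] expressed by parameters on the line through [p] and [q], this is
    [interval_ends]. It identifies overlapping edges, both of fans and of the subdivision. *)
Lemma same_segment p q p' q' w : p <> q -> p' <> q' ->
  open_segment p q w -> open_segment p' q' w ->
  cross (q - p) (p' - p) = 0 -> cross (q - p) (q' - p) = 0 ->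
  ~ open_segment p q p' -> ~ open_segment p q q' ->
  ~ open_segment p' q' p -> ~ open_segment p' q' q ->
  (p = p' /\ q = q') \/ (p = q' /\ q = p').
Proof.
move=> pq pq' hw hw' c1 c2 np' nq' np nq.
have d0 := sub_neq0 pq.
have [a ea] := parallel_scale d0 c1; have [b eb] := parallel_scale d0 c2.
have {}ea : p' = pseg p q a by rewrite /pseg -ea addrC subrK.
have {}eb : q' = pseg p q b by rewrite /pseg -eb addrC subrK.
have [r r01 er] := proj1 (open_segmentP _ pq) hw.
have [t t01 et] := proj1 (open_segmentP _ pq') hw'.
have ab : a <> b by move=> h; apply: pq'; rewrite ea eb h.
have ert : r = a + t * (b - a).
  apply: (pseg_inj pq); rewrite -er et ea eb; apply: ptP; rewrite /pseg !ptE; ring.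
have a01 : ~ 0 < a < 1 by move=> h; apply: np'; apply/(open_segmentP _ pq); exists a.
have b01 : ~ 0 < b < 1 by move=> h; apply: nq'; apply/(open_segmentP _ pq); exists b.
have K (m : R) : a < m < b \/ b < m < a -> open_segment p' q' (pseg p q m).
  move=> hm; apply/(open_segmentP _ pq').
  have hba : b - a != 0 by rewrite subr_eq0; apply/eqP => e; apply: ab.
  exists ((m - a) / (b - a)).
    clear - hm; case: hm => hm.
      by apply/andP; split; [apply: divr_gt0; lra|rewrite ltr_pdivrMr; lra].
    rewrite -mulrNN -invrN; apply/andP; split; first by apply: divr_gt0; lra.
    by rewrite ltr_pdivrMr; lra.
  have e : a + (m - a) / (b - a) * (b - a) = m by rewrite divfK //; ring.
  rewrite -{1}e ea eb; apply: ptP; rewrite /pseg !ptE; ring.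
have p0 : ~ (a < 0 < b \/ b < 0 < a) by move=> /K; rewrite pseg0; apply: np.
have p1 : ~ (a < 1 < b \/ b < 1 < a) by move=> /K; rewrite pseg1; apply: nq.
have [[a0 b1]|[a1 b0]] := interval_ends t01 r01 ert a01 b01 p0 p1.
- by left; rewrite ea eb a0 b1 pseg0 pseg1.
- by right; rewrite ea eb a1 b0 pseg0 pseg1.
Qed.

Lemma extreme_open_segment X y p q : extreme_point X y -> X p -> X q -> p <> q ->
  ~ open_segment p q y.
Proof.
move=> ey Xp Xq pq /(open_segmentP _ pq) [r r01 e].
exact: pq (extreme_pseg ey Xp Xq r01 e).
Qed.

(** The triangles lie in the same cell, hence have the same vertex set and the same centroid [A].
    Once [A] is shown to have the same weight in both representations of [z], the second edge lies
    on the line of the first, and removing [A] from [z] leaves a point common to both edges;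
    vertices being extreme, [same_segment] applies. *)
Lemma fan_overlap x0 s u v l x1 s' u' v' l' z : fan_data x0 s u v l ->
  fan_data x1 s' u' v' l' -> interior (tri_set (fan_tri s u v)) z ->
  interior (tri_set (fan_tri s' u' v')) z ->
  [/\ region blines x0 = region blines x1,
    perm_eq (map (eval_vertex D) s) (map (eval_vertex D) s')
   & (eval_vertex D u = eval_vertex D u' /\ eval_vertex D v = eval_vertex D v') \/
     (eval_vertex D u = eval_vertex D v' /\ eval_vertex D v = eval_vertex D u')].
Proof.
move=> h h' hz hz'.
have er : region blines x0 = region blines x1.
  exact: region_eq (fan_interior h hz) (fan_interior h' hz').
have ps : perm_eq (map (eval_vertex D) s) (map (eval_vertex D) s').
  by case: h => _ hs _ _ _; case: h' => _; rewrite -er => hs' _ _ _; apply: vertices_perm hs hs'.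
split => //.
have [a [b [c [a0 b0 c0 abc ez]]]] := interior_comb3 (fan_nonflat h) hz.
have [a' [b' [c' [a0' b0' c0' abc' ez']]]] := interior_comb3 (fan_nonflat h') hz'.
have ec := centroid_perm ps.
have cr : cregion blines x0 = cregion blines x1.
  case: h => -[h0 _] _ _ _ _; case: h' => -[h1 _] _ _ _ _.
  by rewrite -(closure_region h0) er closure_region.
rewrite !fan_triE !mktriE in ez ez'; rewrite -ec in ez'.
case: h => -[h0 hr] hs [eu ev] [uv _] [hl lu lv].
case: h' => -[h1 hr'] _ [eu' ev'] [uv' _] [hl' lu' lv']; rewrite -cr in eu' ev'.
have hA := centroid_region h0 hr hs; set A := centroid _ in ez ez' hA.
set p := eval_vertex D u in ez eu lu uv *; set q := eval_vertex D v in ez ev lv uv *.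
set p' := eval_vertex D u' in ez' eu' lu' uv' *; set q' := eval_vertex D v' in ez' ev' lv' uv' *.
have A1 := hA l hl; have A2 := hA l' hl'.
have E1 := congr1 (lval l) (etrans (esym ez) ez').
have E2 := congr1 (lval l') (etrans (esym ez) ez').
rewrite !lval_comb3 // lu lv in E1; rewrite !lval_comb3 // lu' lv' in E2.
have n1 := proj1 eu' l hl; have n2 := proj1 ev' l hl.
have m1 := proj1 eu l' hl'; have m2 := proj1 ev l' hl'.
have F1 : lval l x0 * (a * lval l A + b * 0 + c * 0) =
  a' * (lval l x0 * lval l A) + b' * (lval l x0 * lval l p') + c' * (lval l x0 * lval l q').
  by rewrite E1; ring.
have F2 : a * (lval l' x0 * lval l' A) + b * (lval l' x0 * lval l' p) + c * (lval l' x0 * lval l' q)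
   = lval l' x0 * (a' * lval l' A + b' * 0 + c' * 0).
  by rewrite -E2; ring.
have G1 := mulr_ge0 (ltW b0') n1; have G2 := mulr_ge0 (ltW c0') n2.
have G3 := mulr_ge0 (ltW b0) m1; have G4 := mulr_ge0 (ltW c0) m2.
(* [l] vanishes on the first edge and is nowhere on the wrong side on the second, which gives
   [a' <= a]; [l'] gives the converse. *)
have aa : a = a'.
  apply/eqP; rewrite eq_le; apply/andP; split.
    rewrite -(ler_pM2r A2); nra.
  rewrite -(ler_pM2r A1); nra.
have lp' : lval l p' = 0.
  have : b' * (lval l x0 * lval l p') = 0 by rewrite -aa in F1; nra.
  by move/eqP; rewrite !mulf_eq0 (negPf (h0 _ hl)) gt_eqF //= => /eqP.
have lq' : lval l q' = 0.
  have : c' * (lval l x0 * lval l q') = 0 by rewrite -aa in F1; nra.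
  by move/eqP; rewrite !mulf_eq0 (negPf (h0 _ hl)) gt_eqF //= => /eqP.
have on w : lval l w = 0 -> cross (q - p) (w - p) = 0.
  move=> hw; apply: (@cross_parallel R l.1); first exact: blines_dir.
    have -> : cross (q - p) l.1 = lval l p - lval l q by rewrite /lval /cross !ptE; ring.
    by rewrite lu lv subrr.
  have -> : cross l.1 (w - p) = lval l w - lval l p by rewrite /lval /cross !ptE; ring.
  by rewrite hw lu subrr.
have bc0 : b + c != 0 by rewrite gt_eqF // addr_gt0.
have bce : b' + c' = b + c by lra.
pose w := pseg p q (c / (b + c)).
have ew : w = pseg p' q' (c' / (b + c)).
  have e1 := congr1 (@px R) (etrans (esym ez) ez').
  have e2 := congr1 (@py R) (etrans (esym ez) ez').
  rewrite /comb3 !ptE -aa in e1 e2.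
  apply: ptP; apply: (mulfI bc0); rewrite /w /pseg !ptE.
    transitivity (b * px p + c * px q); first by field.
    transitivity ((b' + c') * px p' + c' * (px q' - px p')); last by rewrite bce; field.
    lra.
  transitivity (b * py p + c * py q); first by field.
  transitivity ((b' + c') * py p' + c' * (py q' - py p')); last by rewrite bce; field.
  lra.
have hw : open_segment p q w.
  apply/(open_segmentP _ uv); exists (c / (b + c)) => //.
  by apply/andP; split; [apply: divr_gt0; lra|rewrite ltr_pdivrMr; lra].
have hw' : open_segment p' q' w.
  apply/(open_segmentP _ uv'); exists (c' / (b + c)) => //.
  by apply/andP; split; [apply: divr_gt0; lra|rewrite ltr_pdivrMr; lra].
apply: (same_segment uv uv' hw hw' (on _ lp') (on _ lq'));
  apply: (@extreme_open_segment (cregion blines x0)) => //;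
  by [case: eu|case: ev|case: eu'|case: ev'].
Qed.

End Poly.

(** * The output of the method at a fixed time *)

Section Spatial.
Variable R : realType.
Implicit Types (p q x y z : pt R) (r t : R) (X Y P : set (pt R)).
Implicit Types (T : tri R) (c d : side) (e : tri_expr).
Variable D : seq (tri R).

Definition seg_data u v := [/\ subdivision_vertex D u /\ subdivision_vertex D v,
  eval_vertex D u <> eval_vertex D v,
  forall w, subdivision_vertex D w ->
    ~ open_segment (eval_vertex D u) (eval_vertex D v) (eval_vertex D w),
  exists T, [/\ T \in D, tri_is_segment T
    & open_segment (eval_vertex D u) (eval_vertex D v) `<=` tri_set T]
  & open_segment (eval_vertex D u) (eval_vertex D v) `<=` topo_boundary (covered D)].

Definition pt_data i := [/\ (i < size D)%N, tri_is_point (input_tri D i)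
  & forall T, T \in D -> ~ tri_is_point T -> ~ tri_set T (corner (input_tri D i) k0)].

Lemma ord0_k0 : ord0 = k0 :> 'I_3. Proof. exact: val_inj. Qed.

Variant TS_spec e : Prop :=
| TS_fan x0 s u v l of fan_data D x0 s u v l & e = (Centroid s, Vertex u, Vertex v)
| TS_seg u v of seg_data u v & e = (Vertex u, Vertex v, Vertex v)
| TS_pt i of pt_data i & e = (Vertex (Corner i k0), Vertex (Corner i k0), Vertex (Corner i k0)).

Lemma TS_triangleP e : TS_triangle D e <-> TS_spec e.
Proof.
split.
  case.
  - move=> /polygon_partP [x0 [s [u [v [l [h ->]]]]]]; exact: TS_fan h erefl.
  - case=> u [v [h1 [h2 h3] h4 h5 ->]]; apply: TS_seg erefl; split=> //.
  - by case=> i [h1 h2 h3 ->]; rewrite ord0_k0 in h3 *; apply: TS_pt erefl.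
case.
- by move=> x0 s u v l h ->; constructor 1; apply/polygon_partP; exists x0, s, u, v, l.
- by move=> u v [h1 h2 h3 h4 h5] ->; constructor 2; exists u, v.
- by move=> i [h1 h2 h3] ->; constructor 3; exists i; rewrite ord0_k0.
Qed.

Lemma subdivision_sv_pts v : subdivision_vertex D v -> eval_vertex D v \in sv_pts D.
Proof. by move=> h; apply: sv_mem; exists v. Qed.

(** There are finitely many candidate triangles: every corner of an output is a point of [sv_pts] or
    the average of a subset of these points. *)
Lemma TS_exists : exists L, TS D L.
Proof.
pose V := undup (sv_pts D).
(* Subsets are given by Boolean masks; the order of the points does not affect their centroid. *)
pose cents := [seq centroid (mask (tval b) V) | b : (size V).-tuple bool].
pose W := V ++ cents.
pose ys := [seq mktri g.1 g.2.1 g.2.2 | g <- [seq (a, b) | a <- W, b <- [seq (a, b) | a <- W, b <- W]]].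
have [e he|L [h1 h2 h3]] := @representatives _ _ (TS_triangle D)
    (fun e => tri_set (eval_tri D e)) (map (@tri_set R) ys); last by exists L.
suff hW : [/\ eval_point D e.1.1 \in W, eval_point D e.1.2 \in W & eval_point D e.2 \in W].
  apply: List.in_map; apply/In_mem/mapP.
  exists (eval_point D e.1.1, (eval_point D e.1.2, eval_point D e.2)); last by [].
  case: hW => w1 w2 w3; apply/allpairsP.
  exists (eval_point D e.1.1, (eval_point D e.1.2, eval_point D e.2)); split => //=.
  by apply/allpairsP; exists (eval_point D e.1.2, eval_point D e.2).
have inV w : eval_vertex D w \in sv_pts D -> eval_vertex D w \in W.
  by move=> h; rewrite mem_cat mem_undup h.
case: (proj1 (TS_triangleP e) he).
- move=> x0 s u v l h ->; case: h => -[h0 hr] [hs us vs] _ [_ [hu hv]] _.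
  have hV w : List.In w s -> eval_vertex D w \in sv_pts D.
    move=> hw; apply: (vertex_sv_pts h0); apply/vs/mem_map_In; by exists w.
  split; [|exact: inV (hV _ hu)|exact: inV (hV _ hv)].
  rewrite [X in eval_point D X]/= eval_centroid mem_cat; apply/orP; right.
  set E := map _ s in us *.
  have EV : {subset E <= V}.
    by move=> p /mem_map_In [w hw ->]; rewrite mem_undup; apply: hV.
  apply/mapP; exists (map_tuple (fun p => p \in E) (in_tuple V)) => /=.
    by rewrite mem_enum.
  rewrite -filter_mask; apply: centroid_perm; apply: uniq_perm => //.
    by apply: filter_uniq; apply: undup_uniq.
  by move=> p; rewrite mem_filter; case: (boolP (p \in E)) => // /EV ->.
- by move=> u v [[hu hv] _ _ _ _] ->; split; apply: inV; apply: subdivision_sv_pts.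
- by move=> i [hi _ _] ->; split; apply: inV; apply: subdivision_sv_pts.
Qed.

Lemma fan_sub x0 s u v l : fan_data D x0 s u v l ->
  tri_set (fan_tri D s u v) `<=` cregion (blines D) x0.
Proof.
move=> [[h0 hr] hs [eu ev] _ _]; rewrite fan_triE; apply: mktriP.
- exact: convex_cregion.
- by apply: region_sub; apply: centroid_region.
- by case: eu.
- by case: ev.
Qed.

Lemma TS_sub e : TS_triangle D e -> tri_set (eval_tri D e) `<=` covered D.
Proof.
move=> /TS_triangleP []; rewrite ?eval_triE.
- move=> x0 s u v l h -> x hx; case: (h) => -[h0 hr] _ _ _ _.
  by apply: cregion_covered h0 hr _ _; apply: fan_sub h _ hx.
- move=> u v [_ uv _ [T [hT _ hs]] _] ->.
  rewrite mktri_seg => x hx; exists T => //.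
  by apply: closed_open_segment hx => //; apply: closed_tri.
- move=> i [hi hp _] ->; rewrite mktri_pt => x ->.
  exists (input_tri D i); first by apply/input_triP; exists i.
  exact: corner_in.
Qed.

(** The kind of output is recognised from the shape of [e], a point being the case of equal
    vertices; the value [set0] is a default for shapes that do not occur. *)
Lemma TS_interior e : TS_triangle D e -> tri_interior (eval_tri D e) =
  match e with (Centroid _, _, _) => interior (tri_set (eval_tri D e))
  | (Vertex u, Vertex v, _) => if eval_vertex D u == eval_vertex D v
     then [set eval_vertex D u] else open_segment (eval_vertex D u) (eval_vertex D v)
  | _ => set0 end.
Proof.
move=> /TS_triangleP [].
- move=> x0 s u v l h ->; rewrite nonflat_tri_interior //; exact: fan_nonflat h.
- move=> u v [_ uv _ _ _] ->; rewrite eval_triE [_.1]/= [_.2]/= seg_interior //.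
  by case: eqP.
- by move=> i _ ->; rewrite eval_triE [_.1]/= [_.2]/= pt_interior eqxx.
Qed.

Lemma fan_interior_covered x0 s u v l : fan_data D x0 s u v l ->
  interior (tri_set (fan_tri D s u v)) `<=` interior (covered D).
Proof.
move=> h x hx; case: (h) => -[_ hr] _ _ _ _.
have := @open_region R (blines D) x0; rewrite openE => /(_ x (fan_interior h hx)).
exact: interiorS.
Qed.

Lemma fan_seg_disjoint x0 s u v l u' v' z : fan_data D x0 s u v l -> seg_data u' v' ->
  interior (tri_set (fan_tri D s u v)) z ->
  ~ open_segment (eval_vertex D u') (eval_vertex D v') z.
Proof.
move=> h [_ _ _ _ hb] /(fan_interior_covered h) hz /hb [_]; exact.
Qed.

(** Otherwise a neighbouring point would be covered by a triangle through the isolated point, and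
    that triangle, having two points, would not be a point. *)
Lemma pt_isolated i : pt_data i -> ~ interior (covered D) (corner (input_tri D i) k0).
Proof.
move=> [hi hp hn]; set p := corner _ _ in hn *.
move=> /interior_box [e e0 he]; have [e' e0' he'] := near_tris p D.
have m0 : 0 < Num.min e e' by rewrite lt_min e0.
have [r r0 hr] := box_step p (mkpt 1 0) m0.
have hz : box (Num.min e e') p (p + r *: mkpt 1 0) by apply: hr; rewrite gtr0_norm.
have [|T hT Tz] := he (p + r *: mkpt 1 0); first by apply: box_le hz; rewrite ge_min lexx.
have Tp : tri_set T p by apply: (he' _ _ T hT Tz); apply: box_le hz; rewrite ge_min lexx orbT.
apply: (hn T hT) => // /tri_point_set /(_ _ _ Tp Tz) /(congr1 (@px R)).
by rewrite !ptE; lra.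
Qed.

Lemma seg_side u v : seg_data u v -> exists2 c, is_side D c &
  side_set D c (eval_vertex D u) /\ side_set D c (eval_vertex D v).
Proof.
case=> _ uv _ [T [hT [fT nT] hs]] _; have [k [l eT]] := flat_conv2 fT.
have /input_triP [i hi ei] := hT.
exists (i, (k, l)).
  split => // e; apply: nT; apply/tri_point_set => x y.
  rewrite eT; move: e; rewrite /src /tgt /= -ei => ->.
  move=> /conv2P [a _ ->] /conv2P [b _ ->].
  by apply: ptP; rewrite /pseg !ptE; ring.
have hc := closed_open_segment (@closed_tri _ T) uv hs.
by rewrite /side_set /src /tgt /= -ei -eT; split; apply: hc; [exact: conv2_l|exact: conv2_r].
Qed.

Lemma seg_elementary u v : seg_data u v -> exists c,
  elementary D c (eval_vertex D u) (eval_vertex D v).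
Proof.
move=> h; have [c hc hs] := seg_side h; case: h => -[hu hv] uv hn _ _.
exists c; split => //; first by split; [exists u|exists v].
by move=> w [w' hw ->]; apply: hn.
Qed.

(** Both are edges of the subdivision. The common point is not a vertex, so the sides carrying them
    are on one line, and neither edge contains an end of the other. *)
Lemma seg_overlap u v u' v' z : seg_data u v -> seg_data u' v' ->
  open_segment (eval_vertex D u) (eval_vertex D v) z ->
  open_segment (eval_vertex D u') (eval_vertex D v') z ->
  (eval_vertex D u = eval_vertex D u' /\ eval_vertex D v = eval_vertex D v') \/
  (eval_vertex D u = eval_vertex D v' /\ eval_vertex D v = eval_vertex D u').
Proof.
move=> h h' hz hz'.
have [c [hc [svu svv] [cu cv] uv hn]] := seg_elementary h.
have [c' [hc' [svu' svv'] [cu' cv'] uv' hn']] := seg_elementary h'.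
set p := eval_vertex D u in hz svu cu uv hn *; set q := eval_vertex D v in hz svv cv uv hn *.
set p' := eval_vertex D u' in hz' svu' cu' uv' hn' *.
set q' := eval_vertex D v' in hz' svv' cv' uv' hn' *.
have nz : ~ sv D z by move=> /hn.
have zc := open_segment_side cu cv hz; have zc' := open_segment_side cu' cv' hz'.
have par := nonsv_parallel hc hc' zc zc' nz.
have lin w : side_set D c' w -> line_side D c w = 0.
  by move=> /side_set_line; apply: (parallel_line hc hc' par); apply: side_set_line zc || apply: side_set_line zc'.
have d0 := dir_neq0 hc.
have on w : line_side D c w = 0 -> cross (q - p) (w - p) = 0.
  move=> hw; apply: (@cross_parallel R (dir D c)) => //.
    have -> : cross (q - p) (dir D c) = line_side D c p - line_side D c q.
      by rewrite /line_side /cross !ptE; ring.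
    by rewrite !side_set_line // subrr.
  have -> : cross (dir D c) (w - p) = line_side D c w - line_side D c p.
    by rewrite /line_side /cross !ptE; ring.
  by rewrite hw side_set_line // subrr.
apply: (same_segment uv uv' hz hz'); try (by apply: on; apply: lin).
- exact: hn.
- exact: hn.
- exact: hn'.
- exact: hn'.
Qed.

Lemma pt_seg_disjoint i u v : pt_data i -> seg_data u v ->
  ~ open_segment (eval_vertex D u) (eval_vertex D v) (corner (input_tri D i) k0).
Proof.
move=> [hi hp hn] [_ uv _ [T [hT [_ nT] hs]] _] h; apply: (hn T hT nT); exact: hs.
Qed.

(** Fans have their interior inside the interior of S, segments are in its boundary, and points are
    neither in that interior nor on such a segment; so only outputs of the same kind can overlap. *)
Lemma TS_disjoint e e' z : TS_triangle D e -> TS_triangle D e' ->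
  tri_interior (eval_tri D e) z -> tri_interior (eval_tri D e') z ->
  tri_set (eval_tri D e) = tri_set (eval_tri D e').
Proof.
move=> he he'; rewrite !TS_interior //.
case: (proj1 (TS_triangleP e) he); case: (proj1 (TS_triangleP e') he').
- move=> x1 s' u' v' l' h' -> x0 s u v l h -> hz hz'.
  have [_ ps hc] := fan_overlap h h' hz hz'.
  rewrite -!/(fan_tri D _ _ _) !fan_triE (centroid_perm ps).
  by case: hc => -[-> ->] //; rewrite mktri_swap.
- move=> u' v' h' -> x0 s u v l h -> hz; case: eqP; first by case: (h').
  by move=> _ /(fan_seg_disjoint h h' hz).
- move=> i h' -> x0 s u v l h -> hz; rewrite eqxx => e1.
  by exfalso; apply: (pt_isolated h'); rewrite -[corner _ _]e1; apply: fan_interior_covered h _ hz.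
- move=> x1 s' u' v' l' h' -> u v h ->; case: eqP; first by case: (h).
  by move=> _ hz hz'; exfalso; apply: fan_seg_disjoint h' h hz' hz.
- move=> u' v' h' -> u v h ->; case: eqP; first by case: (h).
  case: eqP; first by case: (h').
  move=> _ _ hz hz'; rewrite !eval_triE !mktri_seg /=.
  by case: (seg_overlap h h' hz hz') => -[-> ->] //; rewrite conv2C.
- move=> i h' -> u v h ->; rewrite eqxx; case: eqP; first by case: (h).
  by move=> _ hz e1; exfalso; apply: (pt_seg_disjoint h' h); rewrite -[corner _ _]e1.
- move=> x1 s' u' v' l' h' -> i h ->; rewrite eqxx => e1 hz'.
  by exfalso; apply: (pt_isolated h); rewrite -[corner _ _]e1; apply: fan_interior_covered h' _ hz'.
- move=> u' v' h' -> i h ->; rewrite eqxx; case: eqP; first by case: (h').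
  by move=> _ e1 hz; exfalso; apply: (pt_seg_disjoint h h'); rewrite -[corner _ _]e1.
- move=> i' h' -> i h ->; rewrite !eqxx => e1 e2.
  by rewrite !eval_triE !mktri_pt; congr set1; exact: etrans (esym e1) e2.
Qed.

(** * The outputs cover the snapshot *)

Section Cover.
Variable L : seq tri_expr.
Hypothesis hL : TS D L.

Let U := covered [seq eval_tri D e | e <- L].

Lemma TS_in_U e : TS_triangle D e -> tri_set (eval_tri D e) `<=` U.
Proof.
case: hL => _ h _ /h [e' he' ee] x hx; exists (eval_tri D e'); last by rewrite ee.
by apply/mem_map_In; exists e'.
Qed.

Lemma closed_U : closed U. Proof. exact: closed_covered. Qed.

(** As [U] is closed, a missed point yields a missed open set inside [T]. A generic point of that
    set determines a cell, which [fill] shows to be covered; a generic missed point of the cell is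
    in one of its fan triangles by [region_fan], a contradiction. *)
Lemma nonflat_covered T : T \in D -> ~ tri_is_flat T -> tri_set T `<=` U.
Proof.
move=> hT nf x Tx; apply: contrapT => nU.
have oU : open (~` U) by apply: closed_openC; exact: closed_U.
have iTc : interior (tri_set T) `<=` interior (covered D).
  by apply: interiorS => y Ty; exists T.
have [y [ny Ty]] : (~` U `&` interior (tri_set T)) !=set0.
  move: (oU); rewrite openE => /(_ x nU) /interior_box [e e0 he].
  have [r r0 hr] := box_step x (comb3 (1/3) (1/3) (1/3) (corner T k0) (corner T k1) (corner T k2) - x) e0.
  exists (pseg x (comb3 (1/3) (1/3) (1/3) (corner T k0) (corner T k1) (corner T k2)) (Num.min r 1)).
  split; first by apply: he; apply: hr; rewrite gtr0_norm ?lt_min ?r0 //= ge_min lexx.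
  by apply: tri_pseg_interior => //; rewrite lt_min r0 ltr01 ge_min lexx orbT.
have oY : open (~` U `&` interior (tri_set T)).
  by apply: openI => //; exact: open_interior.
have [||x0 [nx0 Tx0] h0] := generic_point (L := blines D) oY; first by exists y.
  exact: blines_dir.
have hr : region (blines D) x0 `<=` covered D.
  apply: region_covered; exists x0; split; [exact: region_base|exact: iTc].
have [s hs] := vertices_exist h0.
have hb := cregion_bounded h0 hr.
have ha := centroid_region h0 hr hs; set a := centroid _ in ha.
have va v : extreme_point (cregion (blines D) x0) v -> v \in map (eval_vertex D) s.
  move=> ev; case: hs => _ _ hs; apply/hs; rewrite /polygon_vertex closure_region //.
have oZ : open (~` U `&` region (blines D) x0) by apply: openI => //; exact: open_region.
(* Off the lines that join the centroid to the vertices, as [region_fan] requires. *)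
have [||z [nz rz] hz] := generic_point (oZ)
   (L := [seq (v - a, a) | v <- map (eval_vertex D) s]).
- by exists x0; split => //; apply: region_base.
- move=> l /In_mem /mapP [v hv ->] /=; rewrite subr_eq0; apply/eqP => e.
  case: (hs) => _ _ hs'; have /(vertex_meet _ h0) [_ [c [d [hc _ hcd ev]]]] := proj1 (hs' v) hv.
  have : 0 < line_side D c x0 * line_side D c a.
    by apply: (ha (sline D c)); apply/in_blines; exists c.
  by rewrite -e ev (proj1 (meet_on hcd)) mulr0 ltxx.
have [v /va hv|u [v [l [[eu ev] uv hl [lu lv] hzz]]]] :=
    region_fan (@blines_dir _ D) h0 hb ha rz.
  apply: (hz (v - a, a)); apply/In_mem/mapP; by exists v.
have /mem_map_In [u' us eu'] := va _ eu; have /mem_map_In [v' vs ev'] := va _ ev.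
apply: nz; apply: (@TS_in_U (Centroid s, Vertex u', Vertex v')).
  apply/TS_triangleP; apply: (@TS_fan _ x0 s u' v' l) => //.
  by split; rewrite -?eu' -?ev'.
by rewrite -/(fan_tri D s u' v') fan_triE tri_setE !mktriE -eu' -ev'.
Qed.

(** A missed point has a missed neighbour [y] on [T] that is not a vertex. Either there are
    triangles on both sides of the edge around [y], and such a triangle is not flat and contains the
    edge, or the edge is in the boundary and was output. *)
Lemma segment_covered T : T \in D -> tri_is_segment T -> tri_set T `<=` U.
Proof.
move=> hT [fT nT] x Tx; apply: contrapT => nU.
have oU : open (~` U) by apply: closed_openC; exact: closed_U.
have [k [l eT]] := flat_conv2 fT; have /input_triP [i hi ei] := hT.
pose c : side := (i, (k, l)).
have eS : side_set D c = tri_set T by rewrite /side_set /src /tgt /= -ei -eT.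
have [m Tm xm] : exists2 m, tri_set T m & x <> m.
  apply: contrapT => H; apply: nT; apply/tri_point_set => y y' Ty Ty'.
  have K w : tri_set T w -> x = w by move=> Tw; apply: contrapT => ?; apply: H; exists w.
  by rewrite -(K y) // -(K y').
move: (oU); rewrite openE => /(_ x nU) /interior_box [e e0 he].
have [r r0 hr] := box_step x (m - x) e0.
have r1 : 0 < Num.min r 1 by rewrite lt_min r0 ltr01.
have [s /andP [s0 sr] hs] := avoid_seq (sv_pts D) (pseg_inj xm) r1.
move: sr; rewrite lt_min => /andP [sr s1].
set y := pseg x m s in hs.
have ny : ~ U y by apply: he; apply: hr; rewrite gtr0_norm // ltW.
have nsv : ~ sv D y by move=> /sv_mem; rewrite (negPf hs).
have yc : side_set D c y by rewrite eS; apply: convex_tri => //; rewrite !ltW.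
have hc : is_side D c := nonsv_side (c := c) hi yc nsv.
have [p [q [hpq hy]]] := elementary_exists hc yc nsv.
case: (hpq) => _ [[u su eu] [v svv ev]] [pc qc] pq hn.
case: (pselect (half2 D c 1 p q /\ half2 D c (-1) p q)) => [[[T' [hT' Tp Tq [j hj]]] _]|nh].
  apply: ny; apply: (nonflat_covered hT').
    (* A flat triangle containing the distinct points [p] and [q] of the line of [c] is entirely on
       that line, against the choice of the corner [j]. *)
    move=> /flat_conv2 [k' [l' e']]; rewrite e' in Tp Tq.
    case/conv2P: Tp => a _ ea; case/conv2P: Tq => b _ eb.
    have la := side_set_line pc; have lb := side_set_line qc.
    rewrite ea line_sideE lval_pseg -!line_sideE in la.
    rewrite eb line_sideE lval_pseg -!line_sideE in lb.
    have ab : a - b != 0 by rewrite subr_eq0; apply/eqP => h; apply: pq; rewrite ea eb h.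
    set A := line_side D c _ in la lb; set B := line_side D c _ in la lb.
    have B0 : B = A.
      apply: (mulfI ab); clear - la lb; lra.
    have A0 : A = 0 by rewrite B0 in la; clear - la; lra.
    have : tri_set T' (corner T' j) by apply: corner_in.
    rewrite e' => /conv2P [f _ ef]; move: hj; rewrite ef line_sideE lval_pseg -!line_sideE.
    by rewrite -/A -/B B0 A0 !mulr0 addr0 mulr0 ltxx.
  apply: conv2_sub (open_segment_conv hy) => //; exact: convex_tri.
have hb := proj2 (elementary_boundary hpq) nh.
apply: ny; apply: (@TS_in_U (Vertex u, Vertex v, Vertex v)).
  apply/TS_triangleP; apply: (@TS_seg _ u v) => //; split; rewrite -?eu -?ev //.
    by move=> w hw; apply: hn; exists w.
  exists T; split => //; rewrite -eS; exact: open_segment_side.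
by rewrite eval_triE mktri_seg /= -eu -ev; apply: open_segment_conv.
Qed.

Lemma nonpoint_covered T : T \in D -> ~ tri_is_point T -> tri_set T `<=` U.
Proof.
move=> hT np; case: (pselect (tri_is_flat T)) => h; last exact: nonflat_covered.
exact: segment_covered.
Qed.

Lemma TS_covered : U = covered D.
Proof.
apply/seteqP; split=> x.
  case=> T /mem_map_In [e he eT] Tx.
  case: hL => h _ _; apply: (TS_sub (h e he)); by rewrite -eT.
case=> T hT Tx; case: (pselect (tri_is_point T)) => hp; last exact: nonpoint_covered hp _ Tx.
have xT k : x = corner T k by apply: (proj1 (tri_point_set T) hp) => //; apply: corner_in.
case: (pselect (exists T', [/\ T' \in D, ~ tri_is_point T' & tri_set T' x])) => H.
  by case: H => T' [hT' np Tx']; apply: nonpoint_covered np _ Tx'.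
have /input_triP [i hi ei] := hT.
apply: (@TS_in_U (Vertex (Corner i k0), Vertex (Corner i k0), Vertex (Corner i k0))).
  apply/TS_triangleP; apply: (@TS_pt _ i) => //; split => //; first by rewrite -ei.
  rewrite -ei -(xT k0) => T' hT' np Tx'; apply: H; by exists T'.
by rewrite eval_triE mktri_pt /= -ei -(xT k0).
Qed.

Lemma TS_triangulation : is_triangulation [seq eval_tri D e | e <- L] (covered D).
Proof.
split; last exact: TS_covered.
have K T : T \in [seq eval_tri D e | e <- L] -> exists2 e, TS_triangle D e & T = eval_tri D e.
  by case: hL => h _ _ /mem_map_In [e /h he ->]; exists e.
move=> _ _ /K [e he ->] /K [e' he' ->] ne; rewrite -subset0 => z [hz hz'].
exact: ne (TS_disjoint he he' hz hz').
Qed.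

End Cover.
End Spatial.

(** * Combinatorial types of families of triangles *)

Section Signs.
Variable R : realType.
Implicit Types a b c e k : R.

Lemma sg_mul_ge0 k a b : Num.sg a = Num.sg b -> (0 <= k * a) = (0 <= k * b).
Proof. by move=> h; rewrite -sgr_ge0 sgrM h -sgrM sgr_ge0. Qed.

Lemma sg_mul_gt0 k a b : Num.sg a = Num.sg b -> (0 < k * a) = (0 < k * b).
Proof. by move=> h; rewrite -sgr_gt0 sgrM h -sgrM sgr_gt0. Qed.

Lemma sg_ge0 a b : Num.sg a = Num.sg b -> (0 <= a) = (0 <= b).
Proof. by move=> h; rewrite -sgr_ge0 h sgr_ge0. Qed.

Lemma sg_eq0 a b : Num.sg a = Num.sg b -> (a == 0) = (b == 0).
Proof. by move=> h; rewrite -sgr_eq0 h sgr_eq0. Qed.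

Lemma sg0P a b : Num.sg a = Num.sg b -> a = 0 <-> b = 0.
Proof. by move/sg_eq0 => h; split=> /eqP; [rewrite h|rewrite -h] => /eqP. Qed.

Lemma sign_chain a b c e : 0 < a * b -> 0 < a * c -> 0 < c * e -> 0 < b * e.
Proof.
move=> h1 h2 h3; have : 0 < b * e * ((a * c) * (a * c)).
  rewrite (_ : _ * _ = a * b * (a * c) * (c * e)); last by ring.
  by apply: mulr_gt0 => //; apply: mulr_gt0.
by rewrite pmulr_lgt0 // mulr_gt0.
Qed.

End Signs.

Section Equi.
Variable R : realType.
Implicit Types (p q x y z : pt R) (P X Y : set (pt R)).
Implicit Types (T : tri R) (c d : side) (e : tri_expr) (D : seq (tri R)).
Implicit Types (u v w : vertex) (i : nat) (k : 'I_3).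

(** Unlike a subdivision vertex, an intersection of two lines need not lie on the sides themselves:
    vertices of polygons are of this more general kind. *)
Definition valid D v := match v with
  | Corner i _ => (i < size D)%N : Prop
  | Meet c d => [/\ is_side D c, is_side D d & cross (dir D c) (dir D d) != 0] end.

(** Sameness of combinatorial type. [equi_dot] compares only points on the line of [c] and so
    records their order along it. Validity is required in [D] alone, but it transfers, and the
    relation is symmetric. *)
Record equi D D' : Prop := Equi {
  equi_size : size D = size D';
  equi_corner : forall i k l, (i < size D)%N ->
    corner (input_tri D i) k = corner (input_tri D i) l <->
    corner (input_tri D' i) k = corner (input_tri D' i) l;
  equi_cross : forall c d, is_side D c -> is_side D d ->
    cross (dir D c) (dir D d) = 0 <-> cross (dir D' c) (dir D' d) = 0;
  equi_line : forall v c, valid D v -> is_side D c ->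
    Num.sg (line_side D c (eval_vertex D v)) = Num.sg (line_side D' c (eval_vertex D' v));
  equi_dot : forall v w c, valid D v -> valid D w -> is_side D c ->
    line_side D c (eval_vertex D v) = 0 -> line_side D c (eval_vertex D w) = 0 ->
    Num.sg (dot (dir D c) (eval_vertex D v - eval_vertex D w)) =
    Num.sg (dot (dir D' c) (eval_vertex D' v - eval_vertex D' w));
  equi_vertex : forall v w, valid D v -> valid D w ->
    eval_vertex D v = eval_vertex D w <-> eval_vertex D' v = eval_vertex D' w }.

Lemma equi_side D D' c : equi D D' -> is_side D c <-> is_side D' c.
Proof.
move=> H; rewrite /is_side -(equi_size H) /src /tgt; split=> -[hc h]; split => // e;
by apply: h; apply/(equi_corner H).
Qed.

Lemma equi_valid D D' v : equi D D' -> valid D v <-> valid D' v.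
Proof.
move=> H; case: v => [i k|c d] /=; first by rewrite (equi_size H).
split=> -[hc hd h].
  split; [exact/(equi_side c H)|exact/(equi_side d H)|].
  by apply: contraNneq h => /(equi_cross H hc hd) ->.
have {}hc := proj2 (equi_side c H) hc; have {}hd := proj2 (equi_side d H) hd.
split => //; by apply: contraNneq h => /(equi_cross H hc hd) ->.
Qed.

Lemma equi_sym D D' : equi D D' -> equi D' D.
Proof.
move=> H; split.
- by rewrite (equi_size H).
- by move=> i k l; rewrite -(equi_size H) => hi; rewrite (equi_corner H).
- by move=> c d /(equi_side c H) hc /(equi_side d H) hd; rewrite (equi_cross H).
- by move=> v c /(equi_valid v H) hv /(equi_side c H) hc; rewrite (equi_line H).
- move=> v w c /(equi_valid v H) hv /(equi_valid w H) hw /(equi_side c H) hc h1 h2.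
  by rewrite (equi_dot H) //; apply/(sg0P (equi_line H _ hc)).
- by move=> v w /(equi_valid v H) hv /(equi_valid w H) hw; rewrite (equi_vertex H).
Qed.

Lemma subdivision_valid D v : subdivision_vertex D v -> valid D v.
Proof. by case: v => // c d [hc hd h _]. Qed.

Lemma nonside_dir D c : (c.1 < size D)%N -> ~ is_side D c -> dir D c = 0.
Proof.
move=> hc h; have e : src D c = tgt D c by apply: contrapT => e; apply: h.
by rewrite /dir e subrr.
Qed.

Lemma equi_line_sg D D' v c : equi D D' -> (c.1 < size D)%N -> valid D v ->
  Num.sg (line_side D c (eval_vertex D v)) = Num.sg (line_side D' c (eval_vertex D' v)).
Proof.
move=> H hc hv; case: (pselect (is_side D c)) => h; first exact: (equi_line H).
have hc' : (c.1 < size D')%N by rewrite -(equi_size H).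
have h' : ~ is_side D' c by move=> /(equi_side c H).
by rewrite /line_side (nonside_dir hc h) (nonside_dir hc' h') /cross !ptE !mul0r subrr.
Qed.

Lemma side_memP D c x : is_side D c -> side_set D c x <->
  [/\ line_side D c x = 0, 0 <= dot (dir D c) (x - src D c) & 0 <= dot (dir D c) (tgt D c - x)].
Proof. by case=> _ /eqP h; apply: conv2_line. Qed.

Lemma degenerate_side D c x : src D c = tgt D c -> side_set D c x <-> x = src D c.
Proof.
move=> h; rewrite /side_set -h; split=> [/conv2P [s _ ->]|->]; last exact: conv2_l.
by rewrite /pseg subrr scaler0 addr0.
Qed.

Lemma equi_side_set D D' c v : equi D D' -> (c.1 < size D)%N -> valid D v ->
  side_set D c (eval_vertex D v) -> side_set D' c (eval_vertex D' v).
Proof.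
move=> H hc hv; case: (pselect (is_side D c)) => h.
  move=> /(side_memP _ h) [h1 h2 h3]; apply/(side_memP _ (proj1 (equi_side c H) h)).
  have z1 : line_side D c (eval_vertex D (Corner c.1 c.2.1)) = 0 by exact: line_side_src.
  have z2 : line_side D c (eval_vertex D (Corner c.1 c.2.2)) = 0 by exact: line_side_tgt.
  have v1 : valid D (Corner c.1 c.2.1) by [].
  have v2 : valid D (Corner c.1 c.2.2) by [].
  split; first by apply/(sg0P (equi_line H hv h)).
    by move: h2; rewrite (sg_ge0 (equi_dot H hv v1 h h1 z1)).
  by move: h3; rewrite (sg_ge0 (equi_dot H v2 hv h z2 h1)).
have e : src D c = tgt D c by apply: contrapT => e; apply: h.
have e' : src D' c = tgt D' c by apply/(equi_corner H).
move=> /(degenerate_side _ e) hs; apply/(degenerate_side _ e').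
by apply: (proj1 (equi_vertex H hv (_ : valid D (Corner c.1 c.2.1)))).
Qed.

Lemma equi_subdivision D D' v : equi D D' -> subdivision_vertex D v -> subdivision_vertex D' v.
Proof.
move=> H h; have hv := subdivision_valid h; have hv' := proj1 (equi_valid v H) hv.
case: v h hv hv' => [//|c d] [hc hd h [s1 s2]] hv hv'; case: (hv') => hc' hd' h'.
by split => //; split; apply: (equi_side_set H _ hv); case: hc; case: hd.
Qed.

(** The side opposite to the corner [k], oriented so that [bary] is the function [line_side] of that
    side. *)
Definition opp k : 'I_3 * 'I_3 :=
  if k == k0 then (k1, k2) else if k == k1 then (k2, k0) else (k0, k1).

Lemma bary_line D i k x : bary (input_tri D i) k x = line_side D (i, opp k) x.
Proof. by rewrite /bary /opp; case: (I3_cases k) => ->. Qed.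

Lemma area_line D i : area (input_tri D i) =
  line_side D (i, (k0, k1)) (eval_vertex D (Corner i k2)).
Proof. by []. Qed.

Lemma equi_area D D' i : equi D D' -> (i < size D)%N ->
  Num.sg (area (input_tri D i)) = Num.sg (area (input_tri D' i)).
Proof. by move=> H hi; rewrite !area_line; apply: (equi_line_sg H). Qed.

Lemma equi_bary D D' i k v : equi D D' -> (i < size D)%N -> valid D v ->
  Num.sg (bary (input_tri D i) k (eval_vertex D v)) =
  Num.sg (bary (input_tri D' i) k (eval_vertex D' v)).
Proof. by move=> H hi hv; rewrite !bary_line; apply: (equi_line_sg H). Qed.

Lemma equi_flat D D' i : equi D D' -> (i < size D)%N ->
  tri_is_flat (input_tri D i) <-> tri_is_flat (input_tri D' i).
Proof. by move=> H hi; rewrite !tri_flatE; apply: sg0P; apply: equi_area. Qed.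

Lemma equi_point D D' i : equi D D' -> (i < size D)%N ->
  tri_is_point (input_tri D i) <-> tri_is_point (input_tri D' i).
Proof.
by move=> H hi; split=> h k l; have := h k l; move/(equi_corner H _ _ hi).
Qed.

Lemma equi_tri D D' i v : equi D D' -> (i < size D)%N -> valid D v ->
  tri_set (input_tri D i) (eval_vertex D v) -> tri_set (input_tri D' i) (eval_vertex D' v).
Proof.
move=> H hi hv; case: (pselect (tri_is_flat (input_tri D i))) => hf.
  have [k [l ->]] := flat_conv2 hf => h.
  have := @equi_side_set D D' (i, (k, l)) v H hi hv h; exact: conv2_tri.
have hf' : ~ tri_is_flat (input_tri D' i) by move=> /(equi_flat H hi).
move=> /(tri_bary _ hf) h; apply/(tri_bary _ hf') => k.
have := h k; rewrite (sg_mul_ge0 _ (equi_bary k H hi hv)) mulrC.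
by rewrite (sg_mul_ge0 _ (equi_area H hi)) mulrC.
Qed.

(** Betweenness on a line as the sign of a product of two scalar products, the form in which
    [equi_dot] preserves it. *)
Lemma open_segment_dot (dd p q w : pt R) : dd != 0 -> cross dd (q - p) = 0 ->
  cross dd (w - p) = 0 -> p <> q ->
  open_segment p q w <-> 0 < dot dd (w - p) * dot dd (q - w).
Proof.
move=> d0 hq hw pq; have n0 := norm2_gt0 d0; set N := (X in 0 < X) in n0.
have [b eb] := parallel_scale d0 hq; have [a ea] := parallel_scale d0 hw.
have ew : w = p + a *: dd by rewrite -ea addrC subrK.
have eq' : q = p + b *: dd by rewrite -eb addrC subrK.
have b0 : b != 0 by apply/eqP => h; apply: pq; rewrite eq' h scale0r addr0.
have -> : dot dd (w - p) * dot dd (q - w) = a * (b - a) * N ^+ 2.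
  by rewrite ew eq' /dot /N !ptE; ring.
rewrite pmulr_lgt0 ?exprn_gt0 //; split.
  move=> /(open_segmentP _ pq) [s s01 es].
  have ha : a = s * b.
    have : pseg w (w + dd) 0 = pseg w (w + dd) (s * b - a).
      rewrite pseg0; rewrite {1}es eq' ew; apply: ptP; rewrite /pseg !ptE; ring.
    have wd : w <> w + dd.
      by move=> h; move/eqP: d0; apply; apply: (addrI w); rewrite addr0.
    by move=> /(pseg_inj wd) h; apply/eqP; rewrite eq_sym -subr_eq0 -h.
  have -> : a * (b - a) = s * (1 - s) * b ^+ 2 by rewrite ha; ring.
  case/andP: s01 => s0 s1; rewrite mulr_gt0 ?exprn_even_gt0 // mulr_gt0 // subr_gt0 //.
move=> h; apply/(open_segmentP _ pq); exists (a / b); last first.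
  by rewrite ew eq'; apply: ptP; rewrite /pseg !ptE; field.
have : 0 < a / b * (1 - a / b).
  have -> : a / b * (1 - a / b) = a * (b - a) / b ^+ 2 by field.
  by rewrite divr_gt0 // exprn_even_gt0.
move: (a / b) => s; clear; nra.
Qed.

Lemma cross_lines D c x y : line_side D c x = 0 -> line_side D c y = 0 ->
  cross (dir D c) (x - y) = 0.
Proof.
move=> h1 h2; have -> : cross (dir D c) (x - y) = line_side D c x - line_side D c y.
  by rewrite /line_side /cross !ptE; ring.
by rewrite h1 h2 subrr.
Qed.

Lemma equi_open_segment D D' c u v w : equi D D' -> is_side D c ->
  valid D u -> valid D v -> valid D w ->
  line_side D c (eval_vertex D u) = 0 -> line_side D c (eval_vertex D v) = 0 ->
  line_side D c (eval_vertex D w) = 0 -> eval_vertex D u <> eval_vertex D v ->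
  open_segment (eval_vertex D u) (eval_vertex D v) (eval_vertex D w) ->
  open_segment (eval_vertex D' u) (eval_vertex D' v) (eval_vertex D' w).
Proof.
move=> H hc hu hv hw lu lv lw uv.
have hc' := proj1 (equi_side c H) hc.
have L (x : vertex) : valid D x -> line_side D c (eval_vertex D x) = 0 ->
    line_side D' c (eval_vertex D' x) = 0.
  by move=> hx /(sg0P (equi_line H hx hc)).
have uv' : eval_vertex D' u <> eval_vertex D' v by move=> /(equi_vertex H hu hv).
move=> /(open_segment_dot (dir_neq0 hc) (cross_lines lv lu) (cross_lines lw lu) uv).
rewrite (sg_mul_gt0 _ (equi_dot H hv hw hc lv lw)) mulrC.
rewrite (sg_mul_gt0 _ (equi_dot H hw hu hc lw lu)) mulrC => h.
apply/(open_segment_dot (dir_neq0 hc') (cross_lines _ _) (cross_lines _ _) uv') => //;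
exact: L.
Qed.

Lemma equi_elementary D D' c u v : equi D D' ->
  subdivision_vertex D u -> subdivision_vertex D v ->
  elementary D c (eval_vertex D u) (eval_vertex D v) ->
  elementary D' c (eval_vertex D' u) (eval_vertex D' v).
Proof.
move=> H hu hv [hc _ [cu cv] uv hn].
have vu := subdivision_valid hu; have vv := subdivision_valid hv.
have hc' := proj1 (equi_side c H) hc; have H' := equi_sym H.
have hu' := equi_subdivision H hu; have hv' := equi_subdivision H hv.
have cu' := equi_side_set H (proj1 hc) vu cu.
have cv' := equi_side_set H (proj1 hc) vv cv.
have uv' : eval_vertex D' u <> eval_vertex D' v by move=> /(equi_vertex H vu vv).
split => //; first by split; [exists u|exists v].
move=> _ [w hw' ->] h; have hw := equi_subdivision H' hw'.
apply: (hn (eval_vertex D w)); first by exists w.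
apply: (equi_open_segment H' hc' _ _ _ _ _ _ uv' h); try exact: subdivision_valid;
  try exact: side_set_line.
exact: side_set_line (open_segment_side cu' cv' h).
Qed.

Lemma equi_half2 D D' c (k : R) u v : equi D D' -> (c.1 < size D)%N -> valid D u -> valid D v ->
  half2 D c k (eval_vertex D u) (eval_vertex D v) ->
  half2 D' c k (eval_vertex D' u) (eval_vertex D' v).
Proof.
move=> H hc hu hv [T [hT Tu Tv [j hj]]]; have /input_triP [i hi ei] := hT.
rewrite ei in Tu Tv hj; exists (input_tri D' i); split.
- by apply/input_triP; exists i => //; rewrite -(equi_size H).
- exact: equi_tri Tu.
- exact: equi_tri Tv.
- exists j; move: hj.
  by rewrite (sg_mul_gt0 _ (equi_line_sg H hc (_ : valid D (Corner i j)))).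
Qed.

Lemma equi_boundary D D' c : equi D D' -> boundary_side D c -> boundary_side D' c.
Proof.
move=> H /boundary_sideP [p [q [h nh]]]; case: (h) => hc [[u hu eu] [v hv ev]] _ _ _.
rewrite eu ev in h nh; have vu := subdivision_valid hu; have vv := subdivision_valid hv.
have H' := equi_sym H; have hc' := proj1 (equi_side c H) hc.
apply/boundary_sideP; exists (eval_vertex D' u), (eval_vertex D' v); split.
  exact: equi_elementary h.
case=> h1 h2; apply: nh; split; apply: (equi_half2 H' (proj1 hc')) => //;
exact/(equi_valid _ H).
Qed.

Lemma equi_seg D D' u v : equi D D' -> seg_data D u v -> seg_data D' u v.
Proof.
move=> H h; have [c hel] := seg_elementary h; case: h => -[hu hv] uv hn [T [hT [fT nT] hs]] hb.
have vu := subdivision_valid hu; have vv := subdivision_valid hv.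
have hel' := equi_elementary H hu hv hel.
case: (hel') => hc' _ _ uv' hn'.
split => //.
- by split; apply: (equi_subdivision H).
- by move=> w hw; apply: hn'; exists w.
- have /input_triP [i hi ei] := hT; rewrite ei in fT nT hs.
  exists (input_tri D' i); split.
  + by apply/input_triP; exists i => //; rewrite -(equi_size H).
  + split; first exact/(equi_flat H hi).
    by move=> /(equi_point H hi).
  + have hcv := closed_open_segment (@closed_tri _ _) uv hs.
    apply: subset_trans (@open_segment_conv _ _ _) _; apply: conv2_sub.
    * exact: convex_tri.
    * apply: (equi_tri H hi vu); apply: hcv; exact: conv2_l.
    * apply: (equi_tri H hi vv); apply: hcv; exact: conv2_r.
- apply/(elementary_boundary hel') => -[h1 h2].
  apply: (proj1 (elementary_boundary hel) hb).
  have H' := equi_sym H; split; apply: (equi_half2 H' (proj1 hc')) => //;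
  exact/(equi_valid _ H).
Qed.

Lemma equi_pt D D' i : equi D D' -> pt_data D i -> pt_data D' i.
Proof.
move=> H [hi hp hn]; split; first by rewrite -(equi_size H).
  exact/(equi_point H hi).
move=> T /input_triP [j hj ->] np h.
rewrite -(equi_size H) in hj; apply: (hn (input_tri D j)).
- by apply/input_triP; exists j.
- by move=> /(equi_point H hj).
- have H' := equi_sym H.
  have v : valid D' (Corner i k0) by rewrite /= -(equi_size H).
  have hj' : (j < size D')%N by rewrite -(equi_size H).
  exact: (equi_tri H' hj' v h).
Qed.

(** The side of a line on which a centroid lies is not among the data of [equi]; it follows from
    weak signs at the vertices, one of them strict. *)
Lemma equi_centroid D D' (s : seq vertex) c (k : R) : equi D D' -> (c.1 < size D)%N ->
  (forall v, List.In v s -> valid D v /\ 0 <= k * line_side D c (eval_vertex D v)) ->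
  (exists2 v, List.In v s & k * line_side D c (eval_vertex D v) != 0) ->
  0 < k * line_side D' c (centroid (map (eval_vertex D') s)).
Proof.
move=> H hc h1 [v0 hv0 n0]; rewrite line_sideE; apply: centroid_pos.
  move=> p /mem_map_In [v hv ->]; have [vv hk] := h1 v hv.
  by rewrite -line_sideE -(sg_mul_ge0 _ (equi_line_sg H hc vv)).
exists (eval_vertex D' v0); first by apply/mem_map_In; exists v0.
have [vv hk] := h1 v0 hv0; move: n0; rewrite -line_sideE !mulf_eq0 !negb_or.
by rewrite (sg_eq0 (equi_line_sg H hc vv)).
Qed.

(** A point of the cell that is no vertex and on no line of a side cannot be on the boundary of a
    triangle that covers it. *)
Lemma region_tri D x0 : region (blines D) x0 !=set0 -> region (blines D) x0 `<=` covered D ->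
  exists i x, [/\ (i < size D)%N, ~ tri_is_flat (input_tri D i), region (blines D) x0 x
    & interior (tri_set (input_tri D i)) x].
Proof.
move=> ne hr; have e1 : mkpt 1 0 != 0 :> pt R.
  apply/eqP => /(congr1 (@px R)); rewrite !ptE; apply/eqP; exact: oner_neq0.
pose L := [seq (mkpt 1 0, p) | p <- sv_pts D] ++
  [seq sline D c | c <- all_sides (size D) & `[< is_side D c >]].
have [|x rx hx] := generic_point (L := L) (@open_region R (blines D) x0) ne.
  move=> l /In_mem; rewrite mem_cat => /orP [] /mapP; first by case=> v _ ->.
  by case=> c; rewrite mem_filter => /andP [/asboolP hc _] ->; apply: dir_neq0.
have [T hT Tx] := hr _ rx; have /input_triP [i hi ei] := hT.
have iT : interior (tri_set T) x.
  apply: contrapT => ni; have [k [l hk]] := tri_boundary Tx ni.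
  pose c : side := (i, (k, l)).
  have xc : side_set D c x by rewrite /side_set /src /tgt /= -ei.
  have nsv : ~ sv D x.
    move=> /sv_mem hsv; have : cross (mkpt 1 0) (x - x) != 0.
      apply: (hx (mkpt 1 0, x)); apply/In_mem; rewrite mem_cat; apply/orP; left.
      by apply/mapP; exists x.
    by rewrite subrr /cross !ptE !mulr0 subrr eqxx.
  have hc : is_side D c := nonsv_side (c := c) hi xc nsv.
  have : line_side D c x != 0.
    apply: (hx (sline D c)); apply/In_mem; rewrite mem_cat; apply/orP; right.
    apply/mapP; exists c => //; rewrite mem_filter mem_all_sides; apply/andP; split => //.
    exact/asboolP.
  by rewrite (side_set_line xc) eqxx.
exists i, x; rewrite -ei; split => //; move=> hf; exact: flat_interior hf iT.
Qed.

Lemma nonflat_side D i k : (i < size D)%N -> ~ tri_is_flat (input_tri D i) ->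
  is_side D (i, opp k).
Proof.
move=> hi nf; split => // e; apply: nf; apply/tri_flatE; move: e.
rewrite /src /tgt /opp /area; case: (I3_cases k) => -> /= ->;
  rewrite /cross !ptE; ring.
Qed.

Lemma tri_bounded T : bounded_pts (tri_set T).
Proof.
have [M hM] := covered_bounded [:: T]; exists M => x Tx; apply: hM.
by exists T => //; rewrite inE.
Qed.

Lemma mem_opp k : List.In (opp k) [:: opp k0; opp k1; opp k2].
Proof. by case: (I3_cases k) => ->; [left|right; left|right; right; left]. Qed.

(* The centroid of the vertices of the intersection of the polygon with one of
   the triangles carries over from [D] to [D']. *)
Lemma equi_polygon D D' x0 x1 : equi D D' -> off_blines D x0 ->
  region (blines D) x0 `<=` covered D ->
  (forall c, boundary_side D c -> 0 < line_side D c x0 * line_side D' c x1) ->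
  region (blines D') x1 `<=` covered D'.
Proof.
move=> H h0 hr hx1; have H' := equi_sym H.
have [|i [x [hi nf rx ix]]] := region_tri _ hr; first by exists x0; apply: region_base.
have barx := proj1 (tri_interior_bary _ nf) ix.
pose bs := [seq c <- all_sides (size D) | `[< boundary_side D c >]].
(* The lines bounding the intersection of the polygon with the triangle [i]. This cell is bounded
   because the triangle is, and its vertices are [valid] symbolic vertices. *)
pose cs := bs ++ [seq (i, o) | o <- [:: opp k0; opp k1; opp k2]].
pose L := map (sline D) cs.
have inbs c : boundary_side D c -> c \in bs.
  move=> hc; rewrite mem_filter mem_all_sides; apply/andP; split; first by apply/asboolP.
  by case: hc => -[].
have incs c : c \in cs -> is_side D c /\ line_side D c x != 0.
  rewrite mem_cat => /orP [].
    rewrite mem_filter => /andP [/asboolP hc _]; split; first by case: hc.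
    have : 0 < line_side D c x0 * line_side D c x.
      by apply: (rx (sline D c)); apply/in_blines; exists c.
    by apply: contraTneq => ->; rewrite mulr0 ltxx.
  have K k : is_side D (i, opp k) /\ line_side D (i, opp k) x != 0.
    split; first exact: nonflat_side.
    have := barx k; rewrite bary_line; apply: contraTneq => ->; by rewrite mulr0 ltxx.
  by rewrite !inE => /orP [|/orP []] /eqP ->.
have hd l : List.In l L -> l.1 != 0.
  by move=> /In_mem /mapP [c /incs [hc _] ->]; apply: dir_neq0.
have hl l : List.In l L -> lval l x != 0.
  by move=> /In_mem /mapP [c /incs [_ hc] ->].
have inop k : (i, opp k) \in cs.
  rewrite mem_cat; apply/orP; right; apply/mapP; exists (opp k) => //.
  by apply/In_mem; apply: mem_opp.
have hb : bounded_pts (cregion L x).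
  have [M hM] := tri_bounded (input_tri D i); exists M => y hy; apply: hM.
  apply/(tri_bary _ nf) => k; have := barx k; rewrite !bary_line => h1.
  have h2 : 0 <= line_side D (i, opp k) x * line_side D (i, opp k) y.
    by apply: (hy (sline D (i, opp k))); apply/In_mem; apply: map_f; apply: inop.
  have h3 : 0 <= area (input_tri D i) * line_side D (i, opp k) y *
     (line_side D (i, opp k) x * line_side D (i, opp k) x).
    rewrite (_ : _ * _ = (area (input_tri D i) * line_side D (i, opp k) x) *
      (line_side D (i, opp k) x * line_side D (i, opp k) y)); last by ring.
    by apply: mulr_ge0 => //; apply: ltW.
  rewrite -(pmulr_lge0 _ (_ : 0 < line_side D (i, opp k) x * line_side D (i, opp k) x)) //.
  rewrite -expr2 exprn_even_gt0 //=; exact: (incs _ (inop k)).2.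
have [c|vs [hv1 hv2]] := @choose_list side vertex cs
   (fun v => valid D v /\ forall c, c \in cs -> 0 <= line_side D c x * line_side D c (eval_vertex D v))
   (fun c v => line_side D c (eval_vertex D v) != 0).
  move=> /In_mem hc.
  have [y ey ly] := region_vertex hd hl hb (l := sline D c) ltac:(by apply/In_mem; apply: map_f).
  have [l [m [/In_mem /mapP [c1 hc1 el] /In_mem /mapP [c2 hc2 em] l1 l2 hlm]]] := extreme_meet hd ey.
  rewrite el in l1 hlm; rewrite em in l2 hlm.
  have e := meet_unique hlm l1 l2; exists (Meet c1 c2); last by rewrite -e.
  split; first by split => //; [case: (incs _ hc1)|case: (incs _ hc2)].
  move=> c3 hc3; rewrite -e; apply: ((proj1 ey) (sline D c3)); apply/In_mem; exact: map_f.
set a := centroid (map (eval_vertex D') vs).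
have ha c : c \in cs -> 0 < line_side D c x * line_side D' c a.
  move=> hc; have [[hcs _] hcx] := incs _ hc.
  apply: (equi_centroid H hcs).
    by move=> v /hv1 [vv hv]; split => //; apply: hv.
  have [v hv nv] := hv2 c ltac:(by apply/In_mem); exists v => //.
  by rewrite mulf_neq0.
(* In [D'], the point [a] is in the cell of [x1] and interior to the triangle [i], which is all that
   [region_covered] needs. *)
apply: region_covered; exists a; split.
  move=> l /in_blines [c hc ->]; rewrite -!line_sideE.
  have bc : boundary_side D c by apply: equi_boundary H' hc.
  apply: sign_chain (hx1 c bc) (_ : 0 < line_side D c x0 * line_side D c x) (ha c _).
    by apply: (rx (sline D c)); apply/in_blines; exists c.
  by rewrite mem_cat inbs.
have hi' : (i < size D')%N by rewrite -(equi_size H).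
have : interior (tri_set (input_tri D' i)) a.
  have nf' : ~ tri_is_flat (input_tri D' i) by move=> /(equi_flat H hi).
  apply/(tri_interior_bary _ nf') => k.
  rewrite mulrC -(sg_mul_gt0 _ (equi_area H hi)) mulrC.
  have := barx k; rewrite !bary_line => h1.
  have h2 := ha _ (inop k).
  apply: (@sign_chain R (line_side D (i, opp k) x) _ (line_side D (i, opp k) x)).
  - by rewrite mulrC.
  - by rewrite -expr2 exprn_even_gt0 //=; exact: (incs _ (inop k)).2.
  - by [].
apply: interiorS => y hy; exists (input_tri D' i) => //.
by apply/input_triP; exists i.
Qed.

Lemma equi_uniq D D' (s : seq vertex) : equi D D' -> (forall v, List.In v s -> valid D v) ->
  uniq (map (eval_vertex D) s) -> uniq (map (eval_vertex D') s).
Proof.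
move=> H; elim: s => //= v s IH hv /andP [nv us]; apply/andP; split; last first.
  by apply: IH => // w hw; apply: hv; right.
apply: contra nv => /mem_map_In [w hw e]; apply/mem_map_In; exists w => //.
by apply/(equi_vertex H) => //; apply: hv; [left|right].
Qed.

(** The base point of the polygon in [D'] is the centroid of the same symbolic vertices evaluated
    there; it lies on the same side as [x0] of every boundary line. The closed cells then contain
    the same valid vertices, so [s] lists the vertices in both. *)
Lemma equi_fan D D' x0 s u v l : equi D D' -> fan_data D x0 s u v l ->
  exists x1 l', fan_data D' x1 s u v l'.
Proof.
move=> H h; have H' := equi_sym H.
case: (h) => -[h0 hr] hs [eu ev] [uv [us vs]] [hl lu lv].
have hb := cregion_bounded h0 hr.
case: (hs) => hs1 hs2 hs3.
have sval w : List.In w s -> valid D w.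
  by move=> /hs1 [c [d [-> [hc _] [hd _] hcd]]].
have sreg w : List.In w s -> cregion (blines D) x0 (eval_vertex D w).
  by move=> hw; have /(vertex_meet _ h0) [] := proj1 (hs3 (eval_vertex D w)) (proj2 (mem_map_In _ _ _) (ex_intro2 _ _ w hw erefl)).
pose a := centroid (map (eval_vertex D') s).
have ha c : boundary_side D c -> 0 < line_side D c x0 * line_side D' c a.
  move=> hc; have hcl : List.In (sline D c) (blines D) by apply/in_blines; exists c.
  apply: (equi_centroid H); first by case: hc => -[].
    by move=> w hw; split; [exact: sval|exact: sreg hw _ hcl].
  have [y ey ly] := region_vertex (@blines_dir _ D) h0 hb hcl.
  have /mem_map_In [w hw ew] : y \in map (eval_vertex D) s.
    by apply/hs3; rewrite /polygon_vertex closure_region.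
  exists w => //; rewrite -ew mulf_neq0 //; exact: (h0 _ hcl).
have offa : off_blines D' a.
  apply/off_blinesP => c /(equi_boundary H') hc; have := ha c hc.
  by apply: contraTneq => ->; rewrite mulr0 ltxx.
have hr' := equi_polygon H h0 hr ha.
have regE w : valid D w -> cregion (blines D') a (eval_vertex D' w) <->
    cregion (blines D) x0 (eval_vertex D w).
  move=> vw; split=> hw m.
    move=> /in_blines [c hc ->]; have hc' := equi_boundary H hc.
    have h1 : 0 <= line_side D' c a * line_side D' c (eval_vertex D' w).
      by apply: (hw (sline D' c)); apply/in_blines; exists c.
    rewrite -!line_sideE (sg_mul_ge0 _ (equi_line H vw (proj1 hc))).
    have h2 := ha c hc.
    have h3 : 0 <= line_side D c x0 * line_side D' c (eval_vertex D' w) *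
      (line_side D' c a * line_side D' c a).
      rewrite (_ : _ * _ = line_side D c x0 * line_side D' c a * (line_side D' c a * line_side D' c (eval_vertex D' w))); last by ring.
      by rewrite mulr_ge0 // ltW.
    rewrite -(pmulr_lge0 _ (_ : 0 < line_side D' c a * line_side D' c a)) //.
    by rewrite -expr2 exprn_even_gt0 //=; exact: (proj1 (off_blinesP _ _) offa c hc').
  move=> /in_blines [c hc' ->]; have hc := equi_boundary H' hc'.
  have h1 : 0 <= line_side D c x0 * line_side D c (eval_vertex D w).
    by apply: (hw (sline D c)); apply/in_blines; exists c.
  rewrite (sg_mul_ge0 _ (equi_line H vw (proj1 hc))) in h1.
  have h2 := ha c hc; rewrite -!line_sideE.
  have h3 : 0 <= line_side D' c a * line_side D' c (eval_vertex D' w) *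
      (line_side D c x0 * line_side D c x0).
    rewrite (_ : _ * _ = line_side D c x0 * line_side D' c a * (line_side D c x0 * line_side D' c (eval_vertex D' w))); last by ring.
    by rewrite mulr_ge0 // ltW.
  rewrite -(pmulr_lge0 _ (_ : 0 < line_side D c x0 * line_side D c x0)) //.
  by rewrite -expr2 exprn_even_gt0 //=; exact: (proj1 (off_blinesP _ _) h0 c hc).
have hs' : computes_vertices D' (region (blines D') a) s.
  split.
  - move=> w /hs1 [c [d [-> hc hd hcd]]]; exists c, d; split => //; try exact: equi_boundary H _.
    by apply: contraNneq hcd => /(equi_cross H (proj1 hc) (proj1 hd)) ->.
  - exact: equi_uniq sval hs2.
  - move=> p; rewrite (vertex_meet _ offa); split.
      move=> /mem_map_In [w hw ->]; split; first by apply/(regE w (sval w hw)); apply: sreg.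
      have [c [d [-> hc hd hcd]]] := hs1 w hw; exists c, d; split => //; try exact: equi_boundary H _.
      by apply: contraNneq hcd => /(equi_cross H (proj1 hc) (proj1 hd)) ->.
    case=> hp [c [d [hc' hd' hcd' ep]]].
    have hc := equi_boundary H' hc'; have hd := equi_boundary H' hd'.
    have hcd : cross (dir D c) (dir D d) != 0.
      by apply: contraNneq hcd' => /(equi_cross H (proj1 hc) (proj1 hd)) ->.
    have vm : valid D (Meet c d) by split; [case: hc|case: hd|].
    rewrite ep in hp *; have hp' := proj1 (regE _ vm) hp.
    have /mem_map_In [w hw ew] : eval_vertex D (Meet c d) \in map (eval_vertex D) s.
      by apply/hs3/(vertex_meet _ h0); split => //; exists c, d.
    apply/mem_map_In; exists w => //; apply/(equi_vertex H) => //; exact: sval.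
have /in_blines [c hc el] := hl.
have exw w : List.In w s -> extreme_point (cregion (blines D') a) (eval_vertex D' w).
  move=> hw; rewrite -(closure_region offa); case: hs' => _ _ hs''.
  by apply/hs''; apply/mem_map_In; exists w.
exists a, (sline D' c); split => //.
- by split; apply: exw.
- by split => // /(equi_vertex H (sval _ us) (sval _ vs)).
- rewrite el in lu lv; split.
  + by apply/in_blines; exists c => //; apply: equi_boundary hc.
  + by apply/(sg0P (equi_line H (sval _ us) (proj1 hc))).
  + by apply/(sg0P (equi_line H (sval _ vs) (proj1 hc))).
Qed.

Lemma equi_TS_triangle D D' e : equi D D' -> TS_triangle D e -> TS_triangle D' e.
Proof.
move=> H /TS_triangleP h; apply/TS_triangleP; case: h.
- by move=> x0 s u v l /(equi_fan H) [x1 [l' h]]; apply: TS_fan h.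
- by move=> u v /(equi_seg H) h; apply: TS_seg h.
- by move=> i /(equi_pt H) h; apply: TS_pt h.
Qed.

Lemma fan_valid D x0 s u v l : fan_data D x0 s u v l ->
  forall w, List.In w s -> valid D w.
Proof.
by case=> _ [hs _ _] _ _ _ w /hs [c [d [-> [hc _] [hd _] hcd]]].
Qed.

(** Equal outputs have equal vertices, possibly in another order, and equality of valid vertices
    carries over. This transports the absence of repetitions in an output list. *)
Lemma equi_same D D' e e' : equi D D' -> TS_triangle D e -> TS_triangle D e' ->
  tri_set (eval_tri D e) = tri_set (eval_tri D e') ->
  tri_set (eval_tri D' e) = tri_set (eval_tri D' e').
Proof.
move=> H he he' E.
have fE : tri_is_flat (eval_tri D e) <-> tri_is_flat (eval_tri D e').
  by rewrite !tri_flat_set E.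
case: (proj1 (TS_triangleP D e) he); case: (proj1 (TS_triangleP D e') he').
- move=> x1 s' u' v' l' h' ee' x0 s u v l h ee; rewrite ee ee' in E *.
  have hz := nonflat_interior (fan_nonflat h); set z := comb3 _ _ _ _ _ _ in hz.
  have hz' : interior (tri_set (fan_tri D s' u' v')) z by rewrite /fan_tri -E.
  have [_ ps hc] := fan_overlap h h' hz hz'.
  have V := fan_valid h; have V' := fan_valid h'.
  have [[_ hs hu hv _] [_ hs' hu' hv' _]] := (h, h').
  case: hv => uv [us vs]; case: hv' => uv' [us' vs'].
  have ps' : perm_eq (map (eval_vertex D') s) (map (eval_vertex D') s').
    apply: uniq_perm.
    - by case: hs => _ hq _; apply: equi_uniq H V hq.
    - by case: hs' => _ hq _; apply: equi_uniq H V' hq.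
    - move=> p; apply/idP/idP => /mem_map_In [w hw ->].
        have /mem_map_In [w' hw' ew] : eval_vertex D w \in map (eval_vertex D) s'.
          by rewrite -(perm_mem ps); apply/mem_map_In; exists w.
        apply/mem_map_In; exists w' => //; apply/(equi_vertex H) => //; auto.
      have /mem_map_In [w' hw' ew] : eval_vertex D w \in map (eval_vertex D) s.
        by rewrite (perm_mem ps); apply/mem_map_In; exists w.
      apply/mem_map_In; exists w' => //; apply/(equi_vertex H) => //; auto.
  rewrite -!/(fan_tri D' _ _ _) !fan_triE (centroid_perm ps').
  case: hc => -[/(equi_vertex H (V _ us) (V' _ _)) e1 /(equi_vertex H (V _ vs) (V' _ _)) e2].
    by rewrite e1 // e2.
  by rewrite e1 // e2 // mktri_swap.
- move=> u' v' h' ee' x0 s u v l h ee; rewrite ee ee' in fE.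
  by exfalso; apply: (fan_nonflat h); apply/fE; apply: mktri_seg_flat.
- move=> i h' ee' x0 s u v l h ee; rewrite ee ee' in fE.
  by exfalso; apply: (fan_nonflat h); apply/fE; apply: mktri_seg_flat.
- move=> x1 s' u' v' l' h' ee' u v h ee; rewrite ee ee' in fE.
  by exfalso; apply: (fan_nonflat h'); apply/fE; apply: mktri_seg_flat.
- move=> u' v' h' ee' u v h ee; rewrite ee ee' !eval_triE !mktri_seg /= in E *.
  have uv : eval_vertex D u <> eval_vertex D v by case: h.
  have uv' : eval_vertex D u' <> eval_vertex D v' by case: h'.
  have hz := mid_open uv; set z := pseg _ _ _ in hz.
  have hz' : open_segment (eval_vertex D u') (eval_vertex D v') z.
    rewrite -(seg_interior uv') -(@tri_interior_eq _ (mktri (eval_vertex D u) (eval_vertex D v) (eval_vertex D v))).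
      by rewrite seg_interior.
    by rewrite !mktri_seg.
  have [[/subdivision_valid vu /subdivision_valid vv] _ _ _ _] := h.
  have [[/subdivision_valid vu' /subdivision_valid vv'] _ _ _ _] := h'.
  case: (seg_overlap h h' hz hz') => -[].
    by move=> /(equi_vertex H vu vu') -> /(equi_vertex H vv vv') ->.
  by move=> /(equi_vertex H vu vv') -> /(equi_vertex H vv vu') ->; rewrite conv2C.
- move=> i h' ee' u v h ee; rewrite ee ee' !eval_triE !mktri_seg /= in E.
  have uv : eval_vertex D u <> eval_vertex D v by case: h.
  exfalso; apply: uv; have K x : conv [:: eval_vertex D u; eval_vertex D v] x -> x = corner (input_tri D i) k0.
    by rewrite E => /conv2P [s _ ->]; rewrite /pseg subrr scaler0 addr0.
  by rewrite (K _ (conv2_l _ _)) (K _ (conv2_r _ _)).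
- move=> x1 s' u' v' l' h' ee' i h ee; rewrite ee ee' in fE.
  by exfalso; apply: (fan_nonflat h'); apply/fE; apply: mktri_seg_flat.
- move=> u v h' ee' i h ee; rewrite ee ee' !eval_triE !mktri_seg /= in E.
  have uv : eval_vertex D u <> eval_vertex D v by case: h'.
  exfalso; apply: uv; have K x : conv [:: eval_vertex D u; eval_vertex D v] x -> x = corner (input_tri D i) k0.
    by rewrite -E => /conv2P [s _ ->]; rewrite /pseg subrr scaler0 addr0.
  by rewrite (K _ (conv2_l _ _)) (K _ (conv2_r _ _)).
- move=> i' h' ee' i h ee; rewrite ee ee' !eval_triE !mktri_pt in E *.
  have [[hi _ _] [hi' _ _]] := (h, h').
  congr set1; apply: (proj1 (equi_vertex H (_ : valid D (Corner i k0)) (_ : valid D (Corner i' k0)))) => //.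
  have : [set eval_point D (Vertex (Corner i k0))] (eval_vertex D (Corner i k0)) by [].
  by rewrite E.
Qed.

Lemma TS_equi D D' L : equi D D' -> TS D L -> TS D' L.
Proof.
move=> H [h1 h2 h3]; have H' := equi_sym H; split.
- by move=> e /h1; apply: equi_TS_triangle.
- move=> e he'; have he := equi_TS_triangle H' he'; have [e1 he1 ee] := h2 e he.
  by exists e1 => //; apply: equi_same H _ he ee; apply: h1.
- move=> e0 i j ij e; apply: (h3 e0 i j ij); case/andP: ij => ij jL.
  apply: (equi_same H') e; apply: (equi_TS_triangle H); apply: h1; apply: nth_In => //.
  exact: ltn_trans ij jL.
Qed.

End Equi.

(** * Rational functions and tame sets *)

(* An alias that carries the closure proof, so that the closure properties of
   [K] are found by inference. *)
Definition const_field (R : realType) (K : {pred R}) (hK : constant_field K) : {pred R} := K.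
HB.instance Definition _ (R : realType) (K : {pred R}) (hK : constant_field K) :=
  GRing.isDivringClosed.Build R (const_field hK) (proj1 hK).

Section LineTopology.
Variable R : realType.
Implicit Types (s t x y : R) (X Y : set R) (p : {poly R}).

Lemma nbhs_real t X : nbhs t X <-> exists2 e : R, 0 < e & forall u, `|u - t| < e -> X u.
Proof.
split.
  move=> /nbhs_ballP [e /= e0 h]; exists e => // u hu; apply: h.
  by rewrite /ball /= distrC.
case=> e e0 h; apply/nbhs_ballP; exists e => //= u; rewrite /ball /= distrC; exact: h.
Qed.

Lemma not_boundary t X : (exists2 e : R, 0 < e & (forall u, `|u - t| < e -> X u) \/
  (forall u, `|u - t| < e -> ~ X u)) -> ~ topo_boundary X t.
Proof.
case=> e e0 [] h [hc hi].
  by apply: hi; apply/nbhs_real; exists e.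
have [|u [Xu hu]] := hc [set u | `|u - t| < e]; last exact: h hu Xu.
by apply/nbhs_real; exists e.
Qed.

Lemma boundaryU X Y : topo_boundary (X `|` Y) `<=` topo_boundary X `|` topo_boundary Y.
Proof.
move=> t [hc hi]; rewrite closureU in hc; case: hc => hc; [left|right]; split => // h; apply: hi;
  apply: interiorS h; [exact: subsetUl|exact: subsetUr].
Qed.

Lemma boundaryC X : topo_boundary (~` X) = topo_boundary X.
Proof.
have E (Z : set R) : closure Z = ~` interior (~` Z) by rewrite interiorC setCK.
rewrite /topo_boundary (E (~` X)) setCK interiorC.
by apply/seteqP; split=> t [h1 h2]; split => //; apply: contrapT.
Qed.

(** Without boundary points, the trace of [X] on the interval is both relatively open and relatively
    closed. This is how the absence of moments is exploited. *)
Lemma boundary_connected X x y s t : (forall u, x < u < y -> ~ topo_boundary X u) ->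
  x < s < y -> x < t < y -> X s -> X t.
Proof.
move=> h hs ht Xs; pose I := [set u : R | x < u < y].
have cI : connected I.
  apply/connected_intervalP => a b /andP [a1 a2] /andP [b1 b2] z /andP [z1 z2].
  by apply/andP; split; [exact: lt_le_trans z1|exact: le_lt_trans z2 _].
have : X `&` I = I.
  apply: cI.
  - by exists s.
  - exists (interior X); first exact: open_interior.
    apply/seteqP; split=> u [h1 h2]; split => //; last exact: interior_subset.
    apply: contrapT => h3; apply: (h u h2); split => //; exact: subset_closure.
  - exists (closure X); first exact: closed_closure.
    apply/seteqP; split=> u [h1 h2]; split => //; first exact: subset_closure.
    apply: contrapT => h3; apply: (h u h1); split => // /interior_subset; exact: h3.
by move=> E; have [] : (X `&` I) t by rewrite E.
Qed.

Lemma avoid_list t (s : seq R) : t \notin s ->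
  exists2 e : R, 0 < e & forall u, `|u - t| < e -> u \notin s.
Proof.
elim: s => [|a s IH]; first by exists 1.
rewrite inE negb_or => /andP [ta /IH [e e0 he]].
have ha : 0 < `|a - t| by rewrite normr_gt0 subr_eq0 eq_sym.
exists (Num.min e `|a - t|); first by rewrite lt_min e0.
move=> u; rewrite lt_min => /andP [h1 h2]; rewrite inE negb_or (he _ h1) andbT.
by apply: contraTneq h2 => ->; rewrite ltxx.
Qed.

Lemma poly_roots p : p != 0 -> exists s : seq R, forall t, root p t -> t \in s.
Proof.
have [n] := ubnP (size p); elim: n p => // n IH p sp p0.
case: (pselect (exists t, root p t)) => [[t ht]|h]; last first.
  by exists [::] => t ht; exfalso; apply: h; exists t.
have [q eq] := factor_theorem p t ht.
have q0 : q != 0 by apply: contraNneq p0 => h; rewrite eq h mul0r.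
have sq : (size q < n)%N.
  by move: sp; rewrite eq size_Mmonic ?monicXsubC // size_XsubC addn2.
have [s hs] := IH q sq q0; exists (t :: s) => u.
by rewrite eq rootM root_XsubC inE => /orP [/hs ->|->]; rewrite ?orbT.
Qed.

Lemma sign_const p x y s t : (forall u, x < u < y -> p.[u] != 0) ->
  x < s < y -> x < t < y -> Num.sg p.[s] = Num.sg p.[t].
Proof.
have K q a b : (forall u, x < u < y -> q.[u] != 0) -> x < a < y -> x < b < y ->
    a <= b -> q.[a] < 0 -> 0 < q.[b] -> False.
  move=> h /andP [a1 a2] /andP [b1 b2] ab qa qb.
  have [|z /andP [z1 z2] rz] := @poly_ivt R q a b ab; first by rewrite !ltW.
  have := h z; rewrite (lt_le_trans a1 z1) (le_lt_trans z2 b2) => /(_ isT).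
  by rewrite (eqP rz) eqxx.
have K2 q a b : (forall u, x < u < y -> q.[u] != 0) -> x < a < y -> x < b < y ->
    q.[a] < 0 -> 0 < q.[b] -> False.
  move=> h ha hb qa qb; case: (lerP a b) => ab; first exact: K h ha hb ab qa qb.
  apply: (K (- q) b a) => //; rewrite ?ltW // ?hornerN ?oppr_lt0 ?oppr_gt0 //.
  by move=> u /h; rewrite hornerN oppr_eq0.
move=> h hs ht; move: (h s hs) (h t ht); rewrite !neq_lt => /orP [ps|ps] /orP [pt|pt].
- by rewrite !ltr0_sg.
- by exfalso; apply: (K2 p s t).
- by exfalso; apply: (K2 p t s).
- by rewrite !gtr0_sg.
Qed.

Lemma near_compare t z u : `|u - t| < `|t - z| ->
  (u < z) = (t < z) /\ (u <= z) = (t <= z).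
Proof.
move=> h; case: (ltrgtP t z) => tz.
- have uz : u < z.
    move: h; rewrite [X in _ < X]distrC [X in _ < X]gtr0_norm ?subr_gt0 // ltr_norml => /andP []; lra.
  by rewrite uz ltW.
- have uz : z < u.
    move: h; rewrite [X in _ < X]gtr0_norm ?subr_gt0 // ltr_norml => /andP []; lra.
  by rewrite ltNge ltW //= leNgt uz.
- by move: h; rewrite tz subrr normr0 ltNge normr_ge0.
Qed.

Lemma itv_boundary b1 b2 x y t :
  topo_boundary [set u | u \in Interval (BSide b1 x) (BSide b2 y)] t -> t = x \/ t = y.
Proof.
move=> hb; apply: contrapT => /not_orP [/eqP tx /eqP ty]; apply: not_boundary hb.
exists (Num.min `|t - x| `|t - y|); first by rewrite lt_min !normr_gt0 !subr_eq0 tx ty.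
have E u : `|u - t| < Num.min `|t - x| `|t - y| ->
    (u \in Interval (BSide b1 x) (BSide b2 y)) = (t \in Interval (BSide b1 x) (BSide b2 y)).
  rewrite lt_min => /andP [/near_compare [h1 h2] /near_compare [h3 h4]].
  rewrite !itv_boundlr; congr andb.
    by case: b1; rewrite !bnd_simp; [rewrite !leNgt h1|rewrite !ltNge h2].
  by case: b2; rewrite !bnd_simp; [rewrite h3|rewrite h4].
case: (boolP (t \in Interval (BSide b1 x) (BSide b2 y))) => ht; [left|right] => u /E /=.
  by rewrite ht.
by move=> ->; apply/negP.
Qed.

End LineTopology.

(** * Functions rational over the constant field, and sets with algebraic boundary *)

Section RationalFunctions.
Variables (R : realType) (K : {pred R}) (hK : constant_field K).
Implicit Types (s t x y : R) (X Y J : set R) (p : {poly R}).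

Let Kf := const_field hK.

Lemma polyK1 : 1 \is a polyOver K.
Proof. have : 1 \is a polyOver Kf by exact: rpred1. by []. Qed.

Lemma polyKD p q : p \is a polyOver K -> q \is a polyOver K -> p + q \is a polyOver K.
Proof. move=> hp hq; have : p + q \is a polyOver Kf by exact: rpredD. by []. Qed.

Lemma polyKM p q : p \is a polyOver K -> q \is a polyOver K -> p * q \is a polyOver K.
Proof. move=> hp hq; have : p * q \is a polyOver Kf by exact: rpredM. by []. Qed.

Lemma polyKC c : c \in K -> c%:P \is a polyOver K.
Proof. by move=> hc; have : c%:P \is a polyOver Kf by rewrite polyOverC. Qed.

Lemma polyKXsub c : c \in K -> 'X - c%:P \is a polyOver K.
Proof. by move=> hc; have : 'X - c%:P \is a polyOver Kf by rewrite polyOverXsubC. Qed.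

Lemma polyK_val p t : p \is a polyOver K -> t \in K -> p.[t] \in K.
Proof. by move=> hp ht; have : p.[t] \in Kf by apply: rpred_horner. Qed.

Lemma K_div x y : x \in K -> y \in K -> x / y \in K.
Proof. by move=> hx hy; have : x / y \in Kf by apply: rpred_div. Qed.

Lemma K0 : 0 \in K. Proof. have : 0 \in Kf by apply: rpred0. by []. Qed.
Lemma K1 : 1 \in K. Proof. have : 1 \in Kf by apply: rpred1. by []. Qed.
Lemma KN1 : -1 \in K. Proof. have : -1 \in Kf by apply: rpredN1. by []. Qed.

Definition ratl J (f : R -> R) := exists n d : {poly R},
  [/\ n \is a polyOver K, d \is a polyOver K
    & forall t, J t -> d.[t] != 0 /\ f t = n.[t] / d.[t]].

Lemma ratl_ext J f g : (forall t, J t -> f t = g t) -> ratl J f -> ratl J g.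
Proof.
move=> h [n [d [hn hd hf]]]; exists n, d; split => // t Jt; have [h1 h2] := hf t Jt.
by split => //; rewrite -h.
Qed.

Lemma ratl_poly J p : p \is a polyOver K -> ratl J (fun t => p.[t]).
Proof.
move=> hp; exists p, 1; split => //; first exact: polyK1.
by move=> t _; rewrite !hornerE oner_neq0 divr1.
Qed.

Lemma ratl_const J c : c \in K -> ratl J (fun=> c).
Proof.
move=> hc; apply: (@ratl_ext _ (fun t => c%:P.[t])); first by move=> t _; rewrite hornerC.
by apply: ratl_poly; apply: polyKC.
Qed.

Lemma ratl_add J f g : ratl J f -> ratl J g -> ratl J (fun t => f t + g t).
Proof.
move=> [n [d [hn hd hf]]] [n' [d' [hn' hd' hg]]].
exists (n * d' + n' * d), (d * d'); split.
- by apply: polyKD; apply: polyKM.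
- by apply: polyKM.
- move=> t Jt; have [h1 ->] := hf t Jt; have [h2 ->] := hg t Jt.
  rewrite !hornerE mulf_neq0 //; split => //; field; by rewrite h1 h2.
Qed.

Lemma ratl_mul J f g : ratl J f -> ratl J g -> ratl J (fun t => f t * g t).
Proof.
move=> [n [d [hn hd hf]]] [n' [d' [hn' hd' hg]]].
exists (n * n'), (d * d'); split; try by apply: polyKM.
move=> t Jt; have [h1 ->] := hf t Jt; have [h2 ->] := hg t Jt.
by rewrite !hornerM mulf_neq0 // mulf_div.
Qed.

Lemma ratl_opp J f : ratl J f -> ratl J (fun t => - f t).
Proof.
move=> hf; apply: (@ratl_ext _ (fun t => (-1) * f t)); first by move=> t _; ring.
by apply: ratl_mul => //; apply: ratl_const; exact: KN1.
Qed.

Lemma ratl_sub2 J f g : ratl J f -> ratl J g -> ratl J (fun t => f t - g t).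
Proof. by move=> hf hg; apply: ratl_add => //; apply: ratl_opp. Qed.

Lemma ratl_inv J f : ratl J f -> (forall t, J t -> f t != 0) -> ratl J (fun t => (f t)^-1).
Proof.
move=> [n [d [hn hd hf]]] h; exists d, n; split => // t Jt; have [h1 h2] := hf t Jt.
have := h t Jt; rewrite h2 mulf_eq0 negb_or => /andP [n0 _].
by rewrite n0; split => //; rewrite invf_div.
Qed.

Lemma ratl_div J f g : ratl J f -> ratl J g -> (forall t, J t -> g t != 0) ->
  ratl J (fun t => f t / g t).
Proof. by move=> hf hg h; apply: ratl_mul => //; apply: ratl_inv. Qed.

Lemma ratl_val J f t : ratl J f -> J t -> t \in K -> f t \in K.
Proof.
move=> [n [d [hn hd hf]]] Jt tK; have [_ ->] := hf t Jt.
by apply: K_div; apply: polyK_val.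
Qed.

(** A function with one zero vanishes throughout by hypothesis. Otherwise the sign of [n / d] is
    that of the polynomial [n * d], which has no zero in the interval. *)
Lemma ratl_sign J f x y s t : ratl J f -> (forall u, x < u < y -> J u) ->
  (forall u v, x < u < y -> x < v < y -> f u = 0 -> f v = 0) ->
  x < s < y -> x < t < y -> Num.sg (f s) = Num.sg (f t).
Proof.
move=> [n [d [hn hd hf]]] hJ hz hs ht.
case: (eqVneq (f s) 0) => [e|ne]; first by rewrite e (hz s t).
have nz u : x < u < y -> f u != 0.
  by move=> hu; apply: contraNneq ne => /(hz u s hu hs) ->.
have E u : x < u < y -> Num.sg (f u) = Num.sg (n * d).[u] /\ (n * d).[u] != 0.
  move=> hu; have [h1 h2] := hf u (hJ u hu); have := nz u hu.
  rewrite h2 mulf_eq0 negb_or => /andP [n0 _].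
  by rewrite sgrM sgrV hornerM sgrM mulf_neq0.
rewrite (proj1 (E s hs)) (proj1 (E t ht)); apply: sign_const ht => //.
by move=> u /E [].
Qed.

Definition ratpt J (f : R -> pt R) := ratl J (fun t => px (f t)) /\ ratl J (fun t => py (f t)).

Lemma ratpt_add J f g : ratpt J f -> ratpt J g -> ratpt J (fun t => f t + g t).
Proof.
move=> [f1 f2] [g1 g2]; split.
  by apply: ratl_ext (ratl_add f1 g1) => t _; rewrite ptE.
by apply: ratl_ext (ratl_add f2 g2) => t _; rewrite ptE.
Qed.

Lemma ratpt_sub J f g : ratpt J f -> ratpt J g -> ratpt J (fun t => f t - g t).
Proof.
move=> [f1 f2] [g1 g2]; split.
  by apply: ratl_ext (ratl_sub2 f1 g1) => t _; rewrite !ptE.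
by apply: ratl_ext (ratl_sub2 f2 g2) => t _; rewrite !ptE.
Qed.

Lemma ratpt_scale J c f : ratl J c -> ratpt J f -> ratpt J (fun t => c t *: f t).
Proof.
move=> hc [f1 f2]; split.
  by apply: ratl_ext (ratl_mul hc f1) => t _; rewrite !ptE.
by apply: ratl_ext (ratl_mul hc f2) => t _; rewrite !ptE.
Qed.

Lemma ratpt_mk J f g : ratl J f -> ratl J g -> ratpt J (fun t => mkpt (f t) (g t)).
Proof.
by move=> hf hg; split; [apply: ratl_ext hf|apply: ratl_ext hg] => t _; rewrite !ptE.
Qed.

Lemma ratpt_const J (c : pt R) : px c \in K -> py c \in K -> ratpt J (fun=> c).
Proof. by move=> h1 h2; split; apply: ratl_const. Qed.

Lemma ratl_cross J f g : ratpt J f -> ratpt J g -> ratl J (fun t => cross (f t) (g t)).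
Proof. by move=> [f1 f2] [g1 g2]; apply: ratl_sub2; apply: ratl_mul. Qed.

Lemma ratl_dot J f g : ratpt J f -> ratpt J g -> ratl J (fun t => dot (f t) (g t)).
Proof. by move=> [f1 f2] [g1 g2]; apply: ratl_add; apply: ratl_mul. Qed.

Lemma ratpt_ext J f g : (forall t, J t -> f t = g t) -> ratpt J f -> ratpt J g.
Proof. by move=> h [h1 h2]; split; [apply: ratl_ext h1|apply: ratl_ext h2] => t /h ->. Qed.

Lemma ratpt_sum (A : Type) J (f : A -> R -> pt R) (s : seq A) :
  (forall a, List.In a s -> ratpt J (f a)) -> ratpt J (fun t => \sum_(a <- s) f a t).
Proof.
elim: s => [|a s IH] h.
  apply: (@ratpt_ext _ (fun=> 0)); first by move=> t _; rewrite big_nil.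
  by apply: ratpt_const; rewrite ptE K0.
apply: (@ratpt_ext _ (fun t => f a t + \sum_(b <- s) f b t)).
  by move=> t _; rewrite big_cons.
apply: ratpt_add; first by apply: h; left.
by apply: IH => b hb; apply: h; right.
Qed.

Lemma trans_atE (f : trans R) t (x : pt R) : trans_at f t x =
  mkpt (lin_at f t ord0 ord0 * px x + lin_at f t ord0 ord_max * py x + shift_at f t ord0 ord0)
       (lin_at f t ord_max ord0 * px x + lin_at f t ord_max ord_max * py x + shift_at f t ord_max ord0).
Proof.
have e : lift ord0 ord0 = ord_max :> 'I_2 by apply: val_inj.
apply: ptP; rewrite /trans_at !ptE /px /py;
by rewrite [X in X + _ = _]mxE !big_ord_recl big_ord0 addr0 e.
Qed.

Lemma ratpt_trans J (f : trans R) (x : pt R) : trans_over K f ->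
  (forall t, J t -> trans_defined f t) -> (forall i, x i ord0 \in K) ->
  ratpt J (fun t => trans_at f t x).
Proof.
move=> [o1 o2] hd hx.
have L i j : ratl J (fun t => lin_at f t i j).
  exists (lin_part f i j).1, (lin_part f i j).2; have /andP [h1 h2] := o1 i j.
  split => // t Jt; have [h _ _] := hd t Jt; split; first exact: h.
  by rewrite mxE.
have S i : ratl J (fun t => shift_at f t i ord0).
  exists (shift_part f i ord0).1, (shift_part f i ord0).2; have /andP [h1 h2] := o2 i.
  split => // t Jt; have [_ h _] := hd t Jt; split; first exact: h.
  by rewrite mxE.
apply: (ratpt_ext (fun t _ => esym (trans_atE f t x))).
by apply: ratpt_mk; apply: ratl_add => //; apply: ratl_add; apply: ratl_mul => //;
   apply: ratl_const; apply: hx.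
Qed.

(** The boundary is then finite, and contained in [K] because [K] is algebraically closed in the
    reals. Such sets form a Boolean algebra containing the zero sets of rational functions and the
    time domains. *)
Definition tame X := exists p, [/\ p != 0, p \is a polyOver K
  & forall t, topo_boundary X t -> root p t].

Lemma tame_ext X Y : (forall t, X t <-> Y t) -> tame X -> tame Y.
Proof. by move=> h; have -> : X = Y by apply/seteqP; split=> t /h. Qed.

Lemma tameU X Y : tame X -> tame Y -> tame (X `|` Y).
Proof.
move=> [p [p0 hp h]] [q [q0 hq h']]; exists (p * q); split.
- by rewrite mulf_neq0.
- by apply: polyKM.
- by move=> t /boundaryU [/h|/h']; rewrite rootM => ->; rewrite ?orbT.
Qed.

Lemma tameC X : tame X -> tame (~` X).
Proof. by move=> [p [p0 hp h]]; exists p; split => // t; rewrite boundaryC; apply: h. Qed.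

Lemma tameI X Y : tame X -> tame Y -> tame (X `&` Y).
Proof.
by move=> hX hY; rewrite -[X `&` Y]setCK setCI; apply: tameC; apply: tameU; apply: tameC.
Qed.

Lemma tame_root p : p \is a polyOver K -> tame [set t | root p t].
Proof.
move=> hp; case: (eqVneq p 0) => [->|p0].
  exists 1; split; [exact: oner_neq0|exact: polyK1|].
  move=> t hb; exfalso; apply: not_boundary hb; exists 1 => //; left => u _ /=.
  exact: root0.
exists p; split => // t hb; apply: contrapT => nt; apply: not_boundary hb.
have [s hs] := poly_roots p0.
have [|e e0 he] := @avoid_list R t [seq u <- s | root p u].
  by rewrite mem_filter; apply/negP => /andP [].
exists e => //; right => u /he /negP hu hr; apply: hu.
by rewrite mem_filter; apply/andP; split => //; apply: hs.
Qed.

Lemma tame_itv (I : interval R) : time_interval K I -> tame [set t | t \in I].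
Proof.
case=> _ [bx [x [b_y [y [-> xK yK]]]]]; exists (('X - x%:P) * ('X - y%:P)); split.
- by rewrite mulf_neq0 // polyXsubC_eq0.
- by apply: polyKM; apply: polyKXsub.
- by move=> t /itv_boundary [] ->; rewrite rootM !root_XsubC eqxx ?orbT.
Qed.

Lemma tame_zero J f : tame J -> ratl J f -> tame [set t | J t /\ f t = 0].
Proof.
move=> tJ [n [d [hn hd hf]]]; apply: (@tame_ext (J `&` [set t | root n t])).
  move=> t; split=> -[Jt h]; split => //; have [h1 h2] := hf t Jt.
    by rewrite h2 (eqP h) mul0r.
  by move/eqP: h; rewrite h2 mulf_eq0 invr_eq0 (negPf h1) orbF.
by apply: tameI => //; apply: tame_root.
Qed.

Definition tameq J (Q : R -> Prop) := tame [set t | J t /\ Q t].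

Lemma tameq_and J Q Q' : tameq J Q -> tameq J Q' -> tameq J (fun t => Q t /\ Q' t).
Proof. by move=> h h'; apply: tame_ext (tameI h h') => t; split=> [[[? ?] [? ?]]|[? [? ?]]]. Qed.

Lemma tameq_or J Q Q' : tameq J Q -> tameq J Q' -> tameq J (fun t => Q t \/ Q' t).
Proof.
move=> h h'; apply: tame_ext (tameU h h') => t; split=> [[[? ?]|[? ?]]|[? [?|?]]];
  by [split=> //; auto|left|right].
Qed.

Lemma tameq_not J Q : tame J -> tameq J Q -> tameq J (fun t => ~ Q t).
Proof.
move=> hJ h; apply: tame_ext (tameI hJ (tameC h)) => t; split=> -[Jt hQ]; split => //.
  by move=> q; apply: hQ.
by case.
Qed.

Lemma tameq_pt J f g : tame J -> ratpt J f -> ratpt J g -> tameq J (fun t => f t = g t).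
Proof.
move=> hJ hf hg; have [h1 h2] := ratpt_sub hf hg.
apply: tame_ext (tameI (tame_zero hJ h1) (tame_zero hJ h2)) => t; split.
  move=> [[Jt e1] [_ e2]]; split => //; move: e1 e2; rewrite !ptE => e1 e2.
  by apply: ptP; apply/eqP; rewrite -subr_eq0; apply/eqP.
by move=> [Jt e]; split; split => //=; rewrite e subrr !ptE.
Qed.

Lemma tame_moment X t : tame X -> topo_boundary X t -> t \in K.
Proof. by case=> p [p0 hp h] /h; apply: (proj2 hK) p0 hp. Qed.

Lemma tame_finite X : tame X -> exists s : seq R, forall t, topo_boundary X t -> t \in s.
Proof. by case=> p [p0 hp h]; have [s hs] := poly_roots p0; exists s => t /h; apply: hs. Qed.

End RationalFunctions.

(** * Moments of the time partition *)

Section Lines.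
Variable R : realType.
Implicit Types (p q x y z d : pt R).

(** With [d = 0] this is the point [p], so that degenerate carriers are included. *)
Definition line p d : set (pt R) := [set x | exists s : R, x = p + s *: d].

Lemma line0 p x : line p 0 x <-> x = p.
Proof. by split=> [[s ->]|->]; [rewrite scaler0 addr0|exists 0; rewrite scaler0 addr0]. Qed.

Lemma lineP p d x : d != 0 -> line p d x <-> cross d (x - p) = 0.
Proof.
move=> d0; split=> [[s ->]|h]; first by rewrite /cross !ptE; ring.
by have [s es] := parallel_scale d0 h; exists s; rewrite -es addrC subrK.
Qed.

Lemma line_src p d : line p d p.
Proof. by exists 0; rewrite scale0r addr0. Qed.

Lemma cross0r d : cross d (0 : pt R) = 0. Proof. by rewrite /cross !ptE; ring. Qed.
Lemma cross0l d : cross (0 : pt R) d = 0. Proof. by rewrite /cross !ptE; ring. Qed.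

Definition meet_pt p1 d1 p2 d2 := p1 + (cross (p2 - p1) d2 / cross d1 d2) *: d1.

Lemma meet_ptP p1 d1 p2 d2 : cross d1 d2 <> 0 ->
  line p1 d1 (meet_pt p1 d1 p2 d2) /\ line p2 d2 (meet_pt p1 d1 p2 d2).
Proof.
move=> /eqP h; split; first by exists (cross (p2 - p1) d2 / cross d1 d2).
have d20 : d2 != 0 by apply: contraNneq h => ->; rewrite cross0r.
apply/(lineP _ _ d20); rewrite /meet_pt; move: h; rewrite /cross !ptE => h; field.
exact: h.
Qed.

(** Transverse lines meet; otherwise the base point of one is on the other, or both are the same
    point. The right-hand side is built from equations in the coordinates, so that the moments at
    which it holds form a tame set. *)
Lemma lines_meet p1 d1 p2 d2 : (exists x, line p1 d1 x /\ line p2 d2 x) <->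
  (~ cross d1 d2 = 0 \/ ((~ d1 = 0 /\ cross d1 (p2 - p1) = 0) \/
    ((~ d2 = 0 /\ cross d2 (p2 - p1) = 0) \/ p1 = p2))).
Proof.
split.
  case=> x [[s es] [r er]]; case: (pselect (cross d1 d2 = 0)) => [h|]; last by left.
  right; have e : p2 - p1 = s *: d1 - r *: d2.
    apply: ptP; have := congr1 (@px R) (etrans (esym es) er);
    have := congr1 (@py R) (etrans (esym es) er); rewrite !ptE; lra.
  case: (eqVneq d1 0) => [d10|d10].
    right; case: (eqVneq d2 0) => [d20|d20].
      by right; move: e; rewrite d10 d20 !scaler0 subr0 => /eqP; rewrite subr_eq0 => /eqP ->.
    left; split; first exact/eqP.
    by rewrite e d10 /cross !ptE; ring.
  left; split; first exact/eqP.
  rewrite e; transitivity (- r * cross d1 d2); first by rewrite /cross !ptE; ring.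
  by rewrite h mulr0.
case=> [h|[[/eqP d0 h]|[[/eqP d0 h]|->]]].
- exists (meet_pt p1 d1 p2 d2); exact: meet_ptP.
- exists p2; split; [exact/lineP|exact: line_src].
- exists p1; split; first exact: line_src.
  apply/lineP => //; rewrite -opprB -[RHS](oppr0) -h /cross !ptE; ring.
- exists p2; split; exact: line_src.
Qed.

Definition on_line p d q := (~ d = 0 /\ cross d (q - p) = 0) \/ (d = 0 /\ q = p).

Lemma on_lineP p d q : line p d q <-> on_line p d q.
Proof.
case: (eqVneq d 0) => [->|d0]; rewrite /on_line.
  by rewrite line0; split=> [->|[[]//|[]//]]; right.
rewrite lineP //; split=> [h|[[]//|[h]]]; first by left; split => //; apply/eqP.
by rewrite h eqxx in d0.
Qed.

(** The condition that the intersection of the first two lines is on the third, multiplied by the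
    denominator [cross d1 d2]. *)
Definition meet_on_line p1 d1 p2 d2 p3 d3 := ~ cross d1 d2 = 0 /\
  cross d1 d2 * cross d3 (p1 - p3) + cross (p2 - p1) d2 * cross d3 d1 = 0.

Lemma meet_on_lineP p1 d1 p2 d2 p3 d3 : d3 != 0 ->
  meet_on_line p1 d1 p2 d2 p3 d3 <->
  ~ cross d1 d2 = 0 /\ line p3 d3 (meet_pt p1 d1 p2 d2).
Proof.
move=> d30; split=> -[h hm]; split => //; have h' : cross d1 d2 != 0 by apply/eqP.
  apply/lineP => //; apply: (mulfI h'); rewrite mulr0 -hm /meet_pt.
  move: h'; rewrite /cross !ptE => h'; field; exact: h'.
move: hm => /(lineP _ _ d30) /(congr1 (fun r => cross d1 d2 * r)); rewrite mulr0 => <-.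
rewrite /meet_pt; move: h'; rewrite /cross !ptE => h'; field; exact: h'.
Qed.

Lemma two_lines p1 d1 p2 d2 x y : cross d1 d2 <> 0 -> line p1 d1 x -> line p2 d2 x ->
  line p1 d1 y -> line p2 d2 y -> x = y.
Proof.
move=> /eqP h.
have d10 : d1 != 0 by apply: contraNneq h => ->; rewrite cross0l.
have d20 : d2 != 0 by apply: contraNneq h => ->; rewrite cross0r.
move=> /(lineP _ _ d10) h1 /(lineP _ _ d20) h2 /(lineP _ _ d10) h3 /(lineP _ _ d20) h4.
exact: line_line h h1 h2 h3 h4.
Qed.

Definition concurrent p1 d1 p2 d2 p3 d3 := exists x, forall z,
  (line p1 d1 z /\ line p2 d2 z) /\ line p3 d3 z <-> z = x.

(** If a carrier is a point, that point must be on the other two. Three proper lines have exactly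
    one common point only if two of them are transverse and the third passes through their
    intersection. *)
Lemma concurrentP p1 d1 p2 d2 p3 d3 : concurrent p1 d1 p2 d2 p3 d3 <->
  (d1 = 0 /\ (on_line p2 d2 p1 /\ on_line p3 d3 p1)) \/
  ((d2 = 0 /\ (on_line p1 d1 p2 /\ on_line p3 d3 p2)) \/
  ((d3 = 0 /\ (on_line p1 d1 p3 /\ on_line p2 d2 p3)) \/
  ((~ d1 = 0 /\ (~ d2 = 0 /\ ~ d3 = 0)) /\
   (meet_on_line p1 d1 p2 d2 p3 d3 \/
   (meet_on_line p1 d1 p3 d3 p2 d2 \/ meet_on_line p2 d2 p3 d3 p1 d1))))).
Proof.
split.
  case=> x hx; have [[h1 h2] h3] := proj2 (hx x) erefl.
  case: (eqVneq d1 0) => [e|d10].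
    by rewrite e line0 in h1; left; split => //; rewrite -!on_lineP -h1.
  case: (eqVneq d2 0) => [e|d20].
    by rewrite e line0 in h2; right; left; split => //; rewrite -!on_lineP -h2.
  case: (eqVneq d3 0) => [e|d30].
    by rewrite e line0 in h3; right; right; left; split => //; rewrite -!on_lineP -h3.
  right; right; right; split; first by split; [|split]; apply/eqP.
  case: (pselect (cross d1 d2 = 0)) => [c12|c12]; last first.
    left; apply/meet_on_lineP => //; split => //.
    have [m1 m2] := meet_ptP p1 p2 c12.
    by rewrite -(two_lines c12 h1 h2 m1 m2).
  case: (pselect (cross d1 d3 = 0)) => [c13|c13]; last first.
    right; left; apply/meet_on_lineP => //; split => //.
    have [m1 m2] := meet_ptP p1 p3 c13.
    by rewrite -(two_lines c13 h1 h3 m1 m2).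
  (* If all three lines were parallel to [d1], then [x + d1] would be a second common point. *)
  exfalso; have hz : (line p1 d1 (x + d1) /\ line p2 d2 (x + d1)) /\ line p3 d3 (x + d1).
    have K p d : d != 0 -> cross d1 d = 0 -> line p d x -> line p d (x + d1).
      move=> d0 hc /(lineP _ _ d0) h; apply/lineP => //.
      transitivity (cross d (x - p) - cross d1 d); first by rewrite /cross !ptE; ring.
      by rewrite h hc subrr.
    by split; [split|]; apply: K => //; rewrite cross_self.
  move/(proj1 (hx _)): hz => e; move/eqP: d10; apply.
  by apply: (addrI x); rewrite addr0.
have U a b c x : cross a.2 b.2 <> 0 -> line a.1 a.2 x -> line b.1 b.2 x -> line c.1 c.2 x ->
    forall z, (line a.1 a.2 z /\ line b.1 b.2 z) /\ line c.1 c.2 z <-> z = x.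
  move=> h ha hb hc z; split=> [[[h1 h2] _]|-> //]; exact: two_lines h h1 h2 ha hb.
case=> [[e]|[[e]|[[e]|]]]; rewrite -?on_lineP.
- by move=> [h2 h3]; exists p1 => z; rewrite e line0; split=> [[[]]//|->].
- by move=> [h1 h3]; exists p2 => z; rewrite e line0; split=> [[[]]//|->].
- by move=> [h1 h2]; exists p3 => z; rewrite e line0; split=> [[]//|->].
case=> -[/eqP d10 [/eqP d20 /eqP d30]] [|[]] /meet_on_lineP.
- move=> /(_ d30) [c hm]; have [m1 m2] := meet_ptP p1 p2 c.
  exists (meet_pt p1 d1 p2 d2); exact: (U (p1, d1) (p2, d2) (p3, d3)).
- move=> /(_ d20) [c hm]; have [m1 m3] := meet_ptP p1 p3 c.
  exists (meet_pt p1 d1 p3 d3) => z.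
  by rewrite -(U (p1, d1) (p3, d3) (p2, d2) _ c m1 m3 hm z) /=; tauto.
- move=> /(_ d10) [c hm]; have [m2 m3] := meet_ptP p2 p3 c.
  exists (meet_pt p2 d2 p3 d3) => z.
  by rewrite -(U (p2, d2) (p3, d3) (p1, d1) _ c m2 m3 hm z) /=; tauto.
Qed.

End Lines.

Lemma finite_union (R : eqType) (T : finType) (P : T -> R -> Prop) :
  (forall i, exists s : seq R, forall t, P i t -> t \in s) ->
  exists s : seq R, forall t, (exists i, P i t) -> t \in s.
Proof.
move=> /choice [f hf]; exists (flatten [seq f i | i <- enum T]) => t [i hi].
apply/flattenP; exists (f i); last exact: hf.
by apply: map_f; rewrite mem_enum.
Qed.

(** * Moments are finitely many and belong to the constant field *)

Section Moments.
Variables (R : realType) (K : {pred R}) (hK : constant_field K).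
Implicit Types (a b : atomic R) (s t : R) (k l : 'I_3 * 'I_3).

Lemma corner_tri_at a t (j : 'I_3) :
  corner (tri_at a t) j = trans_at (tfun a) t (corner (ref_obj a) j).
Proof. by rewrite /corner tnth_map. Qed.

Definition msrc a k t := corner (tri_at a t) k.1.
Definition mdir a k t := corner (tri_at a t) k.2 - corner (tri_at a t) k.1.

Lemma ratpt_corner a (J : set R) j : atomic_object K a -> J `<=` [set t | t \in time_dom a] ->
  ratpt K J (fun t => corner (tri_at a t) j).
Proof.
move=> [hc _ ht hd] hJ; apply: (@ratpt_ext _ _ _ (fun t => trans_at (tfun a) t (corner (ref_obj a) j))).
  by move=> t _; rewrite corner_tri_at.
by apply: ratpt_trans => // t /hJ; apply: hd.
Qed.

Lemma ratpt_msrc a k (J : set R) : atomic_object K a -> J `<=` [set t | t \in time_dom a] ->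
  ratpt K J (msrc a k).
Proof. exact: ratpt_corner. Qed.

Lemma ratpt_mdir a k (J : set R) : atomic_object K a -> J `<=` [set t | t \in time_dom a] ->
  ratpt K J (mdir a k).
Proof. by move=> h1 h2; apply: ratpt_sub => //; apply: ratpt_corner. Qed.

Section Formulas.
Variable J : set R.
Hypothesis hJ : tame K J.
Implicit Types p d q : R -> pt R.
Local Notation "'rp' p" := (ratpt K J p) (at level 10).

Lemma rp0 : rp (fun=> 0).
Proof. by apply: ratpt_const => //; rewrite ptE; apply: K0. Qed.

Lemma tameq_eq0 d : rp d -> tameq K J (fun t => d t = 0).
Proof. by move=> h; apply: tameq_pt => //; apply: rp0. Qed.

Lemma tameq_cross d q : rp d -> rp q -> tameq K J (fun t => cross (d t) (q t) = 0).
Proof. by move=> h1 h2; apply: tame_zero => //; apply: ratl_cross. Qed.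

Lemma tameq_on_line p d q : rp p -> rp d -> rp q ->
  tameq K J (fun t => on_line (p t) (d t) (q t)).
Proof.
move=> hp hd hq; apply: tameq_or => //; apply: tameq_and => //.
- by apply: tameq_not => //; apply: tameq_eq0.
- by apply: tameq_cross => //; apply: ratpt_sub.
- exact: tameq_eq0.
- exact: tameq_pt.
Qed.

Lemma tameq_meet_on_line p1 d1 p2 d2 p3 d3 : rp p1 -> rp d1 -> rp p2 -> rp d2 ->
  rp p3 -> rp d3 ->
  tameq K J (fun t => meet_on_line (p1 t) (d1 t) (p2 t) (d2 t) (p3 t) (d3 t)).
Proof.
move=> h1 e1 h2 e2 h3 e3; apply: tameq_and => //.
  by apply: tameq_not => //; apply: tameq_cross.
apply: tame_zero => //; apply: ratl_add => //; apply: ratl_mul => //;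
  apply: ratl_cross => //; exact: ratpt_sub.
Qed.

End Formulas.

Lemma tame_meeting a b k l : atomic_object K a -> atomic_object K b ->
  tame K (meeting_times a b k l).
Proof.
move=> ha hb; pose J : set R := [set t | t \in time_dom a] `&` [set t | t \in time_dom b].
have hJ : tame K J by apply: tameI => //; apply: tame_itv => //; [case: ha|case: hb].
have Ja : J `<=` [set t | t \in time_dom a] by move=> t [].
have Jb : J `<=` [set t | t \in time_dom b] by move=> t [].
have p1 := ratpt_msrc k ha Ja; have d1 := ratpt_mdir k ha Ja.
have p2 := ratpt_msrc l hb Jb; have d2 := ratpt_mdir l hb Jb.
have : tameq K J (fun t => ~ cross (mdir a k t) (mdir b l t) = 0 \/
   ((~ mdir a k t = 0 /\ cross (mdir a k t) (msrc b l t - msrc a k t) = 0) \/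
    ((~ mdir b l t = 0 /\ cross (mdir b l t) (msrc b l t - msrc a k t) = 0) \/ msrc a k t = msrc b l t))).
  have ds := ratpt_sub hK p2 p1.
  apply: tameq_or => //; first by apply: tameq_not => //; apply: tameq_cross.
  apply: tameq_or => //.
    apply: tameq_and => //; last exact: tameq_cross.
    by apply: tameq_not => //; apply: tameq_eq0.
  apply: tameq_or => //; last exact: tameq_pt.
  apply: tameq_and => //; last exact: tameq_cross.
  by apply: tameq_not => //; apply: tameq_eq0.
apply: tame_ext => t; split.
  by case=> -[ta tb] /lines_meet h; split.
by case=> ta tb h; split=> //; apply/lines_meet.
Qed.

Lemma concurrence_concurrent a b c k l (m : 'I_3 * 'I_3) t :
  (exists x, carrier (tri_at a t) k `&` carrier (tri_at b t) l `&` carrier (tri_at c t) m = [set x])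
  <-> concurrent (msrc a k t) (mdir a k t) (msrc b l t) (mdir b l t) (msrc c m t) (mdir c m t).
Proof.
split=> -[x hx]; exists x.
  by move=> z; have := congr1 (fun S => S z) hx => /= e; split=> [h|e']; [rewrite -[z = x]e|rewrite e'; have /= := congr1 (fun S => S x) hx => ->].
by apply/seteqP; split=> z; apply hx.
Qed.

Lemma tame_concurrence a b c k l (m : 'I_3 * 'I_3) : atomic_object K a ->
  atomic_object K b -> atomic_object K c -> tame K (concurrence_times a b c k l m).
Proof.
move=> ha hb hc; pose J : set R := [set t | t \in time_dom a] `&` [set t | t \in time_dom b]
  `&` [set t | t \in time_dom c].
have hJ : tame K J.
  by apply: tameI => //; [apply: tameI => //|]; apply: tame_itv => //; [case: ha|case: hb|case: hc].
have Ja : J `<=` [set t | t \in time_dom a] by move=> t [[]].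
have Jb : J `<=` [set t | t \in time_dom b] by move=> t [[]].
have Jc : J `<=` [set t | t \in time_dom c] by move=> t [].
have p1 := ratpt_msrc k ha Ja; have d1 := ratpt_mdir k ha Ja.
have p2 := ratpt_msrc l hb Jb; have d2 := ratpt_mdir l hb Jb.
have p3 := ratpt_msrc m hc Jc; have d3 := ratpt_mdir m hc Jc.
have z1 := tameq_eq0 hJ d1; have z2 := tameq_eq0 hJ d2; have z3 := tameq_eq0 hJ d3.
have : tameq K J (fun t => 
  (mdir a k t = 0 /\ (on_line (msrc b l t) (mdir b l t) (msrc a k t) /\
     on_line (msrc c m t) (mdir c m t) (msrc a k t))) \/
  ((mdir b l t = 0 /\ (on_line (msrc a k t) (mdir a k t) (msrc b l t) /\
     on_line (msrc c m t) (mdir c m t) (msrc b l t))) \/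
  ((mdir c m t = 0 /\ (on_line (msrc a k t) (mdir a k t) (msrc c m t) /\
     on_line (msrc b l t) (mdir b l t) (msrc c m t))) \/
  ((~ mdir a k t = 0 /\ (~ mdir b l t = 0 /\ ~ mdir c m t = 0)) /\
   (meet_on_line (msrc a k t) (mdir a k t) (msrc b l t) (mdir b l t) (msrc c m t) (mdir c m t) \/
   (meet_on_line (msrc a k t) (mdir a k t) (msrc c m t) (mdir c m t) (msrc b l t) (mdir b l t) \/
    meet_on_line (msrc b l t) (mdir b l t) (msrc c m t) (mdir c m t) (msrc a k t) (mdir a k t))))))).
  apply: tameq_or => //; first by do 2!apply: tameq_and => //; apply: tameq_on_line.
  apply: tameq_or => //; first by do 2!apply: tameq_and => //; apply: tameq_on_line.
  apply: tameq_or => //; first by do 2!apply: tameq_and => //; apply: tameq_on_line.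
  apply: tameq_and => //; first by do 2?[apply: tameq_and => //]; apply: tameq_not.
  by apply: tameq_or => //; [|apply: tameq_or => //]; apply: tameq_meet_on_line.
apply: tame_ext => t; split.
  by case=> -[[ta tb] tc] /concurrentP h; split=> //; apply/concurrence_concurrent.
by case=> ta tb tc /concurrence_concurrent h; split=> //; apply/concurrentP.
Qed.

Variable O : seq (atomic R).
Hypothesis hO : geometric_object K O.

Lemma tnth_atomic i : atomic_object K (tnth (in_tuple O) i).
Proof. apply: hO; exact: tnth_In. Qed.

Lemma endpoint_K a t : atomic_object K a -> is_endpoint (time_dom a) t -> t \in K.
Proof.
case=> _ [_ [bx [u [b_y [v [-> uK vK]]]]]] _ _ [b [r]].
by case=> [[_ <- _]|[_ _ <-]].
Qed.

Lemma endpoint_finite a : atomic_object K a ->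
  exists s : seq R, forall t, is_endpoint (time_dom a) t -> t \in s.
Proof.
case=> _ [_ [bx [u [b_y [v [-> uK vK]]]]]] _ _; exists [:: u; v] => t [b [r]].
by case=> [[_ <- _]|[_ _ <-]]; rewrite !inE eqxx ?orbT.
Qed.

Lemma moment_K t : moment O t -> t \in K.
Proof.
case.
- by case=> a ha; apply: endpoint_K; apply: hO.
- case=> i [j [k [l /= [_ _ _ hb]]]]; apply: tame_moment hb => //.
  apply: tame_meeting; exact: tnth_atomic.
- case=> i [j [h [k [l [m /= [_ _ hb]]]]]]; apply: tame_moment hb => //.
  apply: tame_concurrence; exact: tnth_atomic.
Qed.

Lemma moment_finite : exists s : seq R, forall t, moment O t -> t \in s.
Proof.
have [s1 h1] : exists s : seq R, forall t, (exists2 a, List.In a O & is_endpoint (time_dom a) t) -> t \in s.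
  move: hO; elim: O => [|a O' IH] h; first by exists [::] => t [].
  have [|s hs] := IH; first by move=> b hb; apply: h; right.
  have [s' hs'] := endpoint_finite (h a (or_introl erefl)).
  exists (s' ++ s) => t [b [<-|hb] he]; rewrite mem_cat; first by rewrite hs'.
  by apply/orP; right; apply: hs; exists b.
(* Moments are listed over all index tuples at once, regardless of the order of the indices. *)
have [s2 h2] := @finite_union _ ('I_(size O) * 'I_(size O) * (('I_3 * 'I_3) * ('I_3 * 'I_3)))%type
   (fun w => topo_boundary (meeting_times (tnth (in_tuple O) w.1.1) (tnth (in_tuple O) w.1.2) w.2.1 w.2.2))
   (fun w => tame_finite (tame_meeting w.2.1 w.2.2 (tnth_atomic w.1.1) (tnth_atomic w.1.2))).
have [s3 h3] := @finite_union _ ('I_(size O) * 'I_(size O) * 'I_(size O) * (('I_3 * 'I_3) * ('I_3 * 'I_3) * ('I_3 * 'I_3)))%type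
   (fun w => topo_boundary (concurrence_times (tnth (in_tuple O) w.1.1.1) (tnth (in_tuple O) w.1.1.2)
        (tnth (in_tuple O) w.1.2) w.2.1.1 w.2.1.2 w.2.2))
   (fun w => tame_finite (tame_concurrence w.2.1.1 w.2.1.2 w.2.2 (tnth_atomic w.1.1.1) (tnth_atomic w.1.1.2) (tnth_atomic w.1.2))).
exists (s1 ++ s2 ++ s3) => t; rewrite !mem_cat; case.
- by move=> /h1 ->.
- case=> i [j [k [l /= [_ _ _ hb]]]]; rewrite (h2 t) ?orbT //.
  by exists ((i, j), (k, l)).
- case=> i [j [h [k [l [m /= [_ _ hb]]]]]]; rewrite (h3 t) ?orbT //.
  by exists ((i, j, h), (k, l, m)).
Qed.

Lemma time_partition_exists : exists chi, time_partition O chi.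
Proof.
have [s hs] := moment_finite.
exists (sort <=%R (undup [seq t <- s | `[< moment O t >]])); split.
  by rewrite sort_lt_sorted undup_uniq.
move=> t; rewrite mem_sort mem_undup mem_filter; split; first by move=> /andP [/asboolP].
by move=> h; rewrite hs // andbT; apply/asboolP.
Qed.

End Moments.

(** * Between consecutive moments *)

Section Between.
Variables (R : realType) (K : {pred R}) (hK : constant_field K).
Implicit Types (a b : atomic R) (s t : R) (k l : 'I_3) (c d : side) (v w : vertex).
Variable O : seq (atomic R).
Hypothesis hO : geometric_object K O.
Variables x y m : R.
Hypothesis nomom : forall t, x < t < y -> ~ moment O t.
Hypothesis hm : x < m < y.

Let a0 : atomic R := Atomic [tuple 0 | k < 3] `]0, 0[ (trans_id R).
Let A := active O m.
Let ao i := nth a0 A i.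
Let F t := frame O m t.
Let inJ : set R := [set t | x < t < y].
Let idxs := [seq n <- iota 0 (size O) | m \in time_dom (nth a0 O n)].

Lemma activeE : A = [seq nth a0 O n | n <- idxs].
Proof.
by rewrite /A /active -{1}[O](mkseq_nth a0) /mkseq filter_map.
Qed.

Lemma size_idxs : size idxs = size A.
Proof. by rewrite activeE size_map. Qed.

Lemma idx_lt i : (i < size A)%N -> (nth 0 idxs i < size O)%N.
Proof.
rewrite -size_idxs => hi; have := mem_nth 0%N hi.
by rewrite mem_filter mem_iota => /andP [_].
Qed.

(** Frames number the active objects, moments number all objects of [O]; this translation between
    positions preserves the order, which matters because moments require increasing indices. *)
Definition oidx i (hi : (i < size A)%N) : 'I_(size O) := Ordinal (idx_lt hi).

Lemma tnth_oidx i (hi : (i < size A)%N) : tnth (in_tuple O) (oidx hi) = ao i.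
Proof.
by rewrite (tnth_nth a0) /= /ao activeE (nth_map 0%N) // size_idxs.
Qed.

Lemma oidx_mono i j (hi : (i < size A)%N) (hj : (j < size A)%N) :
  (i < j)%N -> (oidx hi < oidx hj)%N.
Proof.
move=> ij /=; apply: (sorted_ltn_nth ltn_trans) => //; rewrite ?inE ?size_idxs //.
by apply: sorted_filter; [exact: ltn_trans|exact: iota_ltn_sorted].
Qed.

Lemma ao_in i : (i < size A)%N -> List.In (ao i) O.
Proof. by move=> hi; rewrite -(tnth_oidx hi); apply: tnth_In. Qed.

Lemma ao_atomic i : (i < size A)%N -> atomic_object K (ao i).
Proof. by move=> hi; apply: hO; apply: ao_in. Qed.

Lemma itv_boundary_endpoint a t : atomic_object K a ->
  topo_boundary [set t | t \in time_dom a] t -> is_endpoint (time_dom a) t.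
Proof.
case=> _ [_ [bx [u [b_y [v [e _ _]]]]]] _ _ hb.
move: hb; rewrite e => /itv_boundary [] ->.
  by exists bx, (BSide b_y v); left.
by exists b_y, (BSide bx u); right.
Qed.

Lemma dom_const a s t : List.In a O -> x < s < y -> x < t < y ->
  s \in time_dom a -> t \in time_dom a.
Proof.
move=> ha hs ht h; apply: (@boundary_connected R [set t | t \in time_dom a] x y s t) => //.
move=> u hu hb; apply: (nomom hu); constructor 1; exists a => //.
by apply: itv_boundary_endpoint hb; apply: hO.
Qed.

Lemma ao_dom i s : (i < size A)%N -> x < s < y -> s \in time_dom (ao i).
Proof.
move=> hi hs; apply: (dom_const (ao_in hi) hm hs).
exact: (all_nthP a0 (filter_all (fun a => m \in time_dom a) O) i hi).
Qed.

Lemma active_eq t : x < t < y -> active O t = A.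
Proof.
move=> ht; rewrite /A /active; apply: filter_In => a ha.
by apply/idP/idP; apply: dom_const.
Qed.


Lemma size_F t : size (F t) = size A.
Proof. by rewrite size_map. Qed.

Lemma input_F t i : (i < size A)%N -> input_tri (F t) i = tri_at (ao i) t.
Proof. by move=> hi; rewrite /input_tri /F /frame (nth_map a0). Qed.

Lemma corner_F t i k : (i < size A)%N ->
  corner (input_tri (F t) i) k = trans_at (tfun (ao i)) t (corner (ref_obj (ao i)) k).
Proof. by move=> hi; rewrite input_F // corner_tri_at. Qed.

Lemma meet_const_lt i j (k l : 'I_3 * 'I_3) s t : (i < j)%N -> (j < size A)%N -> inJ s -> inJ t ->
  (exists z, carrier (input_tri (F s) i) k z /\ carrier (input_tri (F s) j) l z) ->
  exists z, carrier (input_tri (F t) i) k z /\ carrier (input_tri (F t) j) l z.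
Proof.
move=> ij hj hs ht; have hi := ltn_trans ij hj; rewrite !input_F // => h.
have : meeting_times (ao i) (ao j) k l t.
  apply: (boundary_connected _ hs ht); last by split; [exact: ao_dom|exact: ao_dom|].
  move=> u hu hb; apply: (nomom hu); constructor 2.
  exists (oidx hi), (oidx hj), k, l => a; rewrite /a !tnth_oidx.
  by split; [exact: oidx_mono|exact: ao_dom|exact: ao_dom|].
by case.
Qed.

Lemma meet_const i j (k l : 'I_3 * 'I_3) s t : i <> j -> (i < size A)%N -> (j < size A)%N ->
  inJ s -> inJ t ->
  (exists z, carrier (input_tri (F s) i) k z /\ carrier (input_tri (F s) j) l z) ->
  exists z, carrier (input_tri (F t) i) k z /\ carrier (input_tri (F t) j) l z.
Proof.
move=> ne hi hj hs ht; case: (ltngtP i j) => // ij; first exact: meet_const_lt.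
case=> z [h1 h2]; have [|w [h3 h4]] := meet_const_lt ij hi hs ht (k := l) (l := k).
  by exists z.
by exists w.
Qed.

(** Concurrence in a form symmetric in the three sides, so that they can be sorted into the
    increasing order that moments require. *)
Definition common (D : seq (tri R)) (c1 c2 c3 : side) := exists x : pt R, forall z,
  (carrier (input_tri D c1.1) c1.2 z /\ carrier (input_tri D c2.1) c2.2 z) /\
  carrier (input_tri D c3.1) c3.2 z <-> z = x.

Lemma common_perm1 (D : seq (tri R)) c1 c2 c3 : common D c1 c2 c3 -> common D c2 c1 c3.
Proof. by case=> p hp; exists p => z; rewrite -hp; tauto. Qed.

Lemma common_perm2 (D : seq (tri R)) c1 c2 c3 : common D c1 c2 c3 -> common D c1 c3 c2.
Proof. by case=> p hp; exists p => z; rewrite -hp; tauto. Qed.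

Lemma common_const_lt (c1 c2 c3 : side) s t : (c1.1 < c2.1)%N -> (c2.1 < c3.1)%N ->
  (c3.1 < size A)%N -> inJ s -> inJ t -> common (F s) c1 c2 c3 -> common (F t) c1 c2 c3.
Proof.
move=> ij jh hh hs ht; have hj := ltn_trans jh hh; have hi := ltn_trans ij hj.
rewrite /common !input_F // => h.
have : concurrence_times (ao c1.1) (ao c2.1) (ao c3.1) c1.2 c2.2 c3.2 t.
  apply: (boundary_connected _ hs ht); last first.
    by split; [exact: ao_dom|exact: ao_dom|exact: ao_dom|exact/concurrence_concurrent].
  move=> u hu hb; apply: (nomom hu); constructor 3.
  exists (oidx hi), (oidx hj), (oidx hh), c1.2, c2.2, c3.2 => a; rewrite /a !tnth_oidx; split => //.
    by apply/andP; split; apply: oidx_mono.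
  by split; apply: ao_dom.
by case=> _ _ _ /concurrence_concurrent.
Qed.

Lemma common_const (c1 c2 c3 : side) s t : c1.1 <> c2.1 -> c1.1 <> c3.1 -> c2.1 <> c3.1 ->
  (c1.1 < size A)%N -> (c2.1 < size A)%N -> (c3.1 < size A)%N ->
  inJ s -> inJ t -> common (F s) c1 c2 c3 -> common (F t) c1 c2 c3.
Proof.
move=> n12 n13 n23 h1 h2 h3 hs ht h.
case: (ltngtP c1.1 c2.1) => // l12; case: (ltngtP c1.1 c3.1) => // l13;
  case: (ltngtP c2.1 c3.1) => // l23.
- exact: common_const_lt h.
- apply: common_perm2; apply: (common_const_lt l13 l23 h2 hs ht); exact: common_perm2.
- by have := ltn_trans l23 l13; rewrite ltnNge (ltnW l12).
- apply: common_perm2; apply: common_perm1; apply: (common_const_lt l13 l12 h2 hs ht).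
  by apply: common_perm1; apply: common_perm2.
- apply: common_perm1; apply: (common_const_lt l12 l13 h3 hs ht); exact: common_perm1.
- by have := ltn_trans l23 l12; have := ltn_trans l13 l23 => _; rewrite ltnNge (ltnW l13).
- apply: common_perm1; apply: common_perm2; apply: (common_const_lt l23 l13 h1 hs ht).
  by apply: common_perm2; apply: common_perm1.
- apply: common_perm1; apply: common_perm2; apply: common_perm1.
  apply: (common_const_lt l23 l12 h1 hs ht).
  by apply: common_perm1; apply: common_perm2; apply: common_perm1.
Qed.

Lemma carrier_line (D : seq (tri R)) c z : is_side D c ->
  carrier (input_tri D c.1) c.2 z <-> line_side D c z = 0.
Proof. by move=> h; apply: (lineP _ _ (dir_neq0 h)). Qed.

Lemma carrier_point (D : seq (tri R)) i k z :
  carrier (input_tri D i) (k, k) z <-> z = corner (input_tri D i) k.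
Proof.
have := @line0 R (corner (input_tri D i) k) z.
by rewrite -(subrr (corner (input_tri D i) k)).
Qed.

Let det_at i t := \det (lin_at (tfun (ao i)) t).

Lemma det_neq0 i t : (i < size A)%N -> inJ t -> det_at i t != 0.
Proof. by move=> hi ht; have [_ _ _ hd] := ao_atomic hi; have [] := hd t (ao_dom hi ht). Qed.

Lemma det2 (M : 'M[R]_2) : \det M = M ord0 ord0 * M ord_max ord_max - M ord0 ord_max * M ord_max ord0.
Proof.
have e : lift ord0 ord0 = ord_max :> 'I_2 by apply: val_inj.
have e' : lift ord_max ord0 = ord0 :> 'I_2 by apply: val_inj.
rewrite (expand_det_row _ ord0) !big_ord_recl big_ord0 addr0 e /cofactor !det_mx11 !mxE /=.
by rewrite !e !e' /= /bump /= !expr0 !expr1 mul1r mulN1r mulrN.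
Qed.

(** Cross products within one object are time-independent up to the nonvanishing determinant. This
    settles all incidences between sides of the same object, for which the partition has no
    moments. *)
Lemma cross_trans i t (p q p' q' : pt R) :
  cross (trans_at (tfun (ao i)) t p - trans_at (tfun (ao i)) t q)
        (trans_at (tfun (ao i)) t p' - trans_at (tfun (ao i)) t q') =
  det_at i t * cross (p - q) (p' - q').
Proof. by rewrite !trans_atE /det_at det2 /cross !ptE; ring. Qed.

Lemma trans_inj i t (p q : pt R) : (i < size A)%N -> inJ t ->
  trans_at (tfun (ao i)) t p = trans_at (tfun (ao i)) t q -> p = q.
Proof.
move=> hi ht e; have d0 := det_neq0 hi ht.
have H (u : pt R) : cross (p - q) u = 0.
  apply: (mulfI d0); rewrite mulr0 -[u]subr0 -cross_trans e subrr /cross !ptE; ring.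
have := H (mkpt 0 1); have := H (mkpt 1 0); rewrite /cross !ptE => h1 h2.
by apply: ptP; lra.
Qed.

Lemma F_corner_const i k l s t : (i < size A)%N -> inJ s -> inJ t ->
  corner (input_tri (F s) i) k = corner (input_tri (F s) i) l ->
  corner (input_tri (F t) i) k = corner (input_tri (F t) i) l.
Proof. by move=> hi hs ht; rewrite !corner_F // => /(trans_inj hi hs) ->. Qed.

Lemma F_side s t c : inJ s -> inJ t -> is_side (F s) c -> is_side (F t) c.
Proof.
move=> hs ht [hc h]; rewrite size_F in hc; split; first by rewrite size_F.
by move=> /(F_corner_const hc ht hs).
Qed.

Lemma side_lt s c : is_side (F s) c -> (c.1 < size A)%N.
Proof. by case; rewrite size_F. Qed.

Let D0 := [seq ref_obj a | a <- A].

Lemma input_D0 i : (i < size A)%N -> input_tri D0 i = ref_obj (ao i).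
Proof. by move=> hi; rewrite /input_tri (nth_map a0). Qed.

Lemma cross_same c d t : c.1 = d.1 -> (c.1 < size A)%N ->
  cross (dir (F t) c) (dir (F t) d) = det_at c.1 t * cross (dir D0 c) (dir D0 d).
Proof.
move=> e hc; rewrite /dir /src /tgt -!e !corner_F // !input_D0 //.
exact: cross_trans.
Qed.

Lemma line_same c k t : (c.1 < size A)%N ->
  line_side (F t) c (corner (input_tri (F t) c.1) k) =
  det_at c.1 t * line_side D0 c (corner (input_tri D0 c.1) k).
Proof.
move=> hc; rewrite /line_side /dir /src /tgt !corner_F // !input_D0 //.
exact: cross_trans.
Qed.

(** For a corner of another object this is the meeting of the carrier of [c] with the degenerate
    carrier [(k, k)]; for a corner of the same object the determinant factors out. *)
Lemma line_corner_const c i k s t : is_side (F s) c -> (i < size A)%N -> inJ s -> inJ t ->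
  line_side (F s) c (corner (input_tri (F s) i) k) = 0 ->
  line_side (F t) c (corner (input_tri (F t) i) k) = 0.
Proof.
move=> hc hi hs ht; have hc' := F_side hs ht hc; have lc := side_lt hc.
have [e|ne] := eqVneq c.1 i.
  rewrite -e !line_same // => /eqP; rewrite mulf_eq0 (negPf (det_neq0 lc hs)) => /eqP ->.
  by rewrite mulr0.
move=> h; have [|z] := @meet_const c.1 i c.2 (k, k) s t (elimN eqP ne) lc hi hs ht.
  by exists (corner (input_tri (F s) i) k); split; [exact/carrier_line|exact/carrier_point].
by case=> /(carrier_line _ hc') + /carrier_point <-.
Qed.

(** Suppose the sides are parallel at [s] but transverse at [t]. Their lines meet at [t], hence also
    at [s], where they must coincide; so both corners of [d] are on the line of [c] at [s], and then
    also at [t], contradicting transversality. *)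
Lemma cross_const c d s t : is_side (F s) c -> is_side (F s) d -> inJ s -> inJ t ->
  cross (dir (F s) c) (dir (F s) d) = 0 -> cross (dir (F t) c) (dir (F t) d) = 0.
Proof.
move=> hc hd hs ht; have hc' := F_side hs ht hc; have hd' := F_side hs ht hd.
have lc := side_lt hc; have ld := side_lt hd.
have [e|ne] := eqVneq c.1 d.1.
  rewrite !cross_same // => /eqP; rewrite mulf_eq0 (negPf (det_neq0 lc hs)) => /eqP ->.
  by rewrite mulr0.
move=> h; apply: contrapT => /eqP h'; have [m1 m2] := meet_on h'.
have [|z [z1 z2]] := @meet_const c.1 d.1 c.2 d.2 t s (elimN eqP ne) lc ld ht hs.
  by exists (eval_vertex (F t) (Meet c d)); split; apply/carrier_line.
move/(carrier_line _ hc): z1 => z1; move/(carrier_line _ hd): z2 => z2.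
have on j : j = d.2.1 \/ j = d.2.2 -> line_side (F t) c (corner (input_tri (F t) d.1) j) = 0.
  move=> hj; apply: (line_corner_const hc ld hs ht).
  apply: (parallel_line hc hd h z1 z2).
  by case: hj => ->; [exact: line_side_src|exact: line_side_tgt].
move/eqP: h'; apply.
have -> : cross (dir (F t) c) (dir (F t) d) =
    line_side (F t) c (tgt (F t) d) - line_side (F t) c (src (F t) d).
  by rewrite /line_side /dir /cross !ptE; ring.
by rewrite (on d.2.1) ?(on d.2.2) ?subrr; [| right|left].
Qed.

Lemma F_valid s t v : inJ s -> inJ t -> valid (F s) v -> valid (F t) v.
Proof.
move=> hs ht; case: v => [i k|c d] /=; first by rewrite !size_F.
case=> hc hd h; have hc' := F_side hs ht hc; have hd' := F_side hs ht hd; split => //.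
by apply: contraNneq h => /(cross_const hc' hd' ht hs) ->.
Qed.

Lemma ratpt_F_corner i k : (i < size A)%N -> ratpt K inJ (fun t => corner (input_tri (F t) i) k).
Proof.
move=> hi; apply: (@ratpt_ext _ _ _ (fun t => corner (tri_at (ao i) t) k)).
  by move=> t _; rewrite input_F.
by apply: ratpt_corner (ao_atomic hi) _ => // t; apply: ao_dom.
Qed.

Lemma ratpt_src c : (c.1 < size A)%N -> ratpt K inJ (fun t => src (F t) c).
Proof. exact: ratpt_F_corner. Qed.

Lemma ratpt_dir c : (c.1 < size A)%N -> ratpt K inJ (fun t => dir (F t) c).
Proof. by move=> hc; apply: ratpt_sub => //; apply: ratpt_F_corner. Qed.

Lemma ratpt_vertex v : valid (F m) v -> ratpt K inJ (fun t => eval_vertex (F t) v).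
Proof.
case: v => [i k|c d] hv; first by apply: ratpt_F_corner; move: hv; rewrite /= size_F.
case: (hv) => /side_lt lc /side_lt ld _.
apply: ratpt_add => //; first exact: ratpt_src.
apply: ratpt_scale => //; last exact: ratpt_dir.
apply: ratl_div => //.
- apply: ratl_cross => //; last exact: ratpt_dir.
  by apply: ratpt_sub => //; apply: ratpt_src.
- by apply: ratl_cross => //; apply: ratpt_dir.
- by move=> t ht; have [] := F_valid hm ht hv.
Qed.

Lemma ratl_line v c : valid (F m) v -> (c.1 < size A)%N ->
  ratl K inJ (fun t => line_side (F t) c (eval_vertex (F t) v)).
Proof.
move=> hv hc; apply: ratl_cross => //; first exact: ratpt_dir.
by apply: ratpt_sub => //; [exact: ratpt_vertex|exact: ratpt_src].
Qed.

Lemma share_corner (p q : 'I_3 * 'I_3) : p.1 <> p.2 -> q.1 <> q.2 ->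
  exists k, (k = p.1 \/ k = p.2) /\ (k = q.1 \/ k = q.2).
Proof.
case: p q => [a b] [c d] /= ab cd.
have [|ac] := eqVneq a c; first by exists a; auto.
have [|ad] := eqVneq a d; first by exists a; auto.
exists b; split; first by right.
case: (eqVneq b c) => [|bc]; first by left.
case: (eqVneq b d) => [|bd]; first by right.
have : uniq [:: a; b; c; d].
  by rewrite /= !inE !negb_or ac ad bc bd (introN eqP ab) (introN eqP cd).
(* Two disjoint pairs of distinct corners would need four corners. *)
by move=> /card_uniqP /= h; have := max_card (mem [:: a; b; c; d]); rewrite h card_ord.
Qed.

Lemma on_own_corner c k t : k = c.2.1 \/ k = c.2.2 ->
  line_side (F t) c (corner (input_tri (F t) c.1) k) = 0.
Proof. by case=> ->; [exact: line_side_src|exact: line_side_tgt]. Qed.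

Lemma same_object c d s : c.1 = d.1 -> is_side (F s) c -> is_side (F s) d ->
  exists k, forall t, inJ t -> line_side (F t) c (corner (input_tri (F t) c.1) k) = 0 /\
    line_side (F t) d (corner (input_tri (F t) c.1) k) = 0.
Proof.
move=> e hc hd; have [||k [k1 k2]] := @share_corner c.2 d.2.
- by move=> h; case: hc => _; rewrite /src /tgt h.
- by move=> h; case: hd => _; rewrite /src /tgt h.
exists k => t ht; split; first exact: on_own_corner.
by rewrite e; apply: on_own_corner.
Qed.

(** For sides of three distinct objects this is the constancy of concurrence. Two sides of the same
    object share a corner at all times: if they are transverse, the point in question is that corner
    and [line_corner_const] applies; if they are parallel, their lines coincide. *)
Lemma meet_line_const c1 c2 c3 s t : valid (F s) (Meet c1 c2) -> is_side (F s) c3 ->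
  inJ s -> inJ t ->
  line_side (F s) c3 (eval_vertex (F s) (Meet c1 c2)) = 0 ->
  line_side (F t) c3 (eval_vertex (F t) (Meet c1 c2)) = 0.
Proof.
move=> hv h3 hs ht; have hv' := F_valid hs ht hv; have h3' := F_side hs ht h3.
case: (hv) => h1 h2 n12; case: (hv') => h1' h2' n12'.
have [a1 a2] := meet_on n12; have [b1 b2] := meet_on n12'.
set p := eval_vertex (F s) _ in a1 a2 *; set q := eval_vertex (F t) _ in b1 b2 *.
have l1 := side_lt h1; have l2 := side_lt h2; have l3 := side_lt h3.
have [e12|ne12] := eqVneq c1.1 c2.1.
  have [k hk] := same_object e12 h1 h2.
  have [k1 k2] := hk s hs; have [k1' k2'] := hk t ht.
  rewrite /p /q -(meet_unique n12 k1 k2) -(meet_unique n12' k1' k2').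
  exact: line_corner_const.
have P13 : (cross (dir (F s) c1) (dir (F s) c3) = 0) <-> (cross (dir (F t) c1) (dir (F t) c3) = 0).
  by split; apply: cross_const.
have P23 : (cross (dir (F s) c2) (dir (F s) c3) = 0) <-> (cross (dir (F t) c2) (dir (F t) c3) = 0).
  by split; apply: cross_const.
have [e13|ne13] := eqVneq c1.1 c3.1.
  have [k hk] := same_object e13 h1 h3.
  have [k1 k3] := hk s hs; have [k1' k3'] := hk t ht => hp.
  case: (eqVneq (cross (dir (F s) c1) (dir (F s) c3)) 0) => [par|npar].
    have par' : cross (dir (F t) c3) (dir (F t) c1) = 0.
      by rewrite crossC (proj1 P13 par) oppr0.
    exact: (parallel_line h3' h1' par' k3' k1' b1).
  have npar' : cross (dir (F t) c1) (dir (F t) c3) != 0.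
    by apply: contraNneq npar => /(proj2 P13) ->.
  have ep : corner (input_tri (F s) c1.1) k = p.
    by rewrite (meet_unique npar k1 k3) -(meet_unique npar a1 hp).
  rewrite -ep in a2; have := line_corner_const h2 l1 hs ht a2 => a2'.
  by rewrite /q -(meet_unique n12' k1' a2').
have [e23|ne23] := eqVneq c2.1 c3.1.
  have [k hk] := same_object e23 h2 h3.
  have [k2 k3] := hk s hs; have [k2' k3'] := hk t ht => hp.
  case: (eqVneq (cross (dir (F s) c2) (dir (F s) c3)) 0) => [par|npar].
    have par' : cross (dir (F t) c3) (dir (F t) c2) = 0.
      by rewrite crossC (proj1 P23 par) oppr0.
    exact: (parallel_line h3' h2' par' k3' k2' b2).
  have npar' : cross (dir (F t) c2) (dir (F t) c3) != 0.
    by apply: contraNneq npar => /(proj2 P23) ->.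
  have ep : corner (input_tri (F s) c2.1) k = p.
    by rewrite (meet_unique npar k2 k3) -(meet_unique npar a2 hp).
  rewrite -ep in a1; have := line_corner_const h1 l2 hs ht a1 => a1'.
  by rewrite /q -(meet_unique n12' a1' k2').
move=> hp; have : common (F s) c1 c2 c3.
  exists p => z; rewrite !carrier_line //; split=> [[[z1 z2] _]|-> //].
  exact: meet_unique.
move=> /(common_const (elimN eqP ne12) (elimN eqP ne13) (elimN eqP ne23) l1 l2 l3 hs ht).
case=> z hz; have := proj2 (hz z) erefl; rewrite !carrier_line // => -[[z1 z2] z3].
by rewrite /q -(meet_unique n12' z1 z2).
Qed.

Lemma line_const v c s t : valid (F s) v -> is_side (F s) c -> inJ s -> inJ t ->
  line_side (F s) c (eval_vertex (F s) v) = 0 -> line_side (F t) c (eval_vertex (F t) v) = 0.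
Proof.
case: v => [i k|c1 c2] hv hc hs ht; last exact: meet_line_const.
by apply: line_corner_const => //; move: hv; rewrite /= size_F.
Qed.

(** An intersection point is determined by lying on its two lines, so [line_const] applies; two
    corners of distinct objects coincide when their degenerate carriers meet. *)
Lemma vertex_const v w s t : valid (F s) v -> valid (F s) w -> inJ s -> inJ t ->
  eval_vertex (F s) v = eval_vertex (F s) w -> eval_vertex (F t) v = eval_vertex (F t) w.
Proof.
move=> hv hw hs ht.
have M c d u : valid (F s) (Meet c d) -> valid (F s) u ->
    eval_vertex (F s) u = eval_vertex (F s) (Meet c d) ->
    eval_vertex (F t) u = eval_vertex (F t) (Meet c d).
  move=> hm' hu e; have hmt := F_valid hs ht hm'.
  case: (hm') => hc hd h; case: (hmt) => _ _ h'; have [m1 m2] := meet_on h.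
  by apply: meet_unique => //; apply: (line_const hu _ hs ht) => //; rewrite e.
case: w hw => [j l|c d] hw; last exact: M.
case: v hv => [i k|c d] hv; last by move=> e; symmetry; apply: M.
move: hv hw; rewrite /= !size_F => hi hj.
have [<-|ne] := eqVneq i j; first exact: F_corner_const.
move=> e; have [|z [z1 z2]] := @meet_const i j (k, k) (l, l) s t (elimN eqP ne) hi hj hs ht.
  by exists (corner (input_tri (F s) i) k); split; apply/carrier_point.
by move/carrier_point: z1 => <-; move/carrier_point: z2.
Qed.

Lemma F_equi t : inJ t -> equi (F m) (F t).
Proof.
move=> ht; have J u : x < u < y -> inJ u by [].
split.
- by rewrite !size_F.
- by move=> i k l; rewrite size_F => hi; split; apply: F_corner_const.
- move=> c d hc hd; split; first exact: cross_const.
  by apply: cross_const => //; apply: (F_side hm ht).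
- move=> v c hv hc; have lc := side_lt hc.
  apply: (ratl_sign (ratl_line hv lc) J) => // u w hu hw.
  by apply: line_const => //; [exact: F_valid hm hu hv|exact: F_side hm hu hc].
- move=> v w c hv hw hc z1 z2; have lc := side_lt hc.
  have Z u : inJ u -> [/\ line_side (F u) c (eval_vertex (F u) v) = 0,
      line_side (F u) c (eval_vertex (F u) w) = 0, is_side (F u) c,
      valid (F u) v & valid (F u) w].
    by move=> hu; split; [exact: line_const z1|exact: line_const z2|exact: F_side hc|exact: F_valid hv|exact: F_valid hw].
  have rd : ratl K inJ (fun u => dot (dir (F u) c) (eval_vertex (F u) v - eval_vertex (F u) w)).
    by apply: ratl_dot => //; [exact: ratpt_dir|apply: ratpt_sub => //; exact: ratpt_vertex].
  apply: (ratl_sign rd J) => // u u' hu hu' h0.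
  have [v1 w1 s1 vv vw] := Z u hu.
  (* On the line of [c], a vanishing scalar product means that the two points coincide, and
     coincidence is already known to be constant. *)
  suff e : eval_vertex (F u) v = eval_vertex (F u) w.
    by rewrite (vertex_const vv vw hu hu' e) subrr /dot !ptE; ring.
  have d0 := dir_neq0 s1; have := cross_lines v1 w1.
  move=> /(parallel_scale d0) [r er]; move: h0; rewrite er.
  have -> : dot (dir (F u) c) (r *: dir (F u) c) = r * (px (dir (F u) c) * px (dir (F u) c) + py (dir (F u) c) * py (dir (F u) c)).
    by rewrite /dot !ptE; ring.
  move/eqP; rewrite mulf_eq0 (gt_eqF (norm2_gt0 d0)) orbF => /eqP r0.
  by apply/eqP; rewrite -subr_eq0 er r0 scale0r.
- by move=> v w hv hw; split; apply: vertex_const => //; exact: F_valid hm ht _.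
Qed.

End Between.

(** * Moving triangles *)

Section Snapshots.
Variable R : realType.
Implicit Types (a : atomic R) (t : R) (O : seq (atomic R)).

Lemma trans_at_comb3 (f : trans R) t (r1 r2 r3 : R) (p q u : pt R) : r1 + r2 + r3 = 1 ->
  trans_at f t (comb3 r1 r2 r3 p q u) = comb3 r1 r2 r3 (trans_at f t p) (trans_at f t q) (trans_at f t u).
Proof.
move=> h; have -> : r3 = 1 - r1 - r2 by lra.
by rewrite !trans_atE; apply: ptP; rewrite /comb3 !ptE; ring.
Qed.

Lemma tri_at_set a t : tri_set (tri_at a t) = trans_at (tfun a) t @` tri_set (ref_obj a).
Proof.
apply/seteqP; split=> x.
  move=> /tri_setP [r1 [r2 [r3 [h1 h2 h3 h ->]]]]; rewrite !corner_tri_at -trans_at_comb3 //.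
  exists (comb3 r1 r2 r3 (corner (ref_obj a) k0) (corner (ref_obj a) k1) (corner (ref_obj a) k2)) => //.
  by apply/tri_setP; exists r1, r2, r3.
case=> y /tri_setP [r1 [r2 [r3 [h1 h2 h3 h ->]]]] <-; rewrite trans_at_comb3 //.
by apply/tri_setP; exists r1, r2, r3; rewrite !corner_tri_at.
Qed.

Lemma frame_mem O m t T : T \in frame O m t <->
  exists2 a, List.In a O /\ m \in time_dom a & T = tri_at a t.
Proof.
have E a := In_filter (fun a => m \in time_dom a) O a.
by rewrite mem_map_In; split=> -[a ha ->]; exists a => //; apply/E.
Qed.

Lemma covered_frame O t : covered (frame O t t) = snapshot O t.
Proof.
apply/seteqP; split=> x.
  by case=> T /frame_mem [a [h1 h2] ->]; rewrite tri_at_set => hx; exists a.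
case=> a h1 [h2]; rewrite -tri_at_set => hx; exists (tri_at a t) => //.
by apply/frame_mem; exists a.
Qed.

End Snapshots.

(** * Transformation functions for the moving triangles *)

Section Moving.
Variables (R : realType) (K : {pred R}) (hK : constant_field K).
Implicit Types (s t x y : R) (J : set R).

Let Kf := const_field hK.

Lemma ratfun_of J f : ratl K J f -> exists r : ratfun R, rf_over K r /\
  forall t, J t -> rf_defined t r /\ rf_val t r = f t.
Proof.
case=> n [d [hn hd h]]; exists (n, d); split; first by rewrite /rf_over hn hd.
by move=> t /h [h1 ->].
Qed.

Lemma I2_cases (i : 'I_2) : i = ord0 \/ i = ord_max.
Proof.
by case: i => [[|[|//]] hi]; [left|right]; apply: val_inj.
Qed.

(** With [u] and [v] the edge vectors at [q0], the matrix is the one with columns [u t], [v t] times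
    the inverse of the one with columns [u m], [v m]. Its entries have the constant denominator
    [de], and its determinant is [cross (u t) (v t) / de]. *)
Lemma moving_affinity J (q0 q1 q2 : R -> pt R) m : ratpt K J q0 -> ratpt K J q1 ->
  ratpt K J q2 -> m \in K -> J m ->
  (forall t, J t -> cross (q1 t - q0 t) (q2 t - q0 t) != 0) ->
  exists f : trans R, [/\ trans_over K f, forall t, J t -> trans_defined f t &
    forall t, J t -> [/\ trans_at f t (q0 m) = q0 t, trans_at f t (q1 m) = q1 t
      & trans_at f t (q2 m) = q2 t]].
Proof.
move=> r0 r1 r2 mK Jm nf.
have ru := ratpt_sub hK r1 r0; have rv := ratpt_sub hK r2 r0.
pose u t : pt R := q1 t - q0 t; pose v t : pt R := q2 t - q0 t.
pose de := cross (u m) (v m).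
have de0 : de != 0 by apply: nf.
have C f : ratl K J f -> f m \in K by move=> h; apply: (ratl_val hK h Jm mK).
have [[ux uy] [vx vy]] := (ru, rv).
have cux := ratl_const hK J (C _ ux); have cuy := ratl_const hK J (C _ uy).
have cvx := ratl_const hK J (C _ vx); have cvy := ratl_const hK J (C _ vy).
have cde := ratl_const hK J (C _ (ratl_cross hK ru rv)).
have M f g c d : ratl K J f -> ratl K J g -> c \in K -> d \in K ->
    ratl K J (fun t => (f t * c - g t * d) / de).
  move=> hf hg hc hd; apply: ratl_div => //.
  by apply: ratl_sub2 => //; apply: ratl_mul => //; apply: ratl_const.
have a00 := M _ _ _ _ ux vx (C _ vy) (C _ uy); have a01 := M _ _ _ _ vx ux (C _ ux) (C _ vx).
have a10 := M _ _ _ _ uy vy (C _ vy) (C _ uy); have a11 := M _ _ _ _ vy uy (C _ ux) (C _ vx).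
have [x0 y0] := r0.
have S f g h : ratl K J f -> ratl K J g -> ratl K J h ->
    ratl K J (fun t => h t - (f t * px (q0 m) + g t * py (q0 m))).
  move=> hf hg hh; apply: ratl_sub2 => //; apply: ratl_add => //; apply: ratl_mul => //;
  apply: ratl_const => //; [exact: (C _ x0)|exact: (C _ y0)].
have [f00 [o00 e00]] := ratfun_of a00; have [f01 [o01 e01]] := ratfun_of a01.
have [f10 [o10 e10]] := ratfun_of a10; have [f11 [o11 e11]] := ratfun_of a11.
have [g0 [p0 s0]] := ratfun_of (S _ _ _ a00 a01 x0).
have [g1 [p1 s1]] := ratfun_of (S _ _ _ a10 a11 y0).
pose f : trans R := Trans (\matrix_(i, j) (if i == ord0 then if j == ord0 then f00 else f01
  else if j == ord0 then f10 else f11)) (\matrix_(i, j) (if i == ord0 then g0 else g1)).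
have n01 : (ord_max == ord0 :> 'I_2) = false by [].
have L t : J t ->
   [/\ lin_at f t ord0 ord0 = (px (u t) * py (v m) - px (v t) * py (u m)) / de,
    lin_at f t ord0 ord_max = (px (v t) * px (u m) - px (u t) * px (v m)) / de,
    lin_at f t ord_max ord0 = (py (u t) * py (v m) - py (v t) * py (u m)) / de
  & lin_at f t ord_max ord_max = (py (v t) * px (u m) - py (u t) * px (v m)) / de].
  move=> Jt; split; rewrite !mxE ?n01 ?eqxx.
  - exact: (e00 t Jt).2.
  - exact: (e01 t Jt).2.
  - exact: (e10 t Jt).2.
  - exact: (e11 t Jt).2.
have hde : de = px (u m) * py (v m) - py (u m) * px (v m) by [].
exists f; split.
- split=> i; last by rewrite mxE; case: ifP.
  by move=> j; rewrite mxE; case: ifP => _; case: ifP.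
- move=> t Jt; split.
  + move=> i j; rewrite mxE; case: ifP => _; case: ifP => _;
    [exact: (e00 t Jt).1|exact: (e01 t Jt).1|exact: (e10 t Jt).1|exact: (e11 t Jt).1].
  + by move=> i; rewrite mxE; case: ifP => _; [exact: (s0 t Jt).1|exact: (s1 t Jt).1].
  + have [l0 l1 l2 l3] := L t Jt; rewrite det2 l0 l1 l2 l3.
    have -> : (px (u t) * py (v m) - px (v t) * py (u m)) / de *
      ((py (v t) * px (u m) - py (u t) * px (v m)) / de) -
      (px (v t) * px (u m) - px (u t) * px (v m)) / de *
      ((py (u t) * py (v m) - py (v t) * py (u m)) / de) =
      cross (u t) (v t) * (px (u m) * py (v m) - py (u m) * px (v m)) / de ^+ 2.
      by rewrite /cross; field.
    rewrite -hde mulf_neq0 ?invr_eq0 ?expf_neq0 // mulf_neq0 //; exact: nf.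
- move=> t Jt; have [l0 l1 l2 l3] := L t Jt.
  have b0 : shift_at f t ord0 ord0 = px (q0 t) - (lin_at f t ord0 ord0 * px (q0 m) + lin_at f t ord0 ord_max * py (q0 m)).
    by rewrite l0 l1 !mxE /=; exact: (s0 t Jt).2.
  have b1 : shift_at f t ord_max ord0 = py (q0 t) - (lin_at f t ord_max ord0 * px (q0 m) + lin_at f t ord_max ord_max * py (q0 m)).
    by rewrite l2 l3 !mxE /=; exact: (s1 t Jt).2.
  have T (z w : pt R) (c d : R) : z - q0 m = c *: u m + d *: v m ->
      w - q0 t = c *: u t + d *: v t -> trans_at f t z = w.
    move=> hz hw; rewrite trans_atE b0 b1 l0 l1 l2 l3.
    have zx := congr1 (@px R) hz; have zy := congr1 (@py R) hz.
    have wx := congr1 (@px R) hw; have wy := congr1 (@py R) hw.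
    rewrite !ptE in zx zy wx wy.
    have {}zx : px z = px (q0 m) + (c * px (u m) + d * px (v m)) by rewrite -[px (u m)]/(px (q1 m - q0 m)) -[px (v m)]/(px (q2 m - q0 m)) !ptE; lra.
    have {}zy : py z = py (q0 m) + (c * py (u m) + d * py (v m)) by rewrite -[py (u m)]/(py (q1 m - q0 m)) -[py (v m)]/(py (q2 m - q0 m)) !ptE; lra.
    have {}wx : px w = px (q0 t) + (c * px (u t) + d * px (v t)) by rewrite -[px (u t)]/(px (q1 t - q0 t)) -[px (v t)]/(px (q2 t - q0 t)) !ptE; lra.
    have {}wy : py w = py (q0 t) + (c * py (u t) + d * py (v t)) by rewrite -[py (u t)]/(py (q1 t - q0 t)) -[py (v t)]/(py (q2 t - q0 t)) !ptE; lra.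
    move: de0; rewrite hde => hd0.
    by apply: ptP; rewrite ?px_mkpt ?py_mkpt zx zy ?wx ?wy; field.
  split.
  + by apply: (T _ _ 0 0); apply: ptP; rewrite !ptE; ring.
  + by apply: (T _ _ 1 0); apply: ptP; rewrite /u /v !ptE; ring.
  + by apply: (T _ _ 0 1); apply: ptP; rewrite /u /v !ptE; ring.
Qed.

Definition over_pt (p : pt R) := forall i, p i ord0 \in K.

Lemma over_ptP p : over_pt p <-> px p \in K /\ py p \in K.
Proof.
split; first by move=> h; split; apply: h.
by case=> h1 h2 i; case: (I2_cases i) => ->.
Qed.

Lemma KD x y : x \in K -> y \in K -> x + y \in K.
Proof. by move=> hx hy; have : x + y \in Kf by apply: rpredD. Qed.
Lemma KB x y : x \in K -> y \in K -> x - y \in K.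
Proof. by move=> hx hy; have : x - y \in Kf by apply: rpredB. Qed.
Lemma KM x y : x \in K -> y \in K -> x * y \in K.
Proof. by move=> hx hy; have : x * y \in Kf by apply: rpredM. Qed.
Lemma K_nat n : n%:R \in K.
Proof. by have : n%:R \in Kf by apply: rpred_nat. Qed.
Lemma K_inv x : x \in K -> x^-1 \in K.
Proof. by move=> hx; have : x^-1 \in Kf by rewrite rpredV. Qed.

Lemma over_add p q : over_pt p -> over_pt q -> over_pt (p + q).
Proof. by move=> h1 h2 i; rewrite mxE; apply: KD. Qed.
Lemma over_sub p q : over_pt p -> over_pt q -> over_pt (p - q).
Proof. by move=> h1 h2 i; rewrite !mxE; apply: KB. Qed.
Lemma over_scale c p : c \in K -> over_pt p -> over_pt (c *: p).
Proof. by move=> h1 h2 i; rewrite mxE; apply: KM. Qed.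
Lemma over_cross p q : over_pt p -> over_pt q -> cross p q \in K.
Proof. by move=> h1 h2; apply: KB; apply: KM; (apply: h1 || apply: h2). Qed.

Section Eval.
Variable D : seq (tri R).
Hypothesis hD : forall i k, over_pt (corner (input_tri D i) k).

Lemma over_vertex v : over_pt (eval_vertex D v).
Proof.
case: v => [i k|c d] //=; apply: over_add; first exact: hD.
by apply: over_scale; [apply: K_div => //; apply: over_cross|]; do ?apply: over_sub; apply: hD.
Qed.

Lemma over_point e : over_pt (eval_point D e).
Proof.
case: e => [v|s] /=; first exact: over_vertex.
apply: over_scale; first by apply: K_inv; apply: K_nat.
elim: s => [|v s IH]; first by rewrite big_nil => i; rewrite mxE; apply: K0.
by rewrite big_cons; apply: over_add => //; apply: over_vertex.
Qed.

Lemma over_tri e k : over_pt (corner (eval_tri D e) k).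
Proof. by rewrite eval_triE; case: (I3_cases k) => ->; rewrite mktriE; apply: over_point. Qed.

End Eval.

Lemma over_frame O m : geometric_object K O -> m \in K ->
  forall i k, over_pt (corner (input_tri (frame O m m) i) k).
Proof.
move=> hO mK i k; case: (ltnP i (size (frame O m m))) => hi; last first.
  by rewrite /input_tri nth_default // => j; rewrite /corner tnth_mktuple mxE; apply: K0.
have /frame_mem [a [ha hm] ->] : input_tri (frame O m m) i \in frame O m m by apply: mem_nth.
have [h1 h2] := ratpt_corner hK k (hO _ ha) (@subset_refl _ _).
apply/over_ptP; split; first exact: (ratl_val hK h1 hm mK).
exact: (ratl_val hK h2 hm mK).
Qed.

Lemma trans_id_lin t : lin_at (trans_id R) t = 1%:M.
Proof. by apply/matrixP => i j; rewrite !mxE /rf_val /= !hornerE divr1. Qed.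

Lemma trans_id_at t (x : pt R) : trans_at (trans_id R) t x = x.
Proof.
rewrite /trans_at trans_id_lin mul1mx (_ : shift_at _ _ = 0) ?addr0 //.
by apply/matrixP => i j; rewrite !mxE /rf_val /= !hornerE ?mul0r.
Qed.

Lemma trans_id_defined t : trans_defined (trans_id R) t.
Proof.
split; rewrite ?trans_id_lin ?det1 ?oner_neq0 // => i; try move=> j;
by rewrite mxE /rf_defined /= !hornerE oner_neq0.
Qed.

Lemma trans_id_over : trans_over K (trans_id R).
Proof.
split=> i; try move=> j; rewrite mxE /rf_over /= polyK1 // andbT.
  by apply: polyKC => //; apply: K_nat.
exact: polyOver0.
Qed.

Lemma moment_exists O t : exists G, triangulate_moment O t G.
Proof.
have [L hL] := TS_exists (frame O t t).
by exists [seq Atomic (eval_tri (frame O t t) e) `[t, t] (trans_id R) | e <- L]; exists L.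
Qed.

Variable O : seq (atomic R).
Hypothesis hO : geometric_object K O.
Variables x y : R.
Hypothesis nomom : forall t, x < t < y -> ~ moment O t.
Hypotheses (xy : x < y) (xK : x \in K) (yK : y \in K).
Let m := (x + y) / 2.
Let inJ : set R := [set t | x < t < y].
Let F t := frame O m t.

Lemma mid_in : x < m < y.
Proof. by move: xy; rewrite /m => h; apply/andP; split; lra. Qed.
Lemma mid_K : m \in K. Proof. by apply: K_div => //; [apply: KD|apply: K_nat]. Qed.

Lemma interval_equi t : inJ t -> equi (F m) (F t).
Proof. exact: (F_equi hK hO nomom mid_in). Qed.

Lemma ratpt_point e : (match e with Vertex v => valid (F m) v
   | Centroid s => forall v, List.In v s -> valid (F m) v end) ->
  ratpt K inJ (fun t => eval_point (F t) e).
Proof.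
case: e => [v|s] h; first exact: (ratpt_vertex hK hO nomom mid_in).
apply: ratpt_scale => //; first by apply: ratl_const => //; apply: K_inv; apply: K_nat.
by apply: ratpt_sum => // v hv; apply: (ratpt_vertex hK hO nomom mid_in); apply: h.
Qed.

(** A segment or a point does not determine an affinity, so auxiliary corners that move rationally
    and never make the triangle flat are supplied. *)
Lemma moving_atomic e : TS_triangle (F m) e -> exists a : atomic R,
  [/\ ref_obj a = eval_tri (F m) e, time_dom a = `]x, y[, trans_over K (tfun a),
      forall t, t \in `]x, y[ -> trans_defined (tfun a) t
    & forall t, t \in `]x, y[ -> tri_at a t = eval_tri (F t) e].
Proof.
move=> he; have he' t : inJ t -> TS_triangle (F t) e.
  by move=> ht; apply: equi_TS_triangle he; apply: interval_equi.
have Jm : inJ m := mid_in.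
suff [f [fo fd ft]] : exists f : trans R, [/\ trans_over K f,
    forall t, inJ t -> trans_defined f t
  & forall t, inJ t -> forall k, trans_at f t (corner (eval_tri (F m) e) k) = corner (eval_tri (F t) e) k].
  exists (Atomic (eval_tri (F m) e) `]x, y[ f); split => //.
  move=> t ht; apply: eq_from_tnth => k; rewrite tnth_map /=; apply: ft.
  by move: ht; rewrite in_itv.
case: (proj1 (TS_triangleP (F m) e) he).
- move=> x0 s u v l h ee; have V := fan_valid h.
  have [_ _ _ [_ [us vs]] _] := h.
  have rs : ratpt K inJ (fun t => eval_point (F t) (Centroid s)) by apply: ratpt_point.
  have ru : ratpt K inJ (fun t => eval_point (F t) (Vertex u)) by apply: ratpt_point; apply: V.
  have rv : ratpt K inJ (fun t => eval_point (F t) (Vertex v)) by apply: ratpt_point; apply: V.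
  have [t ht|f [fo fd ft]] := moving_affinity rs ru rv mid_K Jm.
    have [x1 [l' h']] := equi_fan (interval_equi ht) h.
    by apply/eqP => e0; apply: (fan_nonflat h'); apply/tri_flatE.
  exists f; split => // t ht k; have [f0 f1 f2] := ft t ht; rewrite ee.
  by case: (I3_cases k) => ->; rewrite !eval_triE !mktriE.
- move=> u v h ee; have [[/subdivision_valid vu /subdivision_valid vv] _ _ _ _] := h.
  have ru : ratpt K inJ (fun t => eval_point (F t) (Vertex u)) by apply: ratpt_point.
  have rv : ratpt K inJ (fun t => eval_point (F t) (Vertex v)) by apply: ratpt_point.
  have [dx dy] := ratpt_sub hK rv ru.
  (* The third corner is obtained by turning the edge by a right angle; the cross product is then
     the squared length of the edge. *)
  have rr := ratpt_add hK ru (ratpt_mk (ratl_opp hK dy) dx).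
  have [t ht|f [fo fd ft]] := moving_affinity ru rv rr mid_K Jm.
    have [_ uv _ _ _] := equi_seg (interval_equi ht) h.
    have n0 := norm2_gt0 (sub_neq0 uv).
    rewrite gt_eqF // (_ : cross _ _ = px (eval_vertex (F t) v - eval_vertex (F t) u) * px (eval_vertex (F t) v - eval_vertex (F t) u) + py (eval_vertex (F t) v - eval_vertex (F t) u) * py (eval_vertex (F t) v - eval_vertex (F t) u)) //.
    by rewrite /cross /eval_point !ptE; ring.
  exists f; split => // t ht k; have [f0 f1 f2] := ft t ht; rewrite ee.
  by case: (I3_cases k) => ->; rewrite !eval_triE !mktriE.
- move=> i [hi _ _] ee.
  have ru : ratpt K inJ (fun t => eval_point (F t) (Vertex (Corner i k0))) by apply: ratpt_point.
  have c0 := K0 hK; have c1 := K1 hK.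
  (* A moving point carries a fixed frame, so the affinity is a translation. *)
  have r1 := ratpt_add hK ru (ratpt_const hK inJ (c := mkpt 1 0) ltac:(by rewrite ptE) ltac:(by rewrite ptE)).
  have r2 := ratpt_add hK ru (ratpt_const hK inJ (c := mkpt 0 1) ltac:(by rewrite ptE) ltac:(by rewrite ptE)).
  have [t ht|f [fo fd ft]] := moving_affinity ru r1 r2 mid_K Jm.
    rewrite (_ : cross _ _ = 1) ?oner_neq0 //; rewrite /cross !ptE; ring.
  exists f; split => // t ht k; have [f0 f1 f2] := ft t ht; rewrite ee.
  by case: (I3_cases k) => ->; rewrite !eval_triE !mktriE.
Qed.

Lemma interval_exists : exists H, triangulate_interval K O x y H.
Proof.
have [L hL] := TS_exists (F m); have h : forall e, List.In e L -> TS_triangle (F m) e by case: hL.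
suff [H hH] : exists H, List.Forall2 (fun e a => [/\ ref_obj a = eval_tri (F m) e,
    time_dom a = `]x, y[, trans_over K (tfun a),
    forall t, t \in `]x, y[ -> trans_defined (tfun a) t
  & forall t, t \in `]x, y[ -> tri_at a t = eval_tri (F t) e]) L H by exists H, L.
elim: L h {hL} => [|e L IH] h; first by exists [::]; constructor.
have [|H hH] := IH; first by move=> e' he'; apply: h; right.
have [a ha] := moving_atomic (h e (or_introl erefl)).
by exists (a :: H); constructor.
Qed.

Lemma interval_triangulation t H : triangulate_interval K O x y H -> inJ t ->
  is_triangulation [seq tri_at a t | a <- H] (snapshot O t).
Proof.
case=> L hL hH ht; have hL' : TS (F t) L := TS_equi (interval_equi ht) hL.
have -> : [seq tri_at a t | a <- H] = [seq eval_tri (F t) e | e <- L].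
  elim: hH => //= e a L' H' [_ _ _ _ h] _ ->.
  by rewrite h // in_itv.
rewrite -covered_frame /frame (active_eq hO nomom mid_in ht); exact: TS_triangulation.
Qed.

Lemma interval_atomic H : triangulate_interval K O x y H ->
  forall a, List.In a H -> atomic_object K a /\ time_dom a = `]x, y[.
Proof.
case=> L hL hH; have := over_frame hO mid_K => hD.
elim: hH => // e a L' H' [h1 h2 h3 h4 h5] _ IH b [<-|/IH //]; split => //.
split; rewrite ?h1 ?h2 //.
- by move=> k i; apply: over_tri.
- split; first by exists m; rewrite in_itv /=; apply: mid_in.
  by exists false, x, true, y.
Qed.

End Moving.

Section MomentSlice.
Variables (R : realType) (K : {pred R}) (hK : constant_field K).
Variable O : seq (atomic R).
Hypothesis hO : geometric_object K O.

Lemma tri_at_id (T : tri R) (I : interval R) t : tri_at (Atomic T I (trans_id R)) t = T.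
Proof. by apply: eq_from_tnth => k; rewrite tnth_map /= trans_id_at. Qed.

Lemma moment_triangulation t G : triangulate_moment O t G ->
  is_triangulation [seq tri_at a t | a <- G] (snapshot O t).
Proof.
case=> L hL ->; rewrite -map_comp -covered_frame.
rewrite (@eq_map _ _ _ (eval_tri (frame O t t))); first exact: TS_triangulation.
by move=> e /=; rewrite tri_at_id.
Qed.

Lemma moment_atomic t G : t \in K -> triangulate_moment O t G ->
  forall a, List.In a G -> [/\ atomic_object K a, time_dom a = `[t, t] &
    forall s, tri_at a s = ref_obj a].
Proof.
move=> tK [L hL ->] a; have hD := over_frame hK hO tK.
elim: L {hL} => //= e L IH [<-|/IH //]; split => //; last by move=> s; rewrite tri_at_id.
split => //=.
- by move=> k i; apply: (over_tri hK hD).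
- split; first by exists t; rewrite in_itv /= lexx.
  by exists true, t, false, t.
- exact: trans_id_over.
- by move=> s _; apply: trans_id_defined.
Qed.

End MomentSlice.

(** * Slices and merging *)

Section Pieces.
Variable R : realType.
Implicit Types (a b : atomic R) (s t u : R) (G H : seq (atomic R)) (D : seq (tri R)).

(** Being a triangulation depends on this set of sets only; repetitions and the order of corners are
    forgotten. *)
Definition tri_sets D : set (set (pt R)) := [set X | exists2 T, T \in D & X = tri_set T].

Lemma tri_sets_triangulation D D' X : tri_sets D = tri_sets D' ->
  is_triangulation D X -> is_triangulation D' X.
Proof.
move=> e [h1 h2].
have E T : T \in D' -> exists2 T', T' \in D & tri_set T' = tri_set T.
  move=> hT; have [T' hT' eT] : tri_sets D (tri_set T) by rewrite e; exists T.
  by exists T'.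
have E' T : T \in D -> exists2 T', T' \in D' & tri_set T' = tri_set T.
  move=> hT; have [T' hT' eT] : tri_sets D' (tri_set T) by rewrite -e; exists T.
  by exists T'.
split.
  move=> T T' /E [S hS eS] /E [S' hS' eS'] ne.
  by rewrite -(tri_interior_eq eS) -(tri_interior_eq eS'); apply: h1 => //; rewrite eS eS'.
rewrite -h2; apply/seteqP; split=> x [T hT Tx].
  by have [S hS eS] := E T hT; exists S => //; rewrite eS.
by have [S hS eS] := E' T hT; exists S => //; rewrite eS.
Qed.

Definition pieces G t : set (set (pt R)) :=
  [set X | exists a, [/\ List.In a G, t \in time_dom a & X = tri_set (tri_at a t)]].
Definition all_pieces G t : set (set (pt R)) :=
  [set X | exists2 a, List.In a G & X = tri_set (tri_at a t)].

Lemma pieces_frame G t : tri_sets (frame G t t) = pieces G t.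
Proof.
apply/seteqP; split=> X.
  by case=> T /frame_mem [a [h1 h2] ->] ->; exists a.
by case=> a [h1 h2 ->]; exists (tri_at a t) => //; apply/frame_mem; exists a.
Qed.

Lemma tri_sets_map G t : tri_sets [seq tri_at a t | a <- G] = all_pieces G t.
Proof.
apply/seteqP; split=> X.
  by case=> T /mem_map_In [a ha ->] ->; exists a.
by case=> a ha ->; exists (tri_at a t) => //; apply/mem_map_In; exists a.
Qed.

Lemma pieces_cat G H t : pieces (G ++ H) t = pieces G t `|` pieces H t.
Proof.
apply/seteqP; split=> X.
  by case=> a [/(@List.in_app_or _ _ _ _) [ha|ha] h1 h2]; [left|right]; exists a.
by case=> -[a [ha h1 h2]]; exists a; split => //; apply: List.in_or_app; [left|right].
Qed.

Lemma pieces_dom I G t : (forall a, List.In a G -> time_dom a = I) ->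
  pieces G t = if t \in I then all_pieces G t else set0.
Proof.
move=> h; case: ifP => ht; apply/seteqP; split=> X //.
- by case=> a [ha _ ->]; exists a.
- by case=> a ha ->; exists a; split => //; rewrite h.
- by case=> a [ha]; rewrite h // ht.
Qed.

Lemma itv_split (l r : itv_bound R) (b : bool) t s : (l <= BSide b t)%O -> (BSide b t <= r)%O ->
  (s \in Interval l r) = (s \in Interval l (BSide b t)) || (s \in Interval (BSide b t) r).
Proof.
move=> h1 h2; rewrite !itv_boundlr.
have e : (BRight s <= BSide b t)%O = ~~ (BSide b t <= BLeft s)%O.
  by case: (b); rewrite !bnd_simp ?leNgt ?ltNge // negbK.
rewrite e; case: (boolP (BSide b t <= BLeft s)%O) => h /=.
  by rewrite andbF /= (le_trans h1 h).
have h3 : (BRight s <= BSide b t)%O by rewrite e.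
by rewrite andbT orbF (le_trans h3 h2) andbT.
Qed.

Lemma itv_disjoint (l r : itv_bound R) (b : bool) t s :
  s \in Interval l (BSide b t) -> (s \in Interval (BSide b t) r) = false.
Proof.
rewrite !itv_boundlr => /andP [_ h]; apply/negbTE; rewrite negb_and.
by move: h; case: (b); rewrite !bnd_simp ?leNgt ?ltNge => h; rewrite h.
Qed.

(** The common part of the three merging rules: [M] is the list that is kept, and it has to agree
    with [G] before the cut and with [H] after it. The Boolean [b] decides which of the two
    intervals contains [t]. *)
Lemma pieces_merge (l r : itv_bound R) (b : bool) t G H M s :
  (l <= BSide b t)%O -> (BSide b t <= r)%O ->
  (forall a, List.In a G -> time_dom a = Interval l (BSide b t)) ->
  (forall a, List.In a H -> time_dom a = Interval (BSide b t) r) ->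
  (s \in Interval l (BSide b t) -> all_pieces M s = all_pieces G s) ->
  (s \in Interval (BSide b t) r -> all_pieces M s = all_pieces H s) ->
  pieces (map (set_time_dom (Interval l r)) M) s = pieces (G ++ H) s.
Proof.
move=> h1 h2 hG hH mG mH.
rewrite pieces_cat (@pieces_dom _ G s hG) (@pieces_dom _ H s hH).
rewrite (@pieces_dom (Interval l r)); last by move=> a /List.in_map_iff [a' [<-]].
have -> : all_pieces (map (set_time_dom (Interval l r)) M) s = all_pieces M s.
  apply/seteqP; split=> X; first by case=> a /List.in_map_iff [a' [<- ha]] ->; exists a'.
  by case=> a ha ->; exists (set_time_dom (Interval l r) a) => //; apply: List.in_map.
rewrite (itv_split s h1 h2).
case: (boolP (s \in Interval l (BSide b t))) => hs /=.
  by rewrite (itv_disjoint _ hs) setU0 mG.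
by case: ifP => hs'; rewrite set0U // mH.
Qed.

Lemma matching_pieces (same : atomic R -> atomic R -> Prop) (P : Type) (f g : atomic R -> P)
    G H M X : @matching R G H same M ->
  (forall i, f (tnth (in_tuple G) i) = g (tnth (in_tuple H) (M i))) ->
  (exists2 a, List.In a G & X = f a) <-> (exists2 a, List.In a H & X = g a).
Proof.
move=> [[N MN NM] _] h; split=> -[a ha ->]; have [i <-] := In_tnth ha.
  by exists (tnth (in_tuple H) (M i)); [apply: tnth_In|rewrite h].
by exists (tnth (in_tuple G) (N i)); [apply: tnth_In|rewrite h NM].
Qed.

End Pieces.

Section Merging.
Variables (R : realType) (K : {pred R}).
Implicit Types (a b : atomic R) (s t u : R) (G H : seq (atomic R)) (e : slice R) (E : seq (slice R)).

(** The last clause reflects that objects at a single moment do not move: extension to a moment is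
    tested against their reference objects, which must be the sets they occupy. *)
Definition good_slice e := [/\ time_interval K e.1,
  forall a, List.In a e.2 -> atomic_object K a /\ time_dom a = e.1
  & forall t, e.1 = `[t, t] -> forall a, List.In a e.2 ->
      tri_set (tri_at a t) = tri_set (ref_obj a)].

Lemma merged_atomic I J G : time_interval K I ->
  (forall a, List.In a G -> atomic_object K a /\ time_dom a = J) ->
  (forall a s, List.In a G -> s \in I -> s \notin J -> trans_defined (tfun a) s) ->
  forall a, List.In a (map (set_time_dom I) G) -> atomic_object K a /\ time_dom a = I.
Proof.
move=> hI hG hd _ /List.in_map_iff [a [<- ha]]; split => //.
have [[h1 h2 h3 h4] hJ] := hG a ha; split => //= t ht.
case: (boolP (t \in J)) => tJ; first by apply: h4; rewrite hJ.
exact: hd.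
Qed.

Lemma time_intervalP (b1 b2 : bool) x y : time_interval K (Interval (BSide b1 x) (BSide b2 y)) ->
  x \in K /\ y \in K.
Proof. by case=> _ [bx [u [b_y [v [[_ -> _ ->] hu hv]]]]]. Qed.

Lemma time_interval_mk (b1 b2 : bool) x y : x < y -> x \in K -> y \in K ->
  time_interval K (Interval (BSide b1 x) (BSide b2 y)).
Proof.
move=> xy hx hy; split; last by exists b1, x, b2, y.
exists ((x + y) / 2); have h1 : x < (x + y) / 2 by lra.
have h2 : (x + y) / 2 < y by lra.
rewrite itv_boundlr; apply/andP; split.
  by case: b1; rewrite !bnd_simp // ltW.
by case: b2; rewrite !bnd_simp // ltW.
Qed.

Lemma not_singleton (b1 b2 : bool) x y t : x < y ->
  Interval (BSide b1 x) (BSide b2 y) <> `[t, t].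
Proof. by move=> xy [_ e1 _ e2]; move: xy; rewrite e1 e2 ltxx. Qed.

Lemma merge2_good e1 e2 e : good_slice e1 -> good_slice e2 -> merge2 e1 e2 e ->
  good_slice e /\ forall s, pieces e.2 s = pieces (e1.2 ++ e2.2) s.
Proof.
move=> g1 g2 h; case: h g1 g2.
- move=> t u b G H tu [hd [M hM]] I [/= i1 a1 r1] [/= i2 a2 r2].
  have [tK _] := time_intervalP i1; have [_ uK] := time_intervalP i2.
  have hI : time_interval K I by apply: time_interval_mk.
  have l1 : (BLeft t <= BRight t :> itv_bound R)%O by rewrite bnd_simp.
  have l2 : (BRight t <= BSide b u)%O by case: (b); rewrite bnd_simp // ltW.
  split; first split => //=.
  + apply: (merged_atomic hI a2) => a s ha hs hs'.
    move: hs; rewrite (itv_split s l1 l2) (negPf hs') orbF in_itv /= => hs.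
    have -> : s = t by apply/eqP; rewrite eq_le andbC.
    exact: hd.
  + by move=> s /not_singleton; case.
  + move=> s; apply: (pieces_merge l1 l2) => //; try by move=> a; [move/a1|move/a2]; case.
      by move=> a /a1 [].
    by move=> a /a2 [].
    rewrite in_itv /= => hs; have -> : s = t by apply/eqP; rewrite eq_le andbC.
    apply/seteqP; split=> X; apply (matching_pieces X hM) => i;
    rewrite (r1 t erefl (tnth (in_tuple G) (M i))) //; try exact: tnth_In;
    by apply/(proj2 hM i (M i)).
- move=> t u b G H ut [hd [M hM]] I [/= i1 a1 r1] [/= i2 a2 r2].
  have [uK _] := time_intervalP i1; have [tK _] := time_intervalP i2.
  have hI : time_interval K I by apply: time_interval_mk.
  have l1 : (BSide b u <= BLeft t)%O by case: (b); rewrite bnd_simp // ltW.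
  have l2 : (BLeft t <= BRight t :> itv_bound R)%O by rewrite bnd_simp.
  split; first split => //=.
  + apply: (merged_atomic hI a1) => a s ha hs hs'.
    move: hs; rewrite (itv_split s l1 l2) (negPf hs') /= in_itv /= => hs.
    have -> : s = t by apply/eqP; rewrite eq_le andbC.
    exact: hd.
  + by move=> s /not_singleton; case.
  + move=> s; apply: (pieces_merge l1 l2) => //.
      by move=> a /a1 [].
    by move=> a /a2 [].
    rewrite in_itv /= => hs; have -> : s = t by apply/eqP; rewrite eq_le andbC.
    apply/seteqP; split=> X; apply (matching_pieces X hM) => i;
    rewrite (r2 t erefl (tnth (in_tuple H) (M i))) //; try exact: tnth_In;
    by apply/(proj2 hM i (M i)).
- move=> bx x b t b_y y G H xt ty [d1 d2 d3 [M [hM hs]]] I [/= i1 a1 r1] [/= i2 a2 r2].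
  have [xK _] := time_intervalP i1; have [_ yK] := time_intervalP i2.
  have hI : time_interval K I by apply: time_interval_mk => //; apply: lt_trans ty.
  have l1 : (BSide bx x <= BSide b t)%O.
    by apply: (@le_trans _ _ (BLeft t)); case: (bx); case: (b); rewrite bnd_simp // ?ltW.
  have l2 : (BSide b t <= BSide b_y y)%O.
    by apply: (@le_trans _ _ (BRight t)); case: (b_y); case: (b); rewrite bnd_simp // ?ltW.
  split; first split => //=.
  + apply: (merged_atomic hI a1) => a s ha hs1 hs2.
    apply: d1 => //; move: hs1; by rewrite (itv_split s l1 l2) (negPf hs2).
  + by move=> s /not_singleton; case; apply: lt_trans ty.
  + move=> s; apply: (pieces_merge l1 l2) => //.
      by move=> a /a1 [].
    by move=> a /a2 [].
    (* On the second interval the objects of [G] replace those of [H]; [same_motion] says that they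
       occupy the same sets, via the affinity between the reference objects. *)
    move=> hs2; have sI : s \in I by rewrite (itv_split s l1 l2) hs2 orbT.
    apply/seteqP; split=> X; apply (matching_pieces X hM) => i;
    have [P [v [_ eP hm]]] := hs i; rewrite !tri_at_set -eP;
    apply/seteqP; split=> z.
    * by case=> w hw <-; exists (P *m w + v); [exists w|rewrite hm].
    * by case=> _ [w hw <-] <-; exists w => //; rewrite hm.
    * by case=> w hw <-; exists (P *m w + v); [exists w|rewrite hm].
    * by case=> _ [w hw <-] <-; exists w => //; rewrite hm.
Qed.

Lemma merging_good E E' : merging E E' -> (forall e, List.In e E -> good_slice e) ->
  (forall e, List.In e E' -> good_slice e) /\
  forall s, pieces (flatten (map snd E')) s = pieces (flatten (map snd E)) s.
Proof.
elim=> [||e1 e2 e s E1 h _ IH|e1 e2 s E1 _ _ IH].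
- by [].
- by [].
- move=> hg; have [ge pe] := merge2_good (hg e1 (or_introl erefl)) (hg e2 (or_intror (or_introl erefl))) h.
  have [|g p] := IH.
    by move=> e' [<-|he'] //; apply: hg; right; right.
  split => // z; rewrite p /= catA (pieces_cat (_ ++ _)) -pe.
  by rewrite (pieces_cat e.2).
- move=> hg; have [|g p] := IH; first by move=> e he; apply: hg; right.
  split; first by move=> e [<-|/g //]; apply: hg; left.
  by move=> z; rewrite /= !(pieces_cat e1.2) p.
Qed.

Lemma merging_exists E : exists E', merging E E'.
Proof.
have [n] := ubnP (size E); elim: n E => // n IH [|e1 [|e2 E]] hn.
- by exists [::]; constructor.
- by exists [:: e1]; constructor.
- case: (pselect (exists e, merge2 e1 e2 e)) => [[e he]|h].
    have [|E' hE'] := IH (e :: E); first by move: hn.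
    by exists E'; apply: merge_yes he hE'.
  have [|E' hE'] := IH (e2 :: E); first by move: hn.
  by exists (e1 :: E'); apply: merge_no hE' => e he; apply: h; exists e.
Qed.

End Merging.

(** * The procedure as a whole: existence and correctness of its result *)

Section Triangulate.
Variables (R : realType) (K : {pred R}) (hK : constant_field K).
Variable O : seq (atomic R).
Hypothesis hO : geometric_object K O.
Implicit Types (t u z : R) (s chi : seq R) (E : seq (slice R)).

(** The invariant of the recursion along the partition: from [t] on, no moment is missing. *)
Definition complete_from t s := [/\ path <%R t s, forall z, z \in t :: s -> z \in K
  & forall z, moment O z -> t <= z -> z \in t :: s].

Lemma complete_gap t u s : complete_from t (u :: s) ->
  [/\ t < u, forall z, t < z < u -> ~ moment O z & complete_from u s].
Proof.
case=> /= /andP [tu pu] hk hm; split => //.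
  move=> z /andP [tz zu] /hm; rewrite (ltW tz) !inE => /(_ isT).
  rewrite (gt_eqF tz) (lt_eqF zu) /= => /(allP (order_path_min lt_trans pu)) /=.
  by rewrite ltNge (ltW zu).
split=> //.
  by move=> z hz; apply: hk; rewrite inE hz orbT.
move=> z mz uz; have := hm z mz; rewrite (le_trans (ltW tu) uz) inE => /(_ isT).
by rewrite gt_eqF // (lt_le_trans tu uz).
Qed.

Lemma path_last t s : path <%R t s -> t <= last t s.
Proof.
elim: s t => //= u s IH t /andP [tu /IH h]; exact: le_trans (ltW tu) h.
Qed.

Definition triangulated_at (G : seq (atomic R)) z := exists2 D,
  is_triangulation D (snapshot O z) & tri_sets D = pieces G z.

(** The last clause confines the slices in time; in the induction it shows that at a given time only
    one of the moment, the gap and the remaining slices contributes triangles. *)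
Lemma triangulate_good chi E : triangulate K O chi E ->
  forall t s, chi = t :: s -> complete_from t s ->
  [/\ forall e, List.In e E -> good_slice K e,
      forall z, t <= z <= last t s -> triangulated_at (flatten (map snd E)) z
    & forall z X, pieces (flatten (map snd E)) z X -> t <= z <= last t s].
Proof.
have gm t G : t \in K -> triangulate_moment O t G -> good_slice K (`[t, t], G).
  move=> tK h; have hG := moment_atomic hK hO tK h; split => /=.
  - by split; [exists t; rewrite in_itv /= lexx|exists true, t, false, t].
  - by move=> a /hG [].
  - by move=> u _ a /hG [_ _ ->].
have pm t G z : t \in K -> triangulate_moment O t G ->
    pieces G z = if z == t then all_pieces G t else set0.
  move=> tK h; have hG := moment_atomic hK hO tK h.
  rewrite (@pieces_dom _ `[t, t]); last by move=> a /hG [].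
  rewrite in_itv /= -eq_le eq_sym; by case: eqP => // ->.
have tm t G : triangulate_moment O t G ->
    exists2 D, is_triangulation D (snapshot O t) & tri_sets D = all_pieces G t.
  move=> h; exists [seq tri_at a t | a <- G]; last exact: tri_sets_map.
  exact: moment_triangulation h.
elim=> [//|t G hG t' s [<- <-] [_ hk _]|t u s G H E1 hG hH _ IH t' s' [<- <-] hc].
  have tK : t \in K by apply: hk; rewrite inE eqxx.
  rewrite /= cats0; split.
  - by move=> e [<-|//]; apply: gm.
  - move=> z; rewrite -eq_le => /eqP <-; have [D h1 h2] := tm _ _ hG.
    by exists D => //; rewrite (pm t) // eqxx.
  - move=> z X; rewrite (pm t) //; case: eqP => // -> _; by rewrite lexx.
have [tu gap hu] := complete_gap hc; have [gE tE dE] := IH u s erefl hu.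
have tK : t \in K by case: hc => _ hk _; apply: hk; rewrite inE eqxx.
have uK : u \in K by case: hu => _ hk _; apply: hk; rewrite inE eqxx.
have ul : u <= last u s by case: hu => pu _ _; apply: path_last.
have hHa := interval_atomic hK hO tu tK uK hH.
have pH z : pieces H z = if t < z < u then all_pieces H z else set0.
  rewrite (@pieces_dom _ `]t, u[); last by move=> a /hHa [].
  by rewrite in_itv.
have out z : ~~ (u <= z) -> pieces (flatten (map snd E1)) z = set0.
  move=> hz; rewrite -subset0 => X /dE /andP [uz _]; by rewrite uz in hz.
split.
- move=> e [<-|[<-|/gE //]]; first exact: gm.
  split => /=.
  + split; last by exists false, t, true, u.
    exists ((t + u) / 2); rewrite in_itv /=; clear - tu; apply/andP; split; lra.
  + by move=> a /hHa.
  + by move=> z [].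
- move=> z /= /andP [tz zl]; rewrite /triangulated_at !pieces_cat pH (pm t) //.
  case: (ltrP z u) => zu.
    rewrite (out z) ?setU0 -?ltNge //.
    have [->|zt] := eqVneq z t.
      by rewrite ltxx setU0; apply: tm.
    have tz' : t < z by rewrite lt_neqAle eq_sym zt.
    rewrite tz' set0U; exists [seq tri_at a z | a <- H]; last exact: tri_sets_map.
    by apply: (interval_triangulation hK hO gap tu hH); rewrite /= tz' zu.
  have -> : (z == t) = false by rewrite gt_eqF // (lt_le_trans tu zu).
  rewrite andbF !set0U; apply: tE; by rewrite zu zl.
- move=> z X /=; rewrite !pieces_cat pH (pm t) // => -[|[]].
  + by case: eqP => // -> _; rewrite lexx /= (le_trans (ltW tu) ul).
  + case: ifP => // /andP [h1 h2] _; rewrite (ltW h1) /=; exact: le_trans (ltW h2) ul.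
  + move=> /dE /andP [h1 h2]; by rewrite h2 (le_trans (ltW tu) h1).
Qed.

Lemma triangulate_exists t s : complete_from t s -> exists E, triangulate K O (t :: s) E.
Proof.
elim: s t => [|u s IH] t hc.
  by have [G hG] := moment_exists O t; exists [:: (`[t, t], G)]; constructor.
have [tu gap hu] := complete_gap hc; have [E hE] := IH u hu.
have tK : t \in K by case: hc => _ hk _; apply: hk; rewrite inE eqxx.
have uK : u \in K by case: hu => _ hk _; apply: hk; rewrite inE eqxx.
have [G hG] := moment_exists O t.
have [H hH] := interval_exists hK hO gap tu tK uK.
by exists [:: (`[t, t], G), (`]t, u[, H) & E]; constructor.
Qed.

Lemma partition_complete t s : time_partition O (t :: s) -> complete_from t s.
Proof.
case=> hs hm; split => //.
  by move=> z /hm; apply: moment_K.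
by move=> z /hm.
Qed.

Lemma dom_moments a z : List.In a O -> z \in time_dom a ->
  exists x y, [/\ moment O x, moment O y & x <= z <= y].
Proof.
move=> ha hz; have [_ [_ [bx [x [b_y [y [e xK yK]]]]]] _ _] := hO ha.
exists x, y; split.
- by constructor 1; exists a => //; exists bx, (BSide b_y y); left.
- by constructor 1; exists a => //; exists b_y, (BSide bx x); right.
- move: hz; rewrite e itv_boundlr => /andP [h1 h2]; apply/andP; split.
    by case: bx {e} h1; rewrite bnd_simp // => /ltW.
  by case: b_y {e} h2; rewrite bnd_simp // => /ltW.
Qed.

Lemma partition_span t s z x y : time_partition O (t :: s) -> moment O x -> moment O y ->
  x <= z <= y -> t <= z <= last t s.
Proof.
move=> [/= hs hm] /hm hx /hm hy /andP [xz zy]; apply/andP; split.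
  apply: le_trans xz; move: hx; rewrite inE => /orP [/eqP -> //|hx].
  exact: ltW (allP (order_path_min lt_trans hs) x hx).
apply: le_trans zy _; elim: (s) t hs hy {hm hx} => [|u s' IH] t0 /=.
  by rewrite inE => _ /eqP ->.
move=> /andP [tu pu]; rewrite inE => /orP [/eqP ->|hy]; last exact: IH.
exact: le_trans (ltW tu) (path_last pu).
Qed.

Lemma TST_exists : exists G, TST K O G.
Proof.
have [chi hchi] := time_partition_exists hK hO.
have [E hE] : exists E, triangulate K O chi E.
  case: chi hchi => [|t s] h; first by exists [::]; constructor.
  exact: triangulate_exists (partition_complete h).
have [E' hE'] := merging_exists E.
exists (flatten (map snd (if (1 < size chi)%N then E' else E))).
exists chi, E, (if (1 < size chi)%N then E' else E); split => //.
by case: (1 < size chi)%N hE => // hE.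
Qed.

Lemma TST_correct G : TST K O G -> st_triangulation K O G.
Proof.
case=> chi [E [E' [hchi hE hm ->]]].
have snapE H t : snapshot H t = [set x : pt R | st H (x, t)] by [].
(* An empty partition means an empty object, since the end points of any time domain would be
   moments. *)
case: chi hchi hE hm => [|t0 s0] hchi hE hm.
  have O0 a : ~ List.In a O.
    move=> ha; have [_ [[z hz] _] _ _] := hO ha; have [x [y [mx _ _]]] := dom_moments ha hz.
    by have := proj2 (proj2 hchi x) mx.
  have -> : E' = [::] by rewrite hm; inversion hE.
  split => //=.
    by move=> t [a [b [u [v [/O0]]]]].
  by apply/seteqP; split=> z [a ha]; [case: (O0 a)|].
have hc := partition_complete hchi.
have [gE tE dE] := triangulate_good hE erefl hc.
have [gE' pE'] : (forall e, List.In e E' -> good_slice K e) /\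
    forall z, pieces (flatten (map snd E')) z = pieces (flatten (map snd E)) z.
  move: hm; case: ifP => _ hm; last by rewrite hm.
  exact: merging_good hm gE.
set G0 := flatten _ in tE dE pE'; set G' := flatten _ in pE' *.
have tri t : t0 <= t <= last t0 s0 -> is_triangulation (frame G' t t) (snapshot O t).
  move=> /tE [D h1 h2]; apply: tri_sets_triangulation h1.
  by rewrite h2 pieces_frame pE'.
(* Outside the span of the partition both snapshots are empty: the output by the confinement of its
   slices, the input because the ends of its time domains are moments. *)
have snapG t : snapshot G' t = snapshot O t.
  case: (boolP (t0 <= t <= last t0 s0)) => ht.
    by rewrite -covered_frame; case: (tri t ht).
  apply/seteqP; split=> x [a ha [ta hx]]; exfalso; move/negP: ht; apply.
    by apply: (dE t (tri_set (tri_at a t))); rewrite -pE'; exists a.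
  have [y [z [my mz hyz]]] := dom_moments ha ta.
  exact: partition_span hchi my mz hyz.
split.
- move=> a; rewrite /G'; elim: (E') gE' => //= e E1 IH h /(@List.in_app_or _ _ _ _) [ha|].
    by have [_ h2 _] := h e (or_introl erefl); case: (h2 a ha).
  by apply: IH => e' he'; apply: h; right.
- move=> t [a [b [s [u [ha hb hs hu /andP [st tu]]]]]]; apply: tri.
  have [x [_ [mx _ /andP [xs _]]]] := dom_moments ha hs.
  have [_ [y [_ my /andP [_ uy]]]] := dom_moments hb hu.
  by apply: (partition_span hchi mx my); rewrite (le_trans xs st) (le_trans tu uy).
- apply/seteqP; split=> -[x t] h.
    by have : snapshot G' t x by rewrite snapG.
  by have : snapshot O t x by rewrite -snapG.
Qed.

End Triangulate.

Theorem mainTheorem12 (R : realType) (K : {pred R}) (hK : constant_field K)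
    (O : seq (atomic R)) (hO : geometric_object K O) :
  (exists G : seq (atomic R), TST K O G) /\
  (forall G : seq (atomic R), TST K O G -> st_triangulation K O G).
Proof. by split; [exact: TST_exists|move=> G; exact: TST_correct]. Qed.
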